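(* Let $a<b$ be real numbers and let $\gamma:[a,b]\to U$ be a piecewise $C^1$ curve such that $\gamma_a=\mathbf 1$, $$\int_a^b\phi_+(\dot\gamma_t\gamma_t^{-1})\,dt<\pi\quad\text{and}\quad\int_a^b\phi_-(\dot\gamma_t\gamma_t^{-1})\,dt>-\pi.$$ Then $-1\notin\operatorname{spec}(\gamma_b)$ and $$\theta_+(\gamma_b)\leq\int_a^b\phi_+(\dot\gamma_t\gamma_t^{-1})\,dt\quad\text{and}\quad\theta_-(\gamma_b)\geq\int_a^b\phi_-(\dot\gamma_t\gamma_t^{-1})\,dt.$$ If $\theta_+(\gamma_b)=\int_a^b\phi_+(\dot\gamma_t\gamma_t^{-1})\,dt$, then $$\mathcal H_+(\gamma_b)=\bigcap_{t\in[a,b]}\mathcal H_+(\dot\gamma_t\gamma_t^{-1})=\bigcap_{t\in[a,b]}\mathcal H_+(\gamma_t^{-1}\dot\gamma_t),$$ and if $\theta_-(\gamma_b)=\int_a^b\phi_-(\dot\gamma_t\gamma_t^{-1})\,dt$, then $$\mathcal H_-(\gamma_b)=\bigcap_{t\in[a,b]}\mathcal H_-(\dot\gamma_t\gamma_t^{-1})=\bigcap_{t\in[a,b]}\mathcal H_-(\gamma_t^{-1}\dot\gamma_t).$$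
   Context: $\mathcal H$ is a nonzero separable complex Hilbert space (possibly infinite dimensional), $U$ is the group of unitary operators on $\mathcal H$ with the operator-norm topology, $\mathbf 1$ is the identity operator, and $\operatorname{spec}$ denotes the spectrum of a bounded operator. A curve $\gamma:[a,b]\to U$, $t\mapsto\gamma_t$, is piecewise $C^1$ if it is continuous and there is a finite partition of $[a,b]$ such that $\gamma$ is $C^1$ (for the operator norm) on each closed subinterval of the partition; $\dot\gamma_t$ is its derivative. The skew-hermitian operators $\dot\gamma_t\gamma_t^{-1}$ and $\gamma_t^{-1}\dot\gamma_t$ are the right and left logarithmic derivatives. In the intersections over $t\in[a,b]$, the finitely many interior partition points, where $\dot\gamma_t$ may be undefined, are omitted (one-sided derivatives are used at $a$ and $b$). For a unitary operator $u$ with $-1\notin\operatorname{spec}(u)$, let $\log(u)$ be defined by the principal branch of the logarithm, and set $$\theta_+(u)=\max\operatorname{spec}(-i\log(u)),\qquad\theta_-(u)=\min\operatorname{spec}(-i\log(u)),$$ $$\mathcal H_\pm(u)=\{\xi\in\mathcal H:u\xi=e^{i\theta_\pm(u)}\xi\}.$$ For a bounded skew-hermitian operator $x$ on $\mathcal H$, set $$\phi_+(x)=\max\operatorname{spec}(-ix),\qquad\phi_-(x)=\min\operatorname{spec}(-ix),$$ $$\mathcal H_\pm(x)=\{\xi\in\mathcal H:x\xi=i\phi_\pm(x)\xi\}.$$ In the claim, $\mathcal H_\pm(\gamma_b)$ is taken in the sense for unitary operators, and $\mathcal H_\pm$ of a logarithmic derivative in the sense for skew-hermitian operators. These eigenspaces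 may be $\{0\}$. *)

(* Defs.v *)
From HB Require Import structures.
From mathcomp Require Import all_boot all_order all_algebra.
From mathcomp Require Import sesquilinear.
From mathcomp Require Import complex.
From mathcomp Require Import all_classical all_reals all_analysis.
Set Implicit Arguments.
Unset Strict Implicit.
Unset Printing Implicit Defensive.
Import Order.TTheory GRing.Theory Num.Def Num.Theory.
Import numFieldNormedType.Exports.
Local Open Scope classical_set_scope.
Local Open Scope ring_scope.

(* Bounded operators on a complex normed space: a ring under composition,
   normed by the operator norm. The ring is only a pzRingType, since 1 = 0
   when the space is zero. *)
Section BoundedOperators.
Variables (R : realType) (H : normedModType R[i]).

Record bop := Bop {
  bop_fun :> H -> H ;
  bop_linear : linear bop_fun ;
  bop_bounded : exists M : R, forall x, `|bop_fun x| <= M%:C%C * `|x| }.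

Lemma bop_ext (f g : bop) : (forall x, f x = g x) -> f = g.
Proof.
case: f => f fl fb; case: g => g gl gb /= fg.
have e : f = g by apply/funext.
by subst g; congr Bop; exact: Prop_irrelevance.
Qed.

HB.instance Definition _ := gen_eqMixin bop.
HB.instance Definition _ := gen_choiceMixin bop.

Let nrm (x : H) : R := complex.Re `|x|.

Let nrmE x : `|x| = (nrm x)%:C%C.
Proof. by rewrite /nrm RRe_real// normr_real. Qed.

Let nrm_ge0 x : 0 <= nrm x.
Proof. by rewrite -lecR -nrmE normr_ge0. Qed.

Let nrmD x y : nrm (x + y) <= nrm x + nrm y.
Proof. by have := ler_normD x y; rewrite !nrmE -rmorphD lecR. Qed.

Let RReK (k : R[i]) : `|k| = (complex.Re `|k|)%:C%C.
Proof. by rewrite RRe_real// normr_real. Qed.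

Let nrmZ (k : R[i]) x : nrm (k *: x) = complex.Re `|k| * nrm x.
Proof.
apply: (@complexI R).
by have := normrZ k x; rewrite !nrmE RReK -rmorphM => ->.
Qed.

Let bopP (f : bop) : exists2 M : R, 0 <= M & forall x, nrm (f x) <= M * nrm x.
Proof.
have [M fM] := bop_bounded f; exists `|M| => // x.
have := fM x; rewrite !nrmE -rmorphM lecR => /le_trans; apply.
by rewrite ler_wpM2r// ler_norm.
Qed.

Let bopI (f : H -> H) (M : R) : (forall x, nrm (f x) <= M * nrm x) ->
  exists M : R, forall x, `|f x| <= M%:C%C * `|x|.
Proof. by move=> fM; exists M => x; rewrite !nrmE -rmorphM lecR. Qed.

Lemma bop0 (f : bop) : f 0 = 0.
Proof.
have := bop_linear f 1 0 0; rewrite !scale1r addr0 => /eqP.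
by rewrite -subr_eq subrr eq_sym => /eqP.
Qed.

Lemma bopD (f : bop) x y : f (x + y) = f x + f y.
Proof. by rewrite -{1}[x]scale1r bop_linear scale1r. Qed.

Lemma bopZ (f : bop) (k : R[i]) x : f (k *: x) = k *: f x.
Proof. by rewrite -[k *: x]addr0 bop_linear bop0 addr0. Qed.

Let zero_linear : linear (fun _ : H => 0 : H).
Proof. by move=> k x y; rewrite scaler0 addr0. Qed.
Let zero_bounded : exists M : R, forall x : H, `|0 : H| <= M%:C%C * `|x|.
Proof. by exists 0 => x; rewrite normr0 mul0r. Qed.
Definition bop_zero := Bop zero_linear zero_bounded.

Let opp_linear (f : bop) : linear (fun x => - f x).
Proof. by move=> k x y; rewrite bop_linear opprD scalerN. Qed.
Let opp_bounded (f : bop) : exists M : R, forall x, `|- f x| <= M%:C%C * `|x|.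
Proof. by have [M fM] := bop_bounded f; exists M => x; rewrite normrN. Qed.
Definition bop_opp f := Bop (opp_linear f) (opp_bounded f).

Let add_linear (f g : bop) : linear (fun x => f x + g x).
Proof. by move=> k x y; rewrite !bop_linear scalerDr addrACA. Qed.
Let add_bounded (f g : bop) :
  exists M : R, forall x, `|f x + g x| <= M%:C%C * `|x|.
Proof.
have [M _ fM] := bopP f; have [N _ gN] := bopP g; apply: (@bopI _ (M + N)) => x.
by rewrite (le_trans (nrmD _ _))// mulrDl lerD.
Qed.
Definition bop_add f g := Bop (add_linear f g) (add_bounded f g).

Let scale_linear (k : R[i]) (f : bop) : linear (fun x => k *: f x).
Proof. by move=> l x y; rewrite bop_linear scalerDr !scalerA (mulrC k). Qed.
Let scale_bounded (k : R[i]) (f : bop) :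
  exists M : R, forall x, `|k *: f x| <= M%:C%C * `|x|.
Proof.
have [M _ fM] := bopP f; apply: (@bopI _ (complex.Re `|k| * M)) => x.
rewrite nrmZ -mulrA ler_wpM2l//.
by rewrite -lecR RRe_real ?normr_real// normr_ge0.
Qed.
Definition bop_scale k f := Bop (scale_linear k f) (scale_bounded k f).

Let id_linear : linear (fun x : H => x). Proof. by []. Qed.
Let id_bounded : exists M : R, forall x : H, `|x| <= M%:C%C * `|x|.
Proof. by exists 1 => x; rewrite mul1r. Qed.
Definition bop_one := Bop id_linear id_bounded.

Let comp_linear (f g : bop) : linear (fun x => f (g x)).
Proof. by move=> k x y; rewrite !bop_linear. Qed.
Let comp_bounded (f g : bop) :
  exists M : R, forall x, `|f (g x)| <= M%:C%C * `|x|.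
Proof.
have [M M0 fM] := bopP f; have [N _ gN] := bopP g; apply: (@bopI _ (M * N)) => x.
by rewrite (le_trans (fM _))// -mulrA ler_wpM2l.
Qed.
Definition bop_mul f g := Bop (comp_linear f g) (comp_bounded f g).

Let addA : associative bop_add.
Proof. by move=> f g h; apply: bop_ext => x /=; rewrite addrA. Qed.
Let addC : commutative bop_add.
Proof. by move=> f g; apply: bop_ext => x /=; rewrite addrC. Qed.
Let add0 : left_id bop_zero bop_add.
Proof. by move=> f; apply: bop_ext => x /=; rewrite add0r. Qed.
Let addN : left_inverse bop_zero bop_opp bop_add.
Proof. by move=> f; apply: bop_ext => x /=; rewrite addNr. Qed.
HB.instance Definition _ := GRing.isZmodule.Build bop addA addC add0 addN.

Let scaleA k l (f : bop) : bop_scale k (bop_scale l f) = bop_scale (k * l) f.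
Proof. by apply: bop_ext => x /=; rewrite scalerA. Qed.
Let scale1 : left_id 1 bop_scale.
Proof. by move=> f; apply: bop_ext => x /=; rewrite scale1r. Qed.
Let scaleDr : right_distributive bop_scale +%R.
Proof. by move=> k f g; apply: bop_ext => x /=; rewrite scalerDr. Qed.
Let scaleDl (f : bop) :
  {morph bop_scale^~ f : k l / k + l >-> k + l}.
Proof. by move=> k l; apply: bop_ext => x /=; rewrite scalerDl. Qed.
HB.instance Definition _ :=
  GRing.Zmodule_isLmodule.Build R[i] bop scaleA scale1 scaleDr scaleDl.

Let mulA : associative bop_mul.
Proof. by move=> f g h; exact: bop_ext. Qed.
Let mul1 : left_id bop_one bop_mul.
Proof. by move=> f; exact: bop_ext. Qed.
Let mulr1' : right_id bop_one bop_mul.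
Proof. by move=> f; exact: bop_ext. Qed.
Let mulDl : left_distributive bop_mul +%R.
Proof. by move=> f g h; exact: bop_ext. Qed.
Let mulDr : right_distributive bop_mul +%R.
Proof. by move=> f g h; apply: bop_ext => x /=; rewrite bopD. Qed.
HB.instance Definition _ :=
  GRing.Zmodule_isPzRing.Build bop mulA mul1 mulr1' mulDl mulDr.

Definition opnorm (f : bop) : R :=
  sup [set complex.Re `|f x| | x in [set x : H | `|x| <= 1]].

Let unitball x : (`|x| <= 1 :> R[i]) = (nrm x <= 1).
Proof. by rewrite nrmE -lecR. Qed.

Let opnorm_has_sup (f : bop) :
  has_sup [set complex.Re `|f x| | x in [set x : H | `|x| <= 1]].
Proof.
split; first by exists (complex.Re `|f 0|), 0 => //=; rewrite normr0.
have [M M0 fM] := bopP f; exists M => _ [x /= x1 <-].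
by rewrite (le_trans (fM _))// ler_piMr// -unitball.
Qed.

Let opnorm_ub (f : bop) x : nrm x <= 1 -> nrm (f x) <= opnorm f.
Proof.
move=> x1; apply: ub_le_sup; first exact: (opnorm_has_sup f).2.
by exists x => //=; rewrite unitball.
Qed.

Let opnorm_le (f : bop) (M : R) :
  (forall x, nrm x <= 1 -> nrm (f x) <= M) -> opnorm f <= M.
Proof.
move=> fM; apply: ge_sup; first exact: (opnorm_has_sup f).1.
by move=> _ [x /= x1 <-]; apply: fM; rewrite -unitball.
Qed.

Lemma opnormP (f : bop) x : `|f x| <= (opnorm f)%:C%C * `|x|.
Proof.
rewrite !nrmE -rmorphM lecR; have [->|x0] := eqVneq x 0.
  by rewrite bop0 {1 2}/nrm normr0/= mulr0.
have nx0 : 0 < nrm x by rewrite -ltcR -nrmE normr_gt0.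
set k : R[i] := ((nrm x)^-1)%:C%C.
have kE : complex.Re `|k| = (nrm x)^-1.
  by rewrite ger0_norm// lecR invr_ge0.
have /(opnorm_ub f) : nrm (k *: x) <= 1 by rewrite nrmZ kE mulVf// gt_eqF.
by rewrite bopZ nrmZ kE mulrC ler_pdivrMr.
Qed.

Let norm_triangle (f g : bop) :
  (opnorm (f + g))%:C%C <= (opnorm f)%:C%C + (opnorm g)%:C%C :> R[i].
Proof.
rewrite -rmorphD lecR; apply: opnorm_le => x x1.
by rewrite (le_trans (nrmD _ _))// lerD// opnorm_ub.
Qed.

Let opnorm_homo (k : R[i]) (f : bop) :
  opnorm (k *: f) <= complex.Re `|k| * opnorm f.
Proof.
apply: opnorm_le => x x1; rewrite [_ x]/(k *: f x) nrmZ ler_wpM2l ?opnorm_ub//.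
by rewrite -lecR RRe_real ?normr_real// normr_ge0.
Qed.

Let norm0P (f : bop) : (opnorm f)%:C%C = 0 :> R[i] -> f = 0.
Proof.
move=> f0; apply: bop_ext => x; apply/eqP; rewrite -normr_le0.
by have := opnormP f x; rewrite f0 mul0r.
Qed.

Let norm_scale (k : R[i]) (f : bop) :
  (opnorm (k *: f))%:C%C = `|k| * (opnorm f)%:C%C :> R[i].
Proof.
rewrite RReK -rmorphM; congr (_%:C)%C; apply/le_anti/andP; split.
  exact: opnorm_homo.
have [->|k0] := eqVneq k 0.
  rewrite normr0 mul0r (le_trans _ (@opnorm_ub _ 0 _))//.
  by rewrite /nrm normr0.
have kp : 0 < complex.Re `|k| by rewrite -ltcR -RReK normr_gt0.
rewrite mulrC -ler_pdivlMr// mulrC.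
have := opnorm_homo k^-1 (k *: f); rewrite scalerA mulVf// scale1r.
suff -> : complex.Re `|k^-1| = (complex.Re `|k|)^-1 by [].
by apply: (@complexI R); rewrite fmorphV -!RReK normfV.
Qed.

HB.instance Definition _ := Lmodule_isNormed.Build R[i] bop
  norm_triangle norm_scale norm0P.

Lemma bop_normE (f : bop) : `|f| = (opnorm f)%:C%C.
Proof. by []. Qed.

End BoundedOperators.

Section SpectralNotions.
Variables (R : realType) (H : normedModType R[i]).
Implicit Types (x u A : bop H) (S : set R).

Definition bop_inverse x : set (bop H) := [set y | x * y = 1 /\ y * x = 1].

(* Default value 0 if x has no bounded inverse. *)
Definition bop_inv x : bop H := xget 0 (bop_inverse x).

Definition spec x : set R[i] := [set z | ~ (bop_inverse (x - z *: (1 : bop H)) !=set0)].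

(* Literal maxima and minima, with default value 0 if there is none. *)
Definition set_max S : R := xget 0 (S `&` ubound S).
Definition set_min S : R := xget 0 (S `&` lbound S).

Definition real_spec x : set R := [set r | spec x r%:C%C].

Definition unitary (ip : H -> H -> R[i]) u : Prop :=
  (forall xi eta, ip (u xi) (u eta) = ip xi eta) /\
  (forall eta, exists xi, u xi = eta).

(* Principal branch: the argument lies in ]-pi, pi]. *)
Definition Arg (z : R[i]) : R :=
  let c := acos (complex.Re z / complex.Re `|z|) in
  if 0 <= complex.Im z then c else - c.
Definition Log (z : R[i]) : R[i] := (ln (complex.Re `|z|) +i* Arg z)%C.

Definition expi (t : R) : R[i] := (cos t +i* sin t)%C.

Definition bop_horner (p : {poly R[i]}) x : bop H :=
  \sum_(i < size p) p`_i *: x ^+ i.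

(* A = f(u) in the continuous functional calculus of a unitary u: some sequence
   of Laurent polynomials p_n(z) + q_n(1/z) converges to f uniformly on the
   spectrum of u, and p_n(u) + q_n(u^-1) converges to A in operator norm. *)
Definition functional_calculus u (f : R[i] -> R[i]) A : Prop :=
  exists p q : nat -> {poly R[i]},
    (forall e : R, 0 < e -> \forall n \near \oo, forall z, spec u z ->
       `|f z - ((p n).[z] + (q n).[z^-1])| < e%:C%C) /\
    (fun n => bop_horner (p n) u + bop_horner (q n) (bop_inv u)) @ \oo --> A.

Definition bop_log u : bop H := xget 0 [set A | functional_calculus u Log A].

Definition theta_plus u : R := set_max (real_spec (- ('i%C : R[i]) *: bop_log u)).
Definition theta_minus u : R := set_min (real_spec (- ('i%C : R[i]) *: bop_log u)).

Definition unitary_eig_plus u : set H :=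
  [set xi | u xi = expi (theta_plus u) *: xi].
Definition unitary_eig_minus u : set H :=
  [set xi | u xi = expi (theta_minus u) *: xi].

(* For skew-hermitian x, the spectrum of -i x is real. *)
Definition phi_plus x : R := set_max (real_spec (- ('i%C : R[i]) *: x)).
Definition phi_minus x : R := set_min (real_spec (- ('i%C : R[i]) *: x)).

Definition skew_eig_plus x : set H :=
  [set xi | x xi = (('i%C : R[i]) * (phi_plus x)%:C%C) *: xi].
Definition skew_eig_minus x : set H :=
  [set xi | x xi = (('i%C : R[i]) * (phi_minus x)%:C%C) *: xi].

End SpectralNotions.

Section Curves.
Variables (R : realType) (H : normedModType R[i]).
Implicit Types (g : R -> bop H) (a b c d t : R) (s : seq R).

Definition diff_quotient g t : R -> bop H :=
  fun r => ((r - t)^-1)%:C%C *: (g r - g t).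

(* Derivative relative to a closed interval: one-sided at the endpoints. *)
Definition has_derivative_on c d g t (v : bop H) : Prop :=
  diff_quotient g t @ within `[c, d] t^' --> v.

Definition C1_on c d g : Prop :=
  exists dg : R -> bop H,
    (forall t, t \in `[c, d] -> has_derivative_on c d g t (dg t)) /\
    {within `[c, d], continuous dg}.

(* s lists the partition points other than a, in increasing order; it ends
   with b. *)
Definition piecewise_C1 a b s g : Prop :=
  [/\ itv_partition a b s,
      {within `[a, b], continuous g} &
      forall i, (i < size s)%N ->
        C1_on (nth b (a :: s) i) (nth b (a :: s) i.+1) g].

(* Unspecified where the derivative does not exist, which for a piecewise C^1
   curve can only happen at the interior partition points. *)
Definition velocity a b g t : bop H :=
  lim (diff_quotient g t @ within `[a, b] t^').

Definition right_logder a b g t : bop H := velocity a b g t * bop_inv (g t).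
Definition left_logder a b g t : bop H := bop_inv (g t) * velocity a b g t.

Definition off_partition a b s : set R :=
  [set t | t \in `[a, b] /\ (t \in s -> t = b)].

End Curves.

(* Main.v *)
(* After multiplying gamma_t by the scalar e^{-i C(t)}, where C is the primitive of
   (phi_+ + phi_-)/2, the hermitian operator -i gamma' gamma^{-1} has spectrum in
   [-r, r] with r = (phi_+ - phi_-)/2. So every orbit of a unit vector is a curve of
   speed at most r on the unit sphere, and the angle between its end points is at most
   the integral rho < pi of r. Hence the numerical range of e^{-i C(b)} gamma_b lies in
   the half-plane Re >= cos rho, which confines the spectrum of gamma_b to the arc
   between the two integrals. In the case of equality the orbit of an eigenvector of
   gamma_b joins x to e^{+-i rho} x along a curve of length rho < pi, so it is the great
   circle through them, and differentiating it gives the eigenvector equation for the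
   logarithmic derivatives. The logarithm is handled through a spectral inequality for
   Laurent polynomials in a unitary operator and an explicit uniform approximation of
   the argument by such polynomials on a proper arc. *)

Require Import Defs.
From HB Require Import structures.
From mathcomp Require Import all_boot all_order all_algebra.
From mathcomp Require Import sesquilinear.
From mathcomp Require Import complex.
From mathcomp Require Import all_classical all_reals all_analysis.
From mathcomp Require Import measurable_realfun ring lra zify.
Set Implicit Arguments.
Unset Strict Implicit.
Unset Printing Implicit Defensive.
Import Order.TTheory GRing.Theory Num.Def Num.Theory.
Import numFieldNormedType.Exports.
Local Open Scope classical_set_scope.
Local Open Scope ring_scope.

(** * The real inner product on [H], and Cauchy sequences with a rate *)

Section RealInnerProduct.
Variables (R : realType) (H : completeNormedModType R[i]).
Implicit Types (x y : H) (T : bop H) (r m : R).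

Local Notation "r *' x" := ((r%:C%C : R[i]) *: x) (at level 40).
Local Notation J x := (('i%C : R[i]) *: x).

(** The spectrum is known only through invertibility, and its points need not have eigenvectors. So
    every spectral statement is turned into one about quadratic forms: a coercive operator is
    invertible, and the supremum of the form of a hermitian operator belongs to its spectrum. Forms
    are taken in the real inner product [Re <x, y>], with [J] for multiplication by [i]. Removing a
    phase matters because [phi_+] and [phi_-] are unrelated: afterwards one speed bound controls
    both ends, and the integrals enter only through their half-sum and half-difference. The
    half-plane condition determines arguments only modulo [2 pi]; that both integrals lie strictly
    between [- pi] and [pi] selects the branch and keeps [-1] out of the spectrum. The logarithm is
    chosen among all operators satisfying a limit condition. Hence its bounds are proved for every
    such operator, and existence is proved separately, since otherwise the choice would fall back on
    a default value. *)

Definition rnorm x : R := complex.Re `|x|.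

Lemma normrE x : `|x| = (rnorm x)%:C%C.
Proof. by rewrite /rnorm RRe_real// normr_real. Qed.

Lemma rnorm_ge0 x : 0 <= rnorm x.
Proof. by rewrite -lecR -normrE normr_ge0. Qed.

Lemma rnormD x y : rnorm (x + y) <= rnorm x + rnorm y.
Proof. by have := ler_normD x y; rewrite !normrE -rmorphD lecR. Qed.

Lemma rnormN x : rnorm (- x) = rnorm x.
Proof. by rewrite /rnorm normrN. Qed.

Lemma rnormZ r x : rnorm (r *' x) = `|r| * rnorm x.
Proof.
apply: (@complexI R); rewrite rmorphM/= -normrE normrZ -normrE; congr (_ * _).
by rewrite normc_def/= expr0n/= addr0 sqrtr_sqr.
Qed.

Lemma rnormZc (k : R[i]) x : rnorm (k *: x) = complex.Re `|k| * rnorm x.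
Proof.
have kE : `|k| = (complex.Re `|k|)%:C%C by rewrite RRe_real// normr_real.
apply: (@complexI R).
by have := normrZ k x; rewrite !normrE kE -rmorphM => ->.
Qed.

Lemma rnorm0 : rnorm (0 : H) = 0.
Proof. by rewrite /rnorm normr0. Qed.

Lemma rnorm_eq0 x : (rnorm x == 0) = (x == 0).
Proof. by rewrite -[RHS]normr_eq0 normrE -(inj_eq (@complexI R)). Qed.

Lemma rnorm_bop T x : rnorm (T x) <= opnorm T * rnorm x.
Proof. by rewrite -lecR rmorphM/= -!normrE opnormP. Qed.

Lemma rnormB x y : rnorm (x - y) = rnorm (y - x).
Proof. by rewrite -rnormN opprB. Qed.

Lemma cplxZ (k : R[i]) x : k *: x = complex.Re k *' x + complex.Im k *' J x.
Proof.
rewrite scalerA -scalerDl; congr (_ *: _).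
by rewrite [LHS]complexE mulrC; congr (_ + _); rewrite mulrC.
Qed.

Lemma JJ x : J (J x) = - x.
Proof. by rewrite scalerA -expr2 sqr_i scaleN1r. Qed.

(** The limit keeps the rate. This is what later makes pointwise limits of operators linear, bounded
    and uniform on the unit ball. *)
Lemma cauchy_rate (e : nat -> R) (y : nat -> H) :
  e @ \oo --> 0 -> (forall n k, (n <= k)%N -> rnorm (y k - y n) <= e n) ->
  exists l, forall n, rnorm (l - y n) <= e n.
Proof.
move=> e0 ye; have cy : cvgn y.
  apply/cauchy_cvgP/cauchy_ballP => eps eps0; near_simpl.
  have eE : eps = (complex.Re eps)%:C%C by rewrite RRe_real// gtr0_real.
  have epsR : 0 < complex.Re eps by move: eps0; rewrite {1}eE ltcR.
  have [N _ Ne] : \forall n \near \oo, `|e n| < complex.Re eps / 2.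
    by apply/cvgr0_norm_lt => //; rewrite divr_gt0.
  exists ([set n | (N <= n)%N], [set n | (N <= n)%N]); first by split; exists N.
  move=> [n k] /= [Nn Nk]; rewrite -ball_normE /= normrE eE ltcR.
  have -> : y n - y k = (y n - y N) + (y N - y k) by rewrite addrA subrK.
  rewrite (le_lt_trans (rnormD _ _))// (rnormB (y N)).
  have eN := Ne N (leqnn _).
  have := ye N n Nn; have := ye N k Nk; have := ler_norm (e N).
  by move: eN => /=; lra.
exists (limn y) => n; apply/ler_addgt0Pr => d d0.
have /cvgrPdist_lt /(_ d%:C%C) := cy.
rewrite ltcR => /(_ d0)[N _ Nl].
have := Nl (maxn N n) (leq_maxl _ _); rewrite /= normrE ltcR.
have := ye n (maxn N n) (leq_maxr _ _).
have := rnormD (limn y - y (maxn N n)) (y (maxn N n) - y n).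
rewrite addrA subrK; lra.
Qed.

Lemma geometric_cauchy (q C : R) (y : nat -> H) : 0 <= q < 1 -> 
  (forall n, rnorm (y n.+1 - y n) <= C * q ^+ n) ->
  exists l, forall n, rnorm (l - y n) <= C / (1 - q) * q ^+ n.
Proof.
move=> /andP[q0 q1] yC; apply: cauchy_rate.
  rewrite -(mulr0 (C / (1 - q))); apply: cvgMr.
  by apply: cvg_expr; rewrite ger0_norm.
have C0 : 0 <= C by have := yC 0%N; rewrite expr0 mulr1; apply: le_trans; exact: rnorm_ge0.
have q1' : 0 < 1 - q by rewrite subr_gt0.
move=> n k /subnK <-; elim: (k - n)%N => [|j ih].
  by rewrite add0n subrr rnorm0 mulr_ge0 ?exprn_ge0// divr_ge0// ltW.
(* The induction needs the exact partial geometric sum; the claimed bound drops its factor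
   [1 - q ^+ j]. *)
suff : rnorm (y (j.+1 + n)%N - y n) <= C / (1 - q) * (1 - q ^+ j.+1) * q ^+ n.
  move/le_trans; apply; rewrite ler_wpM2r ?exprn_ge0// ler_piMr//.
    by rewrite divr_ge0// ltW.
  by rewrite gerBl exprn_ge0.
move: (j.+1) => {}j {ih}; elim: j => [|j ih].
  by rewrite add0n subrr rnorm0 expr0 subrr mulr0 mul0r.
rewrite addSn -(subrK (y (j + n)%N) (y (j + n).+1)) -addrA.
rewrite (le_trans (rnormD _ _))// (le_trans (lerD (yC _) ih))//.
rewrite le_eqVlt; apply/orP; left; apply/eqP.
by rewrite exprD exprS; field; rewrite gt_eqF.
Qed.

Variable ip : {dot H for @conjC R[i]}.
Hypothesis ip_norm : forall x, ip x x = `|x| ^+ 2.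

(** Nothing is lost by keeping only the real part: the imaginary part of [ip x y] is
    [rip x (J y)]. *)
Definition rip x y : R := complex.Re (ip x y).

Let cJ (z : R[i]) : conjC z = z^*%C. Proof. by []. Qed.

Lemma ipC x y : ip x y = conjC (ip y x).
Proof. by rewrite hermC/= expr0 mul1r. Qed.

Lemma ripC x y : rip x y = rip y x.
Proof. by rewrite /rip ipC cJ; case: (ip y x). Qed.

Lemma ripDl x y z : rip (x + y) z = rip x z + rip y z.
Proof. by rewrite /rip linearDl/= raddfD. Qed.

Lemma ripZl r x y : rip (r *' x) y = r * rip x y.
Proof. by rewrite /rip linearZl/=; case: (ip x y) => u v /=; rewrite mul0r subr0. Qed.

Lemma ripDr x y z : rip z (x + y) = rip z x + rip z y.
Proof. by rewrite !(ripC z) ripDl. Qed.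

Lemma ripZr r x y : rip x (r *' y) = r * rip x y.
Proof. by rewrite !(ripC x) ripZl. Qed.

Lemma ripNl x y : rip (- x) y = - rip x y.
Proof. by rewrite -scaleN1r -(rmorphN1 (real_complex R)) ripZl mulN1r. Qed.

Lemma ripNr x y : rip x (- y) = - rip x y.
Proof. by rewrite !(ripC x) ripNl. Qed.

Lemma ripBl x y z : rip (x - y) z = rip x z - rip y z.
Proof. by rewrite ripDl ripNl. Qed.

Lemma ripBr x y z : rip z (x - y) = rip z x - rip z y.
Proof. by rewrite ripDr ripNr. Qed.

Lemma ripBB x y : rip (x - y) (x - y) = rip x x - 2 * rip x y + rip y y.
Proof. by rewrite !ripBl !ripBr (ripC y x); ring. Qed.

Lemma rip0l x : rip 0 x = 0.
Proof. by rewrite -(subrr 0) ripBl subrr. Qed.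

Lemma rip0r x : rip x 0 = 0.
Proof. by rewrite ripC rip0l. Qed.

Lemma ripJl x y : rip (J x) y = - complex.Im (ip x y).
Proof. by rewrite /rip linearZl/= mulrC ReiNIm. Qed.

Lemma ripJr x y : rip x (J y) = complex.Im (ip x y).
Proof. by rewrite ripC ripJl ipC cJ; case: (ip x y) => u v /=; rewrite opprK. Qed.

Lemma ripJJ x y : rip (J x) (J y) = rip x y.
Proof. by rewrite ripJr linearZl/= mulrC ImiRe. Qed.

Lemma ripJC x y : rip (J x) y = - rip x (J y).
Proof. by rewrite ripJl ripJr. Qed.

Lemma ripJxx x : rip (J x) x = 0.
Proof. by apply/eqP; rewrite -[_ == 0](mulrn_eq0 _ 2)/= mulr2n {1}ripJC ripC addNr. Qed.

Lemma ripxx x : rip x x = rnorm x ^+ 2.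
Proof. by rewrite /rip ip_norm normrE -rmorphXn. Qed.

Lemma ripxx_ge0 x : 0 <= rip x x.
Proof. by rewrite ripxx sqr_ge0. Qed.

Lemma ripxx_eq0 x : (rip x x == 0) = (x == 0).
Proof. by rewrite ripxx sqrf_eq0 rnorm_eq0. Qed.

Definition ripE := (ripDl, ripDr, ripNl, ripNr, ripZl, ripZr).

Lemma rip_eq x y : (forall z, rip x z = rip y z) -> x = y.
Proof.
move=> xy; apply/eqP; rewrite -subr_eq0 -ripxx_eq0 ripBl xy.
by rewrite subrr.
Qed.

Lemma cauchy_schwarz x y : `|rip x y| <= rnorm x * rnorm y.
Proof.
rewrite -ler_sqr ?nnegrE ?mulr_ge0 ?rnorm_ge0// real_normK ?num_real// exprMn -!ripxx.
have [->|y0] := eqVneq y 0; first by rewrite !rip0r expr0n mulr0.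
have yy : 0 < rip y y by rewrite lt0r ripxx_eq0 y0 ripxx_ge0.
have := ripxx_ge0 (x - (rip x y / rip y y) *' y).
rewrite !ripE (ripC y x).
set p := rip x y; set a := rip x x; set b := rip y y in yy *.
have -> : a - p / b * p + (- (p / b * p) - p / b * - (p / b * b)) = a - p ^+ 2 / b.
  by field; rewrite gt_eqF.
by rewrite subr_ge0 ler_pdivrMr.
Qed.

Lemma rip_le x y : rip x y <= rnorm x * rnorm y.
Proof. exact: le_trans (ler_norm _) (cauchy_schwarz _ _). Qed.

End RealInnerProduct.

Lemma geometric_le0 (R : realType) (q C a : R) : 0 <= q < 1 ->
  (forall n, a <= C * q ^+ n) -> a <= 0.
Proof.
move=> /andP[q0 q1] aC; have : (fun n => C * q ^+ n) @ \oo --> C * 0.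
  by apply: cvgMr; apply: cvg_expr; rewrite ger0_norm.
rewrite mulr0 => h; rewrite -(cvg_lim _ h)//; apply: limr_ge.
  by apply: cvgP h.
exact: nearW.
Qed.

(** * Invertibility of bounded operators and forms of hermitian operators *)

Section Operators.
Variables (R : realType) (H : completeNormedModType R[i]).
Variable ip : {dot H for @conjC R[i]}.
Hypothesis ip_norm : forall x, ip x x = `|x| ^+ 2.
Implicit Types (x y : H) (A B S T : bop H) (r m : R).

Local Notation "r *' x" := ((r%:C%C : R[i]) *: x) (at level 40).
Local Notation J x := (('i%C : R[i]) *: x).
Local Notation rp := (rip ip).

Lemma bop_addE A B x : (A + B) x = A x + B x. Proof. by []. Qed.
Lemma bop_oppE A x : (- A) x = - A x. Proof. by []. Qed.
Lemma bop_scaleE (k : R[i]) A x : (k *: A) x = k *: A x. Proof. by []. Qed.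
Lemma bop_mulE A B x : (A * B) x = A (B x). Proof. by []. Qed.
Lemma bop_oneE x : (1 : bop H) x = x. Proof. by []. Qed.
Lemma bop_zeroE x : (0 : bop H) x = 0. Proof. by []. Qed.
Definition bopE := (bop_addE, bop_oppE, bop_scaleE, bop_mulE, bop_oneE, bop_zeroE).

Lemma bopN A x : A (- x) = - A x.
Proof. by rewrite -scaleN1r bopZ scaleN1r. Qed.

Lemma bopB A x y : A (x - y) = A x - A y.
Proof. by rewrite bopD bopN. Qed.

Lemma bop_inverse_unique T V W : bop_inverse T V -> bop_inverse T W -> V = W.
Proof. by move=> [_ VT] [TW _]; rewrite -[V]mulr1 -TW mulrA VT mul1r. Qed.

Lemma bop_invP T V : bop_inverse T V -> bop_inv T = V.
Proof.
move=> TV; apply: (bop_inverse_unique _ TV).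
by rewrite /bop_inv; case: xgetP => [W _ //|/(_ V)].
Qed.

Lemma bop_inverse_cancel S T : bop_inverse S !=set0 ->
  bop_inverse (S * T) !=set0 -> bop_inverse T !=set0.
Proof.
move=> [V [SV VS]] [W [STW WST]]; exists (W * S); split; last by rewrite -mulrA.
by rewrite mulrA -[T * W]mul1r -VS -[V * S * _]mulrA (mulrA S) STW mulr1.
Qed.

(** The lower bound gives injectivity and bounds the set-theoretic inverse by [d^-1], without the
    open mapping theorem. *)
Lemma bijective_inverse T (d : R) : 0 < d ->
  (forall x, d * rnorm x <= rnorm (T x)) -> (forall y, exists x, T x = y) ->
  bop_inverse T !=set0.
Proof.
move=> d0 Td /choice[g Tg].
have Tinj x y : T x = T y -> x = y.
  move=> /eqP; rewrite -subr_eq0 -bopB -rnorm_eq0 => /eqP Txy.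
  apply/eqP; rewrite -subr_eq0 -rnorm_eq0 eq_le rnorm_ge0 andbT.
  by have := Td (x - y); rewrite Txy pmulr_rle0.
have glin : linear g by move=> k x y; apply: Tinj; rewrite bop_linear !Tg.
have gbnd : exists M : R, forall x, `|g x| <= M%:C%C * `|x|.
  exists d^-1 => x; rewrite !normrE -rmorphM lecR ler_pdivlMl//.
  by have := Td (g x); rewrite Tg.
exists (Bop glin gbnd); split; apply: bop_ext => x; rewrite !bopE/= ?Tg//.
by apply: Tinj; rewrite Tg.
Qed.

(* Lax-Milgram: x |-> x - t (T x - y) is a contraction for small t. *)
Lemma coercive_inverse T (d : R) : 0 < d ->
  (forall x, d * rp x x <= rp (T x) x) -> bop_inverse T !=set0.
Proof.
move=> d0 Td.
have dT x : d * rnorm x <= rnorm (T x).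
  have [->|x0] := eqVneq x 0; first by rewrite rnorm0 mulr0 rnorm_ge0.
  have xp : 0 < rnorm x by rewrite lt0r rnorm_eq0 x0 rnorm_ge0.
  rewrite -(ler_pM2r xp) -mulrA -expr2 -(ripxx ip_norm).
  exact: le_trans (Td x) (rip_le ip_norm _ _).
apply: (bijective_inverse d0 dT) => y.
pose K : R := Num.max (opnorm T) d + 1.
have K0 : 0 < K by rewrite ltr_wpDl// le_max (ltW d0) orbT.
have dK : d < K by rewrite ltr_pwDr// le_max lexx orbT.
have TK x : rnorm (T x) <= K * rnorm x.
  rewrite (le_trans (rnorm_bop _ _))// ler_wpM2r ?rnorm_ge0//.
  by rewrite ler_wpDr// le_max lexx.
(* This [t] minimises [1 - 2 t d + t^2 K^2], which bounds the squared contraction factor; the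
   minimum is [Q], and [d < K] keeps it positive. *)
pose t := d / K ^+ 2.
pose Q := 1 - (d / K) ^+ 2.
have dK1 : (d / K) ^+ 2 < 1.
  by rewrite expr_lt1// ?ltr_pdivrMr ?mul1r// divr_ge0 ?ltW.
have Q0 : 0 <= Q by rewrite subr_ge0 ltW.
have Q1 : Q < 1 by rewrite ltrBlDr ltrDl exprn_gt0// divr_gt0.
pose q := Num.sqrt Q.
have q01 : 0 <= q < 1 by rewrite sqrtr_ge0 -[ltRHS]sqrtr1 ltr_sqrt.
have contr x : rnorm (x - t *' T x) <= q * rnorm x.
  rewrite -ler_sqr ?nnegrE ?mulr_ge0 ?rnorm_ge0 ?sqrtr_ge0//.
  rewrite exprMn sqr_sqrtr// -!(ripxx ip_norm) !ripE (ripC ip x).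
  have : rp (T x) (T x) <= K ^+ 2 * rp x x.
    rewrite !(ripxx ip_norm) -exprMn ler_sqr ?nnegrE ?mulr_ge0 ?rnorm_ge0//.
    exact: ltW.
  move: (Td x); set a := rp x x; set b := rp (T x) x; set c := rp (T x) (T x).
  move=> ab ca.
  have t0 : 0 < t by rewrite divr_gt0// exprn_gt0.
  have h1 : t * (d * a) <= t * b by rewrite ler_wpM2l// ltW.
  have h2 : t ^+ 2 * c <= t ^+ 2 * (K ^+ 2 * a) by rewrite ler_wpM2l// sqr_ge0.
  have e1 : Q * a = a - t * (d * a) by rewrite /Q /t; field; rewrite gt_eqF.
  have e2 : t ^+ 2 * (K ^+ 2 * a) = t * (d * a) by rewrite /t; field; rewrite gt_eqF.
  by rewrite e1; rewrite e2 in h2; move: h1 h2; rewrite expr2; lra.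
pose x_ := fix x_ n := if n is n'.+1 then x_ n' - t *' (T (x_ n') - y) else 0.
have xS n : x_ n.+1 = x_ n - t *' (T (x_ n) - y) by [].
have /(geometric_cauchy q01)[l xl] : forall n, rnorm (x_ n.+1 - x_ n) <= rnorm (x_ 1%N - x_ 0%N) * q ^+ n.
  elim=> [|n ih]; first by rewrite expr0 mulr1.
  have -> : x_ n.+2 - x_ n.+1 = (x_ n.+1 - x_ n) - t *' T (x_ n.+1 - x_ n).
    have e : x_ n.+1 - x_ n = - (t *' (T (x_ n) - y)).
      by rewrite xS addrAC subrr add0r.
    rewrite (bopB T) (xS n.+1) e; apply: (rip_eq ip_norm) => z.
    by rewrite !ripE; ring.
  rewrite (le_trans (contr _))// exprS mulrCA ler_wpM2l//.
  by case/andP: q01.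
set C := rnorm _ / _ in xl.
exists l; apply/eqP; rewrite -subr_eq0 -rnorm_eq0 eq_le rnorm_ge0 andbT.
have t0 : 0 < t by rewrite divr_gt0// exprn_gt0.
rewrite -(pmulr_rle0 _ t0).
(* The residual at [l] is written through the errors of [x_ n] and [x_ n.+1], both of order
   [q ^+ n]. *)
have bnd n : t * rnorm (T l - y) <= (C * (2 * q)) * q ^+ n.
  have -> : t * rnorm (T l - y) = rnorm (t *' (T l - y)).
    by rewrite rnormZ gtr0_norm.
  have -> : t *' (T l - y) = (l - x_ n.+1) - ((l - x_ n) - t *' T (l - x_ n)).
    rewrite [x_ n.+1]xS (bopB T); apply: (rip_eq ip_norm) => z.
    by rewrite !ripE; ring.
  rewrite (le_trans (rnormD _ _))// rnormN.
  have h1 := xl n.+1; have h2 := contr (l - x_ n).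
  have h3 : q * rnorm (l - x_ n) <= q * (C * q ^+ n).
    by rewrite ler_wpM2l ?xl//; case/andP: q01.
  by move: h1; rewrite exprS; lra.
exact: geometric_le0 q01 bnd.
Qed.

(** Since [B] commutes with [J], symmetry for the real form is symmetry for the complex one. *)
Definition hermitian B := forall x y, rp (B x) y = rp x (B y).

(** The hypothesis says that [ip (B x) x] is real; polarisation at [x - J y] then gives symmetry. *)
Lemma hermitian_form B : (forall x, rp (B x) (J x) = 0) -> hermitian B.
Proof.
move=> B0 x y; have := B0 (x - J y); have := B0 x; have := B0 (J y).
rewrite !bopB !bopZ !ripBl !scalerBr !ripBr !JJ !ripNr !ripJJ => h1 h2.
rewrite h2 (ripC ip x); lra.
Qed.

(** Let [y] be the multiple of [B x] with the norm of [x]. The form bounds at [x + y] and [x - y]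
    combine, by the parallelogram law, into [rp (B x) y <= m |x|^2], whose left side is
    [|B x| |x|]. *)
Lemma hermitian_norm B m : hermitian B -> 0 <= m ->
  (forall x, `|rp (B x) x| <= m * rp x x) ->
  forall x, rnorm (B x) <= m * rnorm x.
Proof.
move=> hB m0 Bm x; have [->|Bx0] := eqVneq (B x) 0.
  by rewrite rnorm0 mulr_ge0// rnorm_ge0.
have [x0|x0] := eqVneq x 0; first by rewrite x0 bop0 eqxx in Bx0.
have np : 0 < rnorm x by rewrite lt0r rnorm_eq0 x0 rnorm_ge0.
have kp : 0 < rnorm (B x) by rewrite lt0r rnorm_eq0 Bx0 rnorm_ge0.
set n := rnorm x in np *; set k := rnorm (B x) in kp *.
pose y := (n / k) *' B x.
have yy : rp y y = n ^+ 2.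
  by rewrite !ripE (ripxx ip_norm) -/k; field; rewrite gt_eqF.
have Bxy : rp (B x) y = n * k.
  by rewrite !ripE (ripxx ip_norm) -/k; field; rewrite gt_eqF.
have xx : rp x x = n ^+ 2 by rewrite (ripxx ip_norm).
have Byx : rp (B y) x = n * k by rewrite hB ripC.
have := Bm (x + y); have := Bm (x - y).
rewrite !ler_norml => /andP[h1 _] /andP[_ h2].
move: h1 h2; rewrite (bopB B) (bopD B) !ripDl !ripDr !ripNr !ripNl (ripC ip y x).
rewrite xx yy Bxy Byx; set p := rp x y; set u := rp (B x) x; set v := rp (B y) y.
move=> h1 h2; have : n * k <= n * (m * n) by rewrite expr2 in h1 h2; nra.
by rewrite ler_pM2l.
Qed.

End Operators.

(** * Extremes of the spectrum as extremes of the numerical range *)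

Section MaxMin.
Variable R : realType.
Implicit Type (S : set R).

Lemma set_max_eq S m : S m -> ubound S m -> set_max S = m.
Proof.
move=> Sm mub; rewrite /set_max; case: xgetP => [n _ [Sn nub]|/(_ m)/not_andP[]//].
by apply/eqP; rewrite eq_le mub// nub.
Qed.

Lemma set_min_eq S m : S m -> lbound S m -> set_min S = m.
Proof.
move=> Sm mlb; rewrite /set_min; case: xgetP => [n _ [Sn nlb]|/(_ m)/not_andP[]//].
by apply/eqP; rewrite eq_le mlb// nlb.
Qed.

End MaxMin.

Section NumericalRange.
Variables (R : realType) (H : completeNormedModType R[i]).
Variable ip : {dot H for @conjC R[i]}.
Hypothesis ip_norm : forall x, ip x x = `|x| ^+ 2.
Hypothesis H_nonzero : exists x : H, x != 0.
Implicit Types (x y : H) (A B S T : bop H) (r m : R).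

Local Notation "r *' x" := ((r%:C%C : R[i]) *: x) (at level 40).
Local Notation J x := (('i%C : R[i]) *: x).
Local Notation rp := (rip ip).
Local Notation hermitian := (hermitian ip).

Definition numeric_range B : set R := [set rp (B x) x | x in [set x | rnorm x = 1]].
Definition numeric_sup B : R := sup (numeric_range B).

Lemma rp_bop_le B x : `|rp (B x) x| <= opnorm B * rp x x.
Proof.
rewrite (le_trans (cauchy_schwarz ip_norm _ _))// (ripxx ip_norm) expr2 mulrA.
by rewrite ler_wpM2r ?rnorm_ge0// rnorm_bop.
Qed.

Lemma has_sup_numeric B : has_sup (numeric_range B).
Proof.
split.
  have [x x0] := H_nonzero; exists (rp (B ((rnorm x)^-1 *' x)) ((rnorm x)^-1 *' x)).
  have xp : 0 < rnorm x by rewrite lt0r rnorm_eq0 x0 rnorm_ge0.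
  by exists ((rnorm x)^-1 *' x) => //=; rewrite rnormZ gtr0_norm ?invr_gt0// mulVf// gt_eqF.
exists (opnorm B) => _ [x /= x1 <-].
have := rp_bop_le B x; rewrite (ripxx ip_norm) x1 expr1n mulr1.
exact: le_trans (ler_norm _).
Qed.

Lemma numeric_sup_ub B x : rp (B x) x <= numeric_sup B * rp x x.
Proof.
have [->|x0] := eqVneq x 0; first by rewrite !rip0r mulr0.
have xp : 0 < rnorm x by rewrite lt0r rnorm_eq0 x0 rnorm_ge0.
have : rp (B ((rnorm x)^-1 *' x)) ((rnorm x)^-1 *' x) <= numeric_sup B.
  apply: sup_upper_bound; first exact: has_sup_numeric.
  by exists ((rnorm x)^-1 *' x) => //=; rewrite rnormZ gtr0_norm ?invr_gt0// mulVf// gt_eqF.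
rewrite bopZ !ripE mulrA -expr2 exprVn ler_pdivrMl ?exprn_gt0//.
by rewrite -(ripxx ip_norm) mulrC.
Qed.

Lemma numeric_sup_le B m : (forall x, rp (B x) x <= m * rp x x) -> numeric_sup B <= m.
Proof.
move=> Bm; apply: ge_sup; first exact: (has_sup_numeric B).1.
by move=> _ [x /= x1 <-]; have := Bm x; rewrite (ripxx ip_norm x) x1 expr1n mulr1.
Qed.

(* If M := numeric_sup B were not in the spectrum, P := M - B >= 0 would be bounded
   below; since |P x|^2 <= |P| <P x, x>, so would its quadratic form. *)
Lemma numeric_sup_spec B : hermitian B -> real_spec B (numeric_sup B).
Proof.
move=> hB; rewrite /real_spec /spec /= => -[V [BV VB]].
set M := numeric_sup B in BV VB.
pose P : bop H := B - M%:C%C *: (1 : bop H).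
have Px x : P x = B x - M *' x by [].
have VP : V * P = 1 := VB.
have P0 x : rp (P x) x <= 0.
  by rewrite Px !ripE subr_le0 numeric_sup_ub.
have hP : hermitian P by move=> x y; rewrite !Px !ripE hB.
clearbody P.
pose K := opnorm P + 1.
have K0 : 0 < K.
  rewrite ltr_wpDl//; have [x x0] := H_nonzero.
  have xp : 0 < rp x x by rewrite lt0r (ripxx_eq0 ip_norm) x0 (ripxx_ge0 ip_norm).
  have := rp_bop_le P x; rewrite -(pmulr_lge0 _ xp); exact: le_trans (normr_ge0 _).
have PPK x : - rp (P (P x)) (P x) <= K * rp (P x) (P x).
  have := rp_bop_le P (P x); rewrite ler_norml => /andP[h _].
  have := ripxx_ge0 ip_norm (P x); rewrite /K; lra.
(* Here [P] is [B - M], which is nonpositive. Its sign at [x + K^-1 P x] yields the estimate, with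
   [PPK] controlling the term quadratic in [P x]. *)
have PK x : rp (P x) (P x) <= K * - rp (P x) x.
  have := P0 (x + K^-1 *' P x); have := PPK x.
  rewrite (bopD P) bopZ !ripE (hP (P x) x) (hP (P x) (P x)).
  set u := rp (P x) (P x); set v := rp (P x) x; set w := rp _ _.
  move=> wu h; have : K ^+ 2 * (v + K^-1 * u + K^-1 * (u + K^-1 * w)) <= 0.
    by rewrite pmulr_rle0 ?exprn_gt0//; lra.
  have -> : K ^+ 2 * (v + K^-1 * u + K^-1 * (u + K^-1 * w)) = K ^+ 2 * v + 2 * K * u + w.
    by field; rewrite gt_eqF.
  move=> h'; have : K * u <= K * (K * - v) by rewrite expr2 in h'; lra.
  by rewrite ler_pM2l.
pose L := opnorm V + 1.
have L0 : 0 < L.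
  rewrite ltr_wpDl//; have [x x0] := H_nonzero.
  have xp : 0 < rp x x by rewrite lt0r (ripxx_eq0 ip_norm) x0 (ripxx_ge0 ip_norm).
  have := rp_bop_le V x; rewrite -(pmulr_lge0 _ xp); exact: le_trans (normr_ge0 _).
have VL x : rp x x <= L ^+ 2 * rp (P x) (P x).
  rewrite !(ripxx ip_norm) -exprMn ler_sqr ?nnegrE ?mulr_ge0 ?rnorm_ge0 ?(ltW L0)//.
  have {1}-> : x = V (P x) by rewrite -bop_mulE VP.
  rewrite (le_trans (rnorm_bop _ _))// ler_wpM2r ?rnorm_ge0//.
  by rewrite ler_wpDr.
have c0 : 0 < (L ^+ 2 * K)^-1 by rewrite invr_gt0 mulr_gt0// exprn_gt0.
(* The form of [B] would be bounded by a number strictly below its own supremum. *)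
suff h : M <= M - (L ^+ 2 * K)^-1 by move: h; rewrite lerDl oppr_ge0 leNgt c0.
apply: numeric_sup_le => x.
have h : rp x x <= L ^+ 2 * K * - rp (P x) x.
  by rewrite (le_trans (VL x))// -mulrA ler_wpM2l// exprn_ge0// ltW.
have : (L ^+ 2 * K)^-1 * rp x x <= - rp (P x) x.
  by rewrite ler_pdivrMl// mulr_gt0// exprn_gt0.
by rewrite Px !ripE; lra.
Qed.

(** For [m] above the numerical supremum, [m - B] is coercive. *)
Lemma real_spec_ub B : ubound (real_spec B) (numeric_sup B).
Proof.
move=> m; rewrite /real_spec /spec /=; rewrite leNgt => Bm; apply/negP => Mm.
apply: Bm; apply: (@bop_inverse_cancel _ _ (- 1)).
  by exists (- 1); split; rewrite mulrNN mulr1.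
apply: (@coercive_inverse _ _ ip ip_norm _ (m - numeric_sup B)).
  by rewrite subr_gt0.
move=> x; rewrite !bopE !ripE.
by have := numeric_sup_ub B x; lra.
Qed.

Lemma set_max_spec B : hermitian B -> set_max (real_spec B) = numeric_sup B.
Proof.
by move=> hB; apply: set_max_eq; [exact: numeric_sup_spec|exact: real_spec_ub].
Qed.

Lemma specN B (z : R[i]) : spec (- B) (- z) -> spec B z.
Proof.
move=> sB [V [TV VT]]; apply: sB; exists (- V).
have -> : - B - - z *: (1 : bop H) = - (B - z *: (1 : bop H)).
  by rewrite scaleNr opprB opprK addrC.
by split; rewrite mulrNN.
Qed.

Lemma set_min_spec B : hermitian B -> set_min (real_spec B) = - numeric_sup (- B).
Proof.
move=> hB; have hB' : hermitian (- B) by move=> x y; rewrite !bopE !ripE hB.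
apply: set_min_eq.
  by apply: specN; rewrite rmorphN opprK; exact: numeric_sup_spec.
move=> m Bm; rewrite lerNl; apply: real_spec_ub.
by apply: specN; rewrite rmorphN !opprK.
Qed.

(** Polarisation makes this equivalent to being skew-hermitian ([skewC]); the diagonal form is what
    unitarity of the curve and the spectral inequality supply directly. *)
Definition skew B := forall x, rp (B x) x = 0.

Lemma skew_hermitian B : skew B -> hermitian (- ('i%C : R[i]) *: B).
Proof.
move=> sB; apply: hermitian_form => x.
by rewrite bop_scaleE scaleNr ripNl ripJJ sB oppr0.
Qed.

Lemma skewC B x y : skew B -> rp (B x) y = - rp x (B y).
Proof.
move=> sB; have := sB (x + y).
by rewrite bopD !ripE !sB (ripC ip x); lra.
Qed.

Lemma mul_Ni_form B x : rp ((- ('i%C : R[i]) *: B) x) x = rp (B x) (J x).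
Proof. by rewrite bop_scaleE scaleNr ripNl ripJC opprK. Qed.

(** Here [rp (B x) (J x)] is the quadratic form of [-i B]. *)
Lemma phi_plus_ub B x : skew B -> rp (B x) (J x) <= phi_plus B * rp x x.
Proof.
move=> sB; rewrite /phi_plus (set_max_spec (skew_hermitian sB)) -mul_Ni_form.
exact: numeric_sup_ub.
Qed.

Lemma phi_plus_le B m : skew B -> (forall x, rp (B x) (J x) <= m * rp x x) ->
  phi_plus B <= m.
Proof.
move=> sB Bm; rewrite /phi_plus (set_max_spec (skew_hermitian sB)).
by apply: numeric_sup_le => x; rewrite mul_Ni_form.
Qed.

Lemma phi_minus_lb B x : skew B -> phi_minus B * rp x x <= rp (B x) (J x).
Proof.
move=> sB; rewrite /phi_minus (set_min_spec (skew_hermitian sB)) -mul_Ni_form.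
rewrite mulNr lerNl -ripNl -[- (_ *: _ : bop H) x]/((- (_ *: B : bop H)) x).
exact: numeric_sup_ub.
Qed.

Lemma phi_minus_ge B m : skew B -> (forall x, m * rp x x <= rp (B x) (J x)) ->
  m <= phi_minus B.
Proof.
move=> sB Bm; rewrite /phi_minus (set_min_spec (skew_hermitian sB)) lerNr.
by apply: numeric_sup_le => x; rewrite bop_oppE ripNl mul_Ni_form mulNr lerN2.
Qed.

Lemma phi_minus_le_plus B : skew B -> phi_minus B <= phi_plus B.
Proof.
move=> sB; have [x x0] := H_nonzero.
have xp : 0 < rp x x by rewrite lt0r (ripxx_eq0 ip_norm) x0 (ripxx_ge0 ip_norm).
by rewrite -(ler_pM2r xp) (le_trans (phi_minus_lb x sB))// phi_plus_ub.
Qed.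

Lemma iform_le B x : rp (B x) (J x) <= opnorm B * rp x x.
Proof.
rewrite (le_trans (rip_le ip_norm _ _))// (ripxx ip_norm) expr2 mulrA.
rewrite rnormZc normc_def/= expr0n/= add0r expr1n sqrtr1 mul1r.
by rewrite ler_wpM2r ?rnorm_ge0// rnorm_bop.
Qed.

(** Serves to make the integrand continuous wherever the logarithmic derivative is, and to pass
    eigenvector equations to the limit. *)
Lemma phi_plus_lipschitz A B : skew A -> skew B ->
  `|phi_plus A - phi_plus B| <= opnorm (A - B).
Proof.
have main A' B' : skew A' -> skew B' -> phi_plus A' <= phi_plus B' + opnorm (A' - B').
  move=> sA sB; apply: phi_plus_le => // x.
  have := iform_le (A' - B') x; rewrite !bopE !ripE.
  by have := phi_plus_ub x sB; lra.
move=> sA sB; have := main _ _ sA sB; have := main _ _ sB sA.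
have -> : opnorm (B - A) = opnorm (A - B).
  by apply: (@complexI R); rewrite -!bop_normE distrC.
by rewrite ler_norml; lra.
Qed.

Lemma phi_minus_lipschitz A B : skew A -> skew B ->
  `|phi_minus A - phi_minus B| <= opnorm (A - B).
Proof.
have main A' B' : skew A' -> skew B' -> phi_minus B' - opnorm (B' - A') <= phi_minus A'.
  move=> sA sB; apply: phi_minus_ge => // x.
  have := iform_le (B' - A') x; rewrite !bopE !ripE.
  by have := phi_minus_lb x sB; lra.
move=> sA sB; have := main _ _ sA sB; have := main _ _ sB sA.
have -> : opnorm (B - A) = opnorm (A - B).
  by apply: (@complexI R); rewrite -!bop_normE distrC.
by rewrite ler_norml; lra.
Qed.

Lemma phi_plus_bound A : skew A -> `|phi_plus A| <= opnorm A.
Proof.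
move=> sA; have [x x0] := H_nonzero.
have xp : 0 < rp x x by rewrite lt0r (ripxx_eq0 ip_norm) x0 (ripxx_ge0 ip_norm).
rewrite ler_norml; apply/andP; split; last by apply: phi_plus_le => // y; exact: iform_le.
rewrite -(ler_pM2r xp) (le_trans _ (phi_plus_ub x sA))// mulNr lerNl.
have := iform_le (- A) x; rewrite bopE ripNl.
suff -> : opnorm (- A) = opnorm A by [].
by apply: (@complexI R); rewrite -!bop_normE normrN.
Qed.

Lemma phi_minus_bound A : skew A -> `|phi_minus A| <= opnorm A.
Proof.
move=> sA; rewrite ler_norml; apply/andP; split; last first.
  by rewrite (le_trans (phi_minus_le_plus sA))// (le_trans (ler_norm _))// phi_plus_bound.
apply: phi_minus_ge => // y; have := iform_le (- A) y; rewrite bopE ripNl mulNr lerNl.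
suff -> : opnorm (- A) = opnorm A by [].
by apply: (@complexI R); rewrite -!bop_normE normrN.
Qed.

(* -i B - c has its quadratic form in [- r, r]. *)
Lemma skew_centered_norm B (c r : R) x : skew B ->
  phi_plus B <= c + r -> c - r <= phi_minus B ->
  rnorm (B x - c *' J x) <= r * rnorm x.
Proof.
move=> sB cp cm.
have hB := skew_hermitian sB.
pose D : bop H := - ('i%C : R[i]) *: B - c%:C%C *: (1 : bop H).
have hD : hermitian D by move=> y z; rewrite !bopE !ripE -!bop_scaleE hB.
have DE y : rp (D y) y = rp (B y) (J y) - c * rp y y.
  by rewrite /D bop_addE ripDl mul_Ni_form !bopE !ripE.
have r0 : 0 <= r by have := phi_minus_le_plus sB; lra.
have -> : B x - c *' J x = J (D x).
  rewrite !bopE scalerBr scaleNr scalerN JJ opprK; congr (_ - _).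
  by rewrite !scalerA mulrC.
rewrite rnormZc normc_def/= expr0n/= add0r expr1n sqrtr1 mul1r.
apply: (hermitian_norm ip_norm hD) => // y.
have := phi_plus_ub y sB; have := phi_minus_lb y sB; have := ripxx_ge0 ip_norm y.
rewrite DE ler_norml; nra.
Qed.

End NumericalRange.

(** * Real calculus away from finitely many points *)

Section ScalarCalculus.
Variable R : realType.
Implicit Types (f g F : R -> R) (a b t : R) (s : seq R).

Lemma is_derive_quotient f t l :
  (r - t)^-1 * (f r - f t) @[r --> t^'] --> l -> is_derive t 1 f l.
Proof.
move=> fl.
have fl' : h^-1 *: ((f \o shift t) (h *: 1) - f t) @[h --> 0^'] --> l.
  apply/cvgrPdist_lt => e e0; move/cvgrPdist_lt : fl => /(_ e e0).
  move=> [d d0 dP]; exists d => // h hd h0.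
  have := dP (h + t); rewrite /= addrK [h *: 1]mulr1; apply.
    by move: hd; rewrite /= !opprD addrCA subrr addr0 sub0r.
  by rewrite -subr_eq0 addrK.
by apply: DeriveDef; [exact: cvgP fl'|exact: cvg_lim fl'].
Qed.

Lemma is_derive_continuous f t l : is_derive t 1 f l -> {for t, continuous f}.
Proof.
by move=> fl; apply/differentiable_continuous/derivable1_diffP; case: fl.
Qed.

Lemma subitv_continuous f a b c d : a <= c -> d <= b ->
  {within `[a, b], continuous f} -> {within `[c, d], continuous f}.
Proof.
move=> ac db; apply: continuous_subspaceW.
by apply: subset_itv; rewrite bnd_simp.
Qed.

Lemma within_continuousD (A : set R) f g :
  {within A, continuous f} -> {within A, continuous g} ->
  {within A, continuous (fun t => f t + g t)}.
Proof.
move=> /subspace_continuousP cf /subspace_continuousP cg.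
by apply/subspace_continuousP => t At; apply: cvgD; [exact: cf|exact: cg].
Qed.

Lemma within_continuousM (A : set R) f g :
  {within A, continuous f} -> {within A, continuous g} ->
  {within A, continuous (fun t => f t * g t)}.
Proof.
move=> /subspace_continuousP cf /subspace_continuousP cg.
by apply/subspace_continuousP => t At; apply: cvgM; [exact: cf|exact: cg].
Qed.

Lemma within_continuous_comp (A : set R) f g :
  {within A, continuous f} -> continuous g ->
  {within A, continuous (fun t => g (f t))}.
Proof.
move=> /subspace_continuousP cf cg.
apply/subspace_continuousP => t At.
by apply: (@cvg_comp _ _ _ f g _ (nbhs (f t))); [exact: cf|exact: cg].
Qed.

Lemma within_continuousZ (A : set R) (k : R) f :
  {within A, continuous f} -> {within A, continuous (fun t => k * f t)}.
Proof. by move=> cf; apply: within_continuousM cf => //; exact: continuous_subspaceT (@cst_continuous _ _ k). Qed.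

Lemma within_continuousB (A : set R) f g :
  {within A, continuous f} -> {within A, continuous g} ->
  {within A, continuous (fun t => f t - g t)}.
Proof.
move=> /subspace_continuousP cf /subspace_continuousP cg.
by apply/subspace_continuousP => t At; apply: cvgB; [exact: cf|exact: cg].
Qed.

(** Each exceptional point inside the interval splits it in two; without any, the mean value theorem
    applies. *)
Lemma nondecreasing_off_finite F (dF : R -> R) s a b : a <= b ->
  {within `[a, b], continuous F} ->
  (forall t, t \in `]a, b[ -> t \notin s -> is_derive t 1 F (dF t)) ->
  (forall t, t \in `]a, b[ -> t \notin s -> 0 <= dF t) ->
  F a <= F b.
Proof.
elim: s a b => [|c s ih] a b ab Fc Fd Fp.
  (* The point [z] is only known to lie in the closed interval, so the derivative receives the
     harmless value 0 at the end points. *)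
  have [|z zab e] := MVT_segment ab _ Fc (df := fun t => if t \in `]a, b[ then dF t else 0).
    by move=> t tab; rewrite tab; exact: Fd.
  rewrite -subr_ge0 e mulr_ge0 ?subr_ge0//.
  by case: ifPn => // zab'; exact: Fp.
have [cab|cab] := boolP (c \in `]a, b[); last first.
  have ncs t : t \in `]a, b[ -> t \notin s -> t \notin c :: s.
    move=> tab ts; rewrite inE negb_or ts andbT.
    by apply: contraNneq cab => <-.
  by apply: ih => // t tab ts; [apply: Fd|apply: Fp] => //; exact: ncs.
have [ac cb] : a < c /\ c < b by move: cab; rewrite in_itv/= => /andP[].
have sub l r : a <= l -> l <= r -> r <= b -> c <= l \/ r <= c -> F l <= F r.
  move=> al lr rb clr.
  have lrab t : t \in `]l, r[ -> t \notin s -> (t \in `]a, b[) /\ t \notin c :: s.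
    rewrite !in_itv/= => /andP[lt tr] ts; split.
      by rewrite (le_lt_trans al lt) (lt_le_trans tr rb).
    rewrite inE negb_or ts andbT; case: clr => h.
      by rewrite gt_eqF// (le_lt_trans h).
    by rewrite lt_eqF// (lt_le_trans tr).
  have Flr : {within `[l, r], continuous F} by exact: subitv_continuous Fc.
  have Fdlr t : t \in `]l, r[ -> t \notin s -> is_derive t 1 F (dF t).
    by move=> /lrab /[apply] -[? ?]; exact: Fd.
  have Fplr t : t \in `]l, r[ -> t \notin s -> 0 <= dF t.
    by move=> /lrab /[apply] -[? ?]; exact: Fp.
  exact: (ih l r lr Flr Fdlr Fplr).
have Fac : F a <= F c.
  by apply: (sub a c (lexx _) (ltW ac) (ltW cb)); right.
have Fcb : F c <= F b.
  by apply: (sub c b (ltW ac) (ltW cb) (lexx _)); left.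
exact: le_trans Fac Fcb.
Qed.

(* Multiplying [h] by [k = cos e < 1] keeps it away from the values [1] and [-1],
   where [acos] is not differentiable; then let [e] tend to [0]. *)
Lemma angle_bound (h w dh r : R -> R) s a b : a <= b ->
  {within `[a, b], continuous h} -> {within `[a, b], continuous w} ->
  (forall t, t \in `]a, b[ -> t \notin s -> is_derive t 1 h (dh t)) ->
  (forall t, t \in `]a, b[ -> t \notin s -> is_derive t 1 w (r t)) ->
  (forall t, t \in `]a, b[ -> t \notin s -> 0 <= r t) ->
  (forall t, t \in `]a, b[ -> t \notin s ->
    - r t * Num.sqrt (1 - h t ^+ 2) <= dh t) ->
  (forall t, t \in `[a, b] -> `|h t| <= 1) -> h a = 1 ->
  w b - w a <= pi -> cos (w b - w a) <= h b.
Proof.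
move=> ab hc wc hd wd r0 dhr h1 ha wpi.
have w0 : 0 <= w b - w a.
  by rewrite subr_ge0; exact: (nondecreasing_off_finite ab wc wd r0).
set D := w b - w a in w0 wpi *.
(* For [D = pi] the claim is [-1 <= h b]; otherwise there is room for [e > 0] with [D + e <= pi]. *)
have [->|Dpi] := eqVneq D pi.
  rewrite cospi; have := h1 b; rewrite in_itv/= ab lexx => /(_ isT).
  by rewrite ler_norml => /andP[].
have {Dpi wpi} Dpi : D < pi by rewrite lt_neqAle Dpi.
have pi0 := @pi_gt0 R.
have main e : 0 < e -> e < pi / 2 -> e <= pi - D -> 0 <= cos e * h b - cos (D + e).
  move=> e0 epi eD.
  have k0 : 0 < cos e by apply: cos_gt0_pihalf; rewrite epi andbT (lt_trans _ e0)// oppr_lt0 divr_gt0.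
  have k1 : cos e < 1.
    by rewrite -(@cos0 R) ltr_cos// in_itv/= ?lexx ?ltW//; lra.
  set k := cos e in k0 k1 *.
  have kh t : t \in `[a, b] -> `|k * h t| < 1.
    move=> tab; rewrite normrM (gtr0_norm k0) (le_lt_trans _ k1)//.
    by rewrite ler_piMr ?h1// ltW.
  pose q t := Num.sqrt (1 - (k * h t) ^+ 2).
  have q0 t : t \in `[a, b] -> 0 < q t.
    move=> /kh kht; rewrite sqrtr_gt0 subr_gt0 -real_normK ?num_real//.
    by rewrite expr_lt1.
  (* [F] starts at [w a - e], as [acos (cos e) = e], and it is nondecreasing because
     [k * sqrt (1 - h^2) <= q]. At [b] this reads [acos (k * h b) <= D + e]. *)
  pose F t := w t - acos (k * h t).
  have Fc : {within `[a, b], continuous F}.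
    apply/subspace_continuousP => t tab; apply: cvgB.
      by move/subspace_continuousP : wc => /(_ t tab).
    apply: (@cvg_comp _ _ _ (fun t => k * h t) acos _ (nbhs (k * h t))).
      by apply: cvgMr; move/subspace_continuousP : hc => /(_ t tab).
    by apply: continuous_acos; move: (kh t tab); rewrite ltr_norml.
  have sub t : t \in `]a, b[ -> t \in `[a, b] by exact: subset_itv_oo_cc.
  have Fd t : t \in `]a, b[ -> t \notin s ->
      is_derive t 1 F (r t - - (q t)^-1 * (k * dh t)).
    move=> tab ts; apply: is_deriveB; first exact: wd.
    apply: (@is_derive1_comp _ acos (fun t => k * h t)).
      apply: is_derive1_acos; move: (kh t (sub _ tab)); rewrite ltr_norml.
      exact.
    have := is_deriveZ k (hd t tab ts); apply.
  have := nondecreasing_off_finite ab Fc Fd.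
  rewrite /F ha mulr1 cosK; last by rewrite in_itv/= ltW//=; lra.
  have hb1 : `|k * h b| < 1 by apply: kh; rewrite in_itv/= ab lexx.
  have bI : (-1 <= k * h b <= 1) by move: hb1; rewrite ltr_norml => /andP[? ?]; rewrite !ltW.
  move=> Fm; have {Fm} Fm : acos (k * h b) <= D + e.
    suff hw : w a - e <= w b - acos (k * h b) by rewrite /D; lra.
    apply: Fm => t tab ts; have tab' := sub t tab.
    have qk : k * Num.sqrt (1 - h t ^+ 2) <= q t.
      rewrite -ler_sqr ?nnegrE ?mulr_ge0 ?sqrtr_ge0 ?(ltW (q0 _ _)) ?(ltW k0)//.
      have ht1 : h t ^+ 2 <= 1.
        by rewrite -real_normK ?num_real// expr_le1 ?h1.
      rewrite exprMn !sqr_sqrtr ?subr_ge0//; last first.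
        by rewrite -real_normK ?num_real// expr_le1// ltW// kh.
      by rewrite mulrBr mulr1 exprMn lerB// expr_le1 ?(ltW k1) ?(ltW k0).
    have rk : r t * (k * Num.sqrt (1 - h t ^+ 2)) <= r t * q t.
      by rewrite ler_wpM2l ?r0.
    have : k * (- r t * Num.sqrt (1 - h t ^+ 2)) <= k * dh t.
      by rewrite ler_wpM2l ?dhr// ltW.
    move=> kd; rewrite -(pmulr_rge0 _ (q0 t tab')).
    have -> : q t * (r t - - (q t)^-1 * (k * dh t)) = q t * r t + k * dh t.
      by field; rewrite gt_eqF ?q0.
    by move: rk kd; lra.
  have aI : acos (k * h b) \in `[0, pi] by rewrite in_itv/= acos_ge0// acos_lepi.
  have DI : D + e \in `[0, pi] by rewrite in_itv/=; apply/andP; split; lra.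
  by rewrite subr_ge0 -[leRHS]acosK ?in_itv// leNgt ltr_cos// -leNgt.
have : cos e * h b - cos (D + e) @[e --> (0:R)^'+] --> cos 0 * h b - cos (D + 0).
  apply: cvg_at_right_filter; apply: cvgB.
    by apply: cvgMl; exact: continuous_cos.
  apply: continuous_cvg; first exact: continuous_cos.
  by apply: cvgD; [exact: cvg_cst|exact: cvg_id].
rewrite cos0 mul1r addr0 => lim0; rewrite -subr_ge0 -(cvg_lim _ lim0)//.
apply: limr_ge; first exact: cvgP lim0.
near=> e; apply: main.
- by near: e; exact: nbhs_right_gt.
- by near: e; apply: nbhs_right_lt; rewrite divr_gt0.
- by near: e; apply: nbhs_right_le; rewrite subr_gt0.
Unshelve. all: by end_near. Qed.

Lemma constant_off_finite F s a b : a <= b ->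
  {within `[a, b], continuous F} ->
  (forall t, t \in `]a, b[ -> t \notin s -> is_derive t 1 F 0) -> F a = F b.
Proof.
move=> ab Fc Fd; apply/eqP; rewrite eq_le (nondecreasing_off_finite ab Fc Fd)//=.
rewrite -lerN2; apply: (@nondecreasing_off_finite (fun t => - F t) (fun=> - 0) s) => //.
- by move=> t; apply: continuousN; exact: Fc.
- by move=> t tab ts; apply: is_deriveN; exact: Fd.
Qed.

Lemma open_itv_off_finite a b s : open (`]a, b[ `\` [set` s]).
Proof.
rewrite setDE; apply: openI; first exact: interval_open.
apply: closed_openC; apply: (@accessible_finite_set_closed _).1 => //.
  exact/hausdorff_accessible/norm_hausdorff.
exact: finite_seq.
Qed.

Section Primitive.
Variables (f : R -> R) (a b : R) (s : seq R).
Hypotheses (ab : a < b)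
  (fc : forall t, t \in `]a, b[ -> t \notin s -> {for t, continuous f})
  (fb : exists K : R, forall t, t \in `]a, b[ -> t \notin s -> `|f t| <= K).

Let mu := @lebesgue_measure R.

Let D : set R := `]a, b[ `\` [set` s].
Let N : set R := `[a, b] `&` [set` a :: b :: s].

Let itvDN : `[a, b]%classic = D `|` N.
Proof.
apply/seteqP; split=> [t tab|t [[/= tab _]|[]//]]; last exact: subset_itv_oo_cc.
have [ts|ts] := boolP (t \in a :: b :: s); [by right|left].
move: ts; rewrite !inE !negb_or => /and3P[ta tb ts]; split; last exact/negP.
by move: tab; rewrite /= !in_itv/= => /andP[at_ tb_]; rewrite !lt_neqAle at_ tb_ tb eq_sym ta.
Qed.

Let openD : open D := @open_itv_off_finite a b s.

Let finN : finite_set N.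
Proof. by apply: (@sub_finite_set _ _ [set` a :: b :: s]) => // x []. Qed.

Let measurableN' : measurable N.
Proof.
apply: countable_measurable => [x|]; first exact: measurable_set1.
exact: (finite_set_countable finN).
Qed.

Lemma integrable_off_finite : mu.-integrable `[a, b] (EFin \o f).
Proof.
apply: measurable_bounded_integrable => //.
- by rewrite /= lebesgue_measure_itv/=; case: ifP => _; rewrite ?ltry// -EFinB ltry.
- rewrite itvDN; apply/measurable_funU.
  + apply: measurableD; first exact: measurable_itv.
    apply: countable_measurable => [x|]; first exact: measurable_set1.
    by apply: finite_set_countable; exact: finite_seq.
  + exact: measurableN'.
  split.
  + apply: subspace_continuous_measurable_fun.
      apply: measurableD; first exact: measurable_itv.
      apply: countable_measurable => [x|]; first exact: measurable_set1.
      by apply: finite_set_countable; exact: finite_seq.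
    rewrite continuous_open_subspace// => t; rewrite inE => -[/= tab ts].
    by apply: fc => //; apply/negP.
  + move=> _ Y mY; apply: countable_measurable => [x|]; first exact: measurable_set1.
    by apply/finite_set_countable/(sub_finite_set _ finN) => x [].
- have [K fK] := fb.
  (* The values of [f] at the exceptional points are arbitrary; the sum of their absolute values
     bounds them. *)
  pose S := \sum_(x <- a :: b :: s) `|f x|.
  have S0 : 0 <= S by exact: sumr_ge0.
  exists (`|K| + S); split; first exact: num_real.
  move=> M KM t tab; apply/ltW/(le_lt_trans _ KM).
  have [ts|ts] := boolP (t \in a :: b :: s).
    by rewrite ler_wpDl// /S (big_rem _ ts)/= lerDl sumr_ge0.
  rewrite ler_wpDr// (le_trans _ (ler_norm _))//; move: ts.
  rewrite !inE !negb_or => /and3P[ta tb ts]; apply: fK => //.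
  by move: tab; rewrite /= !in_itv/= => /andP[at_ tb_]; rewrite !lt_neqAle at_ tb_ tb eq_sym ta.
Qed.

Definition primitive t := \int[mu]_(x in `[a, t]) f x.

Lemma primitive_left : primitive a = 0.
Proof. by rewrite /primitive set_itv1 Rintegral_set1. Qed.

Lemma primitive_continuous : {within `[a, b], continuous primitive}.
Proof.
exact: (@parameterized_integral_continuous _ _ _ _ (ltW ab) integrable_off_finite).
Qed.

Lemma primitive_is_derive t : t \in `]a, b[ -> t \notin s -> is_derive t 1 primitive (f t).
Proof.
move=> tab ts; have := tab; rewrite in_itv/= => /andP[at_ tb].
have [d1 d2] := continuous_FTC1_closed tb integrable_off_finite at_ (fc tab ts).
by apply: DeriveDef => //; rewrite -derive1E.
Qed.

End Primitive.

End ScalarCalculus.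

(** * Pieces of a partition *)

Section Partitions.
Variable R : realType.
Implicit Types (a b t : R) (s : seq R).

(** The disjunctions make the piece a neighbourhood of [t] in [[a, b]], so one-sided derivatives
    arise only at [a] and [b]. No piece has this property at an interior partition point. *)
Lemma partition_piece b s a t : itv_partition a b s -> a < b ->
  t \in `[a, b] -> (t \in s -> t = b) ->
  exists i, [/\ (i < size s)%N, nth b (a :: s) i < nth b (a :: s) i.+1,
    a <= nth b (a :: s) i /\ nth b (a :: s) i.+1 <= b,
    (nth b (a :: s) i < t \/ t = a /\ nth b (a :: s) i = a) /\
    (t < nth b (a :: s) i.+1 \/ t = b /\ nth b (a :: s) i.+1 = b) &
    forall r, nth b (a :: s) i < r -> r < nth b (a :: s) i.+1 -> r \notin s].
Proof.
elim: s a => [|x s ih] a abs ab; first by rewrite (itv_partition_nil abs) ltxx in ab.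
have [/= /andP[ax xs] lb] := abs.
have xbs : itv_partition x b s by exact: itv_partition_cons abs.
have xb := itv_partition_le xbs.
rewrite in_itv/= => /andP[at_ tb] ts.
have [tx|xt] := leP t x.
  exists 0%N; split => //=.
  - split.
      by move: at_; rewrite le_eqVlt => /predU1P[->|]; [right|left].
    move: tx; rewrite le_eqVlt => /predU1P[tx|]; last by left.
    by right; have := ts; rewrite tx inE eqxx => /(_ isT) ->.
  - move=> r ar rx; rewrite inE negb_or lt_eqF//=.
    apply/negP => rs; have := order_path_min lt_trans xs => /allP /(_ r rs).
    by rewrite ltNge (ltW rx).
have xb' : x < b by exact: lt_le_trans xt tb.
have [|ts'|i [is_ cd [xc db] [ct td] rs]] := ih x xbs xb'.
- by rewrite in_itv/= (ltW xt).
- by apply: ts; rewrite inE ts' orbT.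
exists i.+1; split => //=.
- by split => //; rewrite (le_trans (ltW ax)).
- split => //; left; case: ct => // -[_ ->]; exact: xt.
- move=> r cr rd; rewrite inE negb_or rs// andbT gt_eqF//.
  exact: le_lt_trans xc cr.
Qed.

End Partitions.

(** * Operator norm and unitary operators *)

Section OperatorNorm.
Variables (R : realType) (H : completeNormedModType R[i]).
Implicit Types (f g : bop H).

Lemma opnorm_ge0 f : 0 <= opnorm f.
Proof. by rewrite -ler0c -bop_normE normr_ge0. Qed.

Lemma opnorm_le f (M : R) : 0 <= M ->
  (forall x, rnorm (f x) <= M * rnorm x) -> opnorm f <= M.
Proof.
move=> M0 fM; apply: ge_sup; first by exists (complex.Re `|f 0|), 0 => //=; rewrite normr0.
move=> _ [x /= x1 <-]; rewrite -[complex.Re _]/(rnorm (f x)) (le_trans (fM x))//.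
by rewrite ler_piMr// -lecR -normrE.
Qed.

Lemma opnormD f g : opnorm (f + g) <= opnorm f + opnorm g.
Proof. by rewrite -lecR rmorphD/= -!bop_normE ler_normD. Qed.

Lemma opnormN f : opnorm (- f) = opnorm f.
Proof. by apply: (@complexI R); rewrite -!bop_normE normrN. Qed.

Lemma opnormB f g : opnorm (f - g) = opnorm (g - f).
Proof. by rewrite -opnormN opprB. Qed.

Lemma opnormM f g : opnorm (f * g) <= opnorm f * opnorm g.
Proof.
apply: opnorm_le => [|x]; first by rewrite mulr_ge0 ?opnorm_ge0.
rewrite bop_mulE (le_trans (rnorm_bop _ _))// -mulrA ler_wpM2l ?opnorm_ge0//.
exact: rnorm_bop.
Qed.

Lemma cvg_opnorm T (F : set_system T) (FF : Filter F) (f : T -> bop H) (g : bop H) :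
  f @ F --> g <-> (fun r => opnorm (f r - g)) @ F --> 0.
Proof.
split=> [/cvgrPdist_lt fg|/cvgrPdist_lt fg].
  apply/cvgrPdist_lt => e e0; have := fg e%:C%C; rewrite ltcR => /(_ e0).
  apply: filterS => r; rewrite /= bop_normE ltcR opnormB sub0r normrN.
  by rewrite ger0_norm ?opnorm_ge0.
apply/cvgrPdist_lt => e e0.
have eE : e = (complex.Re e)%:C%C by rewrite RRe_real// gtr0_real.
have := fg (complex.Re e); rewrite -ltcR -eE => /(_ e0).
apply: filterS => r; rewrite /= sub0r normrN ger0_norm ?opnorm_ge0//.
by rewrite opnormB bop_normE eE ltcR.
Qed.

End OperatorNorm.

Section Unitary.
Variables (R : realType) (H : completeNormedModType R[i]).
Variable ip : {dot H for @conjC R[i]}.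
Hypothesis ip_norm : forall x, ip x x = `|x| ^+ 2.
Implicit Types (u v : bop H) (x y : H).
Local Notation J x := (('i%C : R[i]) *: x).
Local Notation rp := (rip ip).

Lemma unitary_rip u x y : unitary ip u -> rp (u x) (u y) = rp x y.
Proof. by move=> [uu _]; rewrite /rip uu. Qed.

Lemma unitary_rnorm u x : unitary ip u -> rnorm (u x) = rnorm x.
Proof.
move=> uu; apply/eqP; rewrite -(eqrXn2 (n := 2)) ?rnorm_ge0//.
by rewrite -!(ripxx ip_norm) unitary_rip.
Qed.

Lemma unitary_inverse u : unitary ip u -> bop_inverse u (bop_inv u).
Proof.
move=> uu; have [V uV] : bop_inverse u !=set0.
  apply: (@bijective_inverse _ _ _ 1) => //; last exact: uu.2.
  by move=> x; rewrite mul1r unitary_rnorm.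
by rewrite (bop_invP uV).
Qed.

Lemma unitaryK u x : unitary ip u -> bop_inv u (u x) = x.
Proof. by move=> /unitary_inverse[_ h]; rewrite -bop_mulE h. Qed.

Lemma unitaryVK u x : unitary ip u -> u (bop_inv u x) = x.
Proof. by move=> /unitary_inverse[h _]; rewrite -bop_mulE h. Qed.

Lemma unitary_adj u x y : unitary ip u -> rp (bop_inv u x) y = rp x (u y).
Proof. by move=> uu; rewrite -(unitary_rip _ _ uu) unitaryVK. Qed.

Lemma unitary_inv u : unitary ip u -> unitary ip (bop_inv u).
Proof.
move=> uu; split=> [x y|y]; last by exists (u y); rewrite unitaryK.
by rewrite -[LHS]uu.1 !unitaryVK.
Qed.

Lemma unitary_opnorm u : unitary ip u -> opnorm u <= 1.
Proof. by move=> uu; apply: opnorm_le => // x; rewrite mul1r unitary_rnorm. Qed.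

(** [u^-1 - v^-1 = u^-1 (v - u) v^-1], with isometries on both sides. *)
Lemma unitary_inv_lipschitz u v : unitary ip u -> unitary ip v ->
  opnorm (bop_inv u - bop_inv v) <= opnorm (u - v).
Proof.
move=> uu uv; apply: opnorm_le; first exact: opnorm_ge0.
move=> x; rewrite -(unitary_rnorm _ uu) bop_addE bop_oppE bopB unitaryVK//.
rewrite -{1}(unitaryVK x uv) -[v _ - _]/((v - u) (bop_inv v x)).
rewrite (le_trans (rnorm_bop _ _))// opnormB unitary_rnorm//.
exact: unitary_inv.
Qed.

End Unitary.

(** * Logarithmic derivatives of a piecewise C^1 curve of unitary operators *)

Section Curve.
Variables (R : realType) (H : completeNormedModType R[i]).
Variable ip : {dot H for @conjC R[i]}.
Hypothesis ip_norm : forall x, ip x x = `|x| ^+ 2.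
Implicit Types (u v : bop H) (x y : H).
Local Notation "r *' x" := ((r%:C%C : R[i]) *: x) (at level 40).
Local Notation J x := (('i%C : R[i]) *: x).
Local Notation rp := (rip ip).

Lemma near_withinW T (D : set T) (F : set_system T) (FF : Filter F) (P : set T) :
  (forall r, D r -> P r) -> \forall r \near within D F, P r.
Proof. by move=> DP; exact: (filterS (fun r _ => @DP r) filterT). Qed.

Lemma cvg_rnorm_bop T (F : set_system T) (FF : Filter F) (f : T -> bop H) (g : bop H) x :
  f @ F --> g -> (fun r => rnorm (f r x - g x)) @ F --> 0.
Proof.
move=> /cvg_opnorm fg; rewrite -(mul0r (rnorm x)).
apply: (@squeeze_cvgr _ _ _ _ (cst 0) (fun r => opnorm (f r - g) * rnorm x)).
- by near=> r; rewrite rnorm_ge0/= -[f r x - g x]/((f r - g) x) rnorm_bop.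
- by rewrite mul0r; exact: cvg_cst.
- exact: cvgMl.
Unshelve. all: by end_near. Qed.

Lemma cvg_rip T (F : set_system T) (FF : Filter F) (f g : T -> H) x y :
  (fun r => rnorm (f r - x)) @ F --> 0 -> (fun r => rnorm (g r - y)) @ F --> 0 ->
  (fun r => rp (f r) (g r)) @ F --> rp x y.
Proof.
move=> fx gy; apply/subr_cvg0/norm_cvg0P.
pose u r := rnorm (f r - x); pose v r := rnorm (g r - y).
apply: (@squeeze_cvgr _ _ _ _ (cst 0)
    (fun r => u r * rnorm y + rnorm x * v r + u r * v r)).
- near=> r; rewrite normr_ge0/=.
  have -> : rp (f r) (g r) - rp x y =
      rp (f r - x) y + rp x (g r - y) + rp (f r - x) (g r - y).
    by rewrite !ripE; ring.
  rewrite (le_trans (ler_normD _ _))// lerD ?cauchy_schwarz//.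
  by rewrite (le_trans (ler_normD _ _))// lerD ?cauchy_schwarz.
- exact: cvg_cst.
- have -> : 0 = 0 * rnorm y + rnorm x * 0 + 0 * 0 :> R by rewrite !(mul0r, mulr0, addr0).
  by apply: cvgD; [apply: cvgD; [exact: cvgMl|exact: cvgMr]|exact: cvgM].
Unshelve. all: by end_near. Qed.

Lemma cvg_rip_bop T (F : set_system T) (FF : Filter F) (f : T -> bop H) (g : bop H) x y :
  f @ F --> g -> (fun r => rp (f r x) y) @ F --> rp (g x) y.
Proof.
move=> fg; apply: (@cvg_rip _ _ _ _ (cst y)); first exact: cvg_rnorm_bop.
by under eq_fun do rewrite subrr rnorm0; exact: cvg_cst.
Qed.

(** Operator curves are differentiated through their matrix coefficients, which leaves only real
    functions to deal with. *)
Lemma diff_quotient_derive (g : R -> bop H) t v x y :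
  diff_quotient g t @ t^' --> v ->
  is_derive t 1 (fun r => rp (g r x) y) (rp (v x) y).
Proof.
move=> gv; apply: is_derive_quotient.
have : (fun r => rp (diff_quotient g t r x) y) @ t^' --> rp (v x) y.
  exact: cvg_rip_bop.
by under eq_fun do rewrite /diff_quotient bop_scaleE bop_addE bop_oppE ripZl ripBl.
Qed.

(** A point of a nondegenerate interval is not isolated in it. Hence limits along this filter are
    unique, and [velocity], defined by [lim], can be computed. *)
Lemma within_itv_proper (c d t : R) : c < d -> t \in `[c, d] ->
  ProperFilter (within `[c, d] t^').
Proof.
move=> cd; rewrite in_itv/= => /andP[ct td].
apply: Build_ProperFilter_ex => A [e /= e0 eA].
have [tld|dlt] := ltP t d.
  pose r := Num.min d (t + e / 2).
  have rt : t < r by rewrite lt_min tld ltrDl divr_gt0.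
  exists r; apply: eA => /=.
  - rewrite distrC gtr0_norm ?subr_gt0// ltrBlDl.
    by rewrite (@le_lt_trans _ _ (t + e / 2))// ?ge_min ?lexx ?orbT// ltrD2l; lra.
  - by rewrite gt_eqF.
  - by rewrite in_itv/= ge_min lexx (le_trans ct (ltW rt)).
have td' : t = d by apply/eqP; rewrite eq_le td.
pose r := Num.max c (t - e / 2).
have rt : r < t by rewrite gt_max td' cd/= ltrBlDr ltrDl divr_gt0.
exists r; apply: eA => /=.
- rewrite gtr0_norm ?subr_gt0// ltrBlDl -ltrBlDr.
  by rewrite (@lt_le_trans _ _ (t - e / 2))// ?le_max ?lexx ?orbT// ltrD2l; lra.
- by rewrite lt_eqF.
- by rewrite in_itv/= le_max lexx (le_trans (ltW rt) td).
Qed.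

(* [c, d] is a neighbourhood of t in [a, b]. *)
Lemma velocity_eq (a b c d t : R) (g : R -> bop H) v : a < b ->
  a <= c -> d <= b -> t \in `[c, d] ->
  (c < t \/ t = a /\ c = a) -> (t < d \/ t = b /\ d = b) ->
  has_derivative_on c d g t v -> velocity a b g t = v.
Proof.
move=> ab ac db tcd ct td gv.
have tab : t \in `[a, b].
  by move: tcd; rewrite !in_itv/= => /andP[? ?]; rewrite (le_trans ac)// (le_trans _ db).
have P := within_itv_proper ab tab.
apply: cvg_lim; first exact: norm_hausdorff.
apply: cvg_trans gv; apply: cvg_app => A hA.
have hc : \forall r \near t^', a <= r -> c <= r.
  case: ct => [ct|[_ ->]]; last exact: nearW.
  by apply: nbhs_dnbhs; apply: filterS (lt_nbhsr ct) => r /ltW.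
have hd : \forall r \near t^', r <= b -> r <= d.
  case: td => [td|[_ ->]]; last exact: nearW.
  by apply: nbhs_dnbhs; apply: filterS (lt_nbhsl td) => r /ltW.
suff h : \forall r \near t^', r \in `[a, b] -> A r by exact: h.
have hA' : \forall r \near t^', r \in `[c, d] -> A r := hA.
apply: filterS3 hA' hc hd => r rA rc rd; rewrite in_itv/= => /andP[ar rb].
by apply: rA; rewrite in_itv/= rc// rd.
Qed.

Lemma interior_derivative (c d t : R) (g : R -> bop H) v : c < t -> t < d ->
  has_derivative_on c d g t v -> diff_quotient g t @ t^' --> v.
Proof.
move=> ct td; apply: cvg_trans; apply: cvg_app => A hA.
have hc : \forall r \near t^', c <= r.
  by apply: nbhs_dnbhs; apply: filterS (lt_nbhsr ct) => r /ltW.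
have hd : \forall r \near t^', r <= d.
  by apply: nbhs_dnbhs; apply: filterS (lt_nbhsl td) => r /ltW.
have hA' : \forall r \near t^', r \in `[c, d] -> A r := hA.
by apply: filterS3 hA' hc hd => r rA rc rd; apply: rA; rewrite in_itv/= rc.
Qed.

Variables (a b : R) (s : seq R) (gamma : R -> bop H).
Hypotheses (ab : a < b)
  (gamma_unitary : forall t, t \in `[a, b] -> unitary ip (gamma t))
  (gamma_C1 : piecewise_C1 a b s gamma).

Local Notation logder := (right_logder a b gamma).

(** [dg] is a continuous version of the velocity on all of [[c, d]], whereas [velocity] may be
    unspecified at an end of the piece that is an interior partition point. *)
Let piece t c d (dg : R -> bop H) := [/\ c < d, a <= c /\ d <= b,
  (c < t \/ t = a /\ c = a) /\ (t < d \/ t = b /\ d = b),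
  (forall r, c < r -> r < d -> r \notin s) &
  (forall r, r \in `[c, d] -> has_derivative_on c d gamma r (dg r)) /\
  {within `[c, d], continuous dg}].

Let ex_piece t : off_partition a b s t -> exists c d dg, piece t c d dg.
Proof.
have [abs _ C1] := gamma_C1.
move=> [tab ts]; have [i [is_ cd acdb ctd rs]] := partition_piece abs ab tab ts.
by have [dg [gdg dgc]] := C1 i is_; exists (nth b (a :: s) i), (nth b (a :: s) i.+1), dg.
Qed.

Let piece_mem t c d dg : piece t c d dg -> t \in `[c, d].
Proof.
move=> [cd _ [ct td] _ _]; rewrite in_itv/=; apply/andP; split.
  by case: ct => [/ltW//|[-> ->]].
by case: td => [/ltW//|[-> ->]].
Qed.

Let sub_piece c d r : a <= c -> d <= b -> r \in `[c, d] -> r \in `[a, b].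
Proof.
by move=> ac db; rewrite !in_itv/= => /andP[? ?]; rewrite (le_trans ac)// (le_trans _ db).
Qed.

Let piece_velocity t c d dg : piece t c d dg -> velocity a b gamma t = dg t.
Proof.
move=> p; have := piece_mem p; move: p => [cd [ac db] [ct td] _ [gdg _]] tcd.
exact: velocity_eq (gdg t tcd).
Qed.

Let piece_interior t c d dg r : piece t c d dg -> c < r -> r < d -> piece r c d dg.
Proof. by move=> [? ? _ ? ?] cr rd; split => //; split; left. Qed.

Let gamma_cvg t c d : a <= c -> d <= b -> t \in `[c, d] ->
  gamma @ within `[c, d] (nbhs t) --> gamma t.
Proof.
move=> ac db tcd; have [_ gc _] := gamma_C1.
move/subspace_continuousP : gc => /(_ t (sub_piece ac db tcd)).
apply: cvg_trans; apply: cvg_app => A hA.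
have hA' : \forall r \near t, r \in `[a, b] -> A r := hA.
suff h : \forall r \near t, r \in `[c, d] -> A r by exact: h.
by apply: filterS hA' => r rA rcd; apply: rA; exact: sub_piece rcd.
Qed.

Lemma gamma_continuous_rip x y : {within `[a, b], continuous (fun t => rp (gamma t x) y)}.
Proof.
apply/subspace_continuousP => t tab; apply: cvg_rip_bop.
exact: gamma_cvg.
Qed.

Lemma off_partition_interior t : t \in `]a, b[ -> t \notin s -> off_partition a b s t.
Proof.
move=> tab ts; split; first exact: subset_itv_oo_cc.
by move=> h; rewrite h in ts.
Qed.

Let piece_in t c d dg : t \in `]a, b[ -> piece t c d dg -> c < t /\ t < d.
Proof.
rewrite in_itv/= => /andP[at_ tb] [_ _ [ct td] _ _]; split.
  by case: ct => // -[ta _]; rewrite ta ltxx in at_.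
by case: td => // -[ta _]; rewrite ta ltxx in tb.
Qed.

Lemma logder_gamma t x : t \in `[a, b] -> logder t (gamma t x) = velocity a b gamma t x.
Proof. by move=> tab; rewrite /right_logder bop_mulE (unitaryK ip_norm)//; exact: gamma_unitary. Qed.

Lemma gamma_is_derive t x y : t \in `]a, b[ -> t \notin s ->
  is_derive t 1 (fun r => rp (gamma r x) y) (rp (logder t (gamma t x)) y).
Proof.
move=> tab ts; have [c [d [dg p]]] := ex_piece (off_partition_interior tab ts).
have [ct td] := piece_in tab p.
rewrite logder_gamma; last exact: subset_itv_oo_cc.
apply: diff_quotient_derive; apply: (interior_derivative ct td).
rewrite (piece_velocity p); have := piece_mem p.
by case: p => _ _ _ _ [gdg _] tcd; exact: gdg.
Qed.

(** Since [gamma r] and [gamma t] are isometries, [<(gamma r - gamma t) y, (gamma r + gamma t) y>]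
    has real part 0. Dividing by [r - t] and letting [r] tend to [t] gives
    [2 Re <gamma' y, gamma y> = 0], for one-sided derivatives too. *)
Lemma logder_skew t : off_partition a b s t -> skew ip (logder t).
Proof.
move=> toff x; have [c [d [dg p]]] := ex_piece toff.
have tcd := piece_mem p.
have uu : unitary ip (gamma t) by case: toff => tab _; exact: gamma_unitary.
rewrite /right_logder bop_mulE (piece_velocity p) -{2}(unitaryVK ip_norm x uu).
set y := bop_inv _ x.
case: p => cd [ac db] _ _ [gdg _].
have P := within_itv_proper cd tcd.
have lim1 : (fun r => rp (diff_quotient gamma t r y) (gamma r y + gamma t y))
    @ within `[c, d] t^' --> rp (dg t y) (gamma t y + gamma t y).
  apply: cvg_rip; first by apply: cvg_rnorm_bop; exact: gdg.
  under eq_fun do rewrite opprD addrACA subrr addr0.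
  apply: cvg_rnorm_bop; have := gamma_cvg ac db tcd.
  apply: cvg_trans; apply: cvg_app => A.
  by rewrite /within /=; exact: nbhs_dnbhs.
have lim0 : (fun r => rp (diff_quotient gamma t r y) (gamma r y + gamma t y))
    @ within `[c, d] t^' --> (0 : R).
  apply: cvg_near_cst; apply: near_withinW => r /= rcd.
  have rab := sub_piece ac db rcd.
  rewrite /diff_quotient ?bop_scaleE ?bop_addE ?bop_oppE !ripE (ripC ip (gamma t y)).
  by rewrite !(unitary_rip _ _ (gamma_unitary _))//; [ring|case: toff].
have : rp (dg t y) (gamma t y + gamma t y) = 0.
  exact: (cvg_unique (@norm_hausdorff _ R) lim1 lim0).
rewrite ripDr => /eqP.
by rewrite -mulr2n mulrn_eq0 => /eqP.
Qed.

Let logder_lip t r c d dg : piece t c d dg -> c < r -> r < d ->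
  opnorm (logder r - logder t) <=
    opnorm (dg r - dg t) + opnorm (dg t) * opnorm (gamma r - gamma t).
Proof.
move=> p cr rd; have pr := piece_interior p cr rd.
rewrite /right_logder (piece_velocity p) (piece_velocity pr).
have tcd := piece_mem p; have rcd := piece_mem pr.
case: p => _ [ac db] _ _ _.
have ut : unitary ip (gamma t) by apply: gamma_unitary; exact: sub_piece tcd.
have ur : unitary ip (gamma r) by apply: gamma_unitary; exact: sub_piece rcd.
have -> : dg r * bop_inv (gamma r) - dg t * bop_inv (gamma t) =
    (dg r - dg t) * bop_inv (gamma r) + dg t * (bop_inv (gamma r) - bop_inv (gamma t)).
  by rewrite mulrBl mulrBr addrA subrK.
rewrite (le_trans (opnormD _ _))// lerD//.
  rewrite (le_trans (opnormM _ _))// ler_piMr ?opnorm_ge0//.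
  by apply: (unitary_opnorm ip_norm); exact: unitary_inv.
rewrite (le_trans (opnormM _ _))// ler_wpM2l ?opnorm_ge0//.
exact: (unitary_inv_lipschitz ip_norm).
Qed.

Let logder_cvg t c d dg : piece t c d dg ->
  (fun r => opnorm (logder r - logder t)) @ within `]c, d[ (nbhs t) --> 0.
Proof.
move=> p; have tcd := piece_mem p.
have sub : within `]c, d[ (nbhs t) `=>` within `[c, d] (nbhs t).
  move=> A; rewrite /within /=; apply: filterS => r rA rcd.
  by apply: rA; exact: subset_itv_oo_cc.
apply: (@squeeze_cvgr _ _ _ _ (cst 0)
   (fun r => opnorm (dg r - dg t) + opnorm (dg t) * opnorm (gamma r - gamma t))).
- apply: near_withinW => r; rewrite /= in_itv/= => /andP[cr rd].
  by rewrite opnorm_ge0/=; exact: (logder_lip p).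
- exact: cvg_cst.
- have -> : 0 = 0 + opnorm (dg t) * 0 :> R by rewrite mulr0 addr0.
  case: p => _ [ac db] _ _ [_ dgc].
  apply: cvgD.
    apply/cvg_opnorm; move/subspace_continuousP : dgc => /(_ t tcd).
    by apply: cvg_trans; apply: cvg_app.
  apply: cvgMr; apply/cvg_opnorm; have := gamma_cvg ac db tcd.
  by apply: cvg_trans; apply: cvg_app.
Qed.

Lemma logder_continuous t : t \in `]a, b[ -> t \notin s ->
  (fun r => opnorm (logder r - logder t)) @ t --> 0.
Proof.
move=> tab ts; have [c [d [dg p]]] := ex_piece (off_partition_interior tab ts).
have := logder_cvg p; rewrite within_interior//.
have [ct td] := piece_in tab p.
by apply: near_in_itvoo; rewrite in_itv/= ct.
Qed.

(** Of interest at [a] and [b]: what is proved by differentiation at interior points is carried over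
    to the end points. *)
Lemma logder_approx t (e : R) : off_partition a b s t -> 0 < e ->
  exists r, [/\ r \in `]a, b[, r \notin s & opnorm (logder r - logder t) < e].
Proof.
move=> toff e0; have [c [d [dg p]]] := ex_piece toff.
have := logder_cvg p => /cvgrPdist_lt /(_ e e0)[k /= k0 kP].
have tcd := piece_mem p; case: p => cd [ac db] _ cds _.
move: tcd; rewrite in_itv/= => /andP[ct td].
(* The point [r] below moves [t] towards the middle of the piece by the fraction [l], hence by less
   than [k]; it falls strictly inside even if [t] is an end point. *)
pose l := Num.min 1 (k / (2 * (d - c))).
have dc0 : 0 < d - c by rewrite subr_gt0.
have l0 : 0 < l by rewrite lt_min ltr01 divr_gt0// mulr_gt0.
have l1 : l <= 1 by rewrite ge_min lexx.
have lk : l * (d - c) < k.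
  rewrite (@le_lt_trans _ _ (k / (2 * (d - c)) * (d - c)))//.
    by rewrite ler_pM2r// ge_min lexx orbT.
  have -> : k / (2 * (d - c)) * (d - c) = k / 2 by field; rewrite gt_eqF.
  by lra.
pose r := t + l * ((c + d) / 2 - t).
have cr : c < r by rewrite /r; nra.
have rd : r < d by rewrite /r; nra.
exists r; split.
- by rewrite in_itv/= (le_lt_trans ac cr) (lt_le_trans rd db).
- exact: cds.
have := kP r; rewrite sub0r normrN ger0_norm ?opnorm_ge0//; apply.
  rewrite /= /r opprD addrA subrr sub0r normrN normrM gtr0_norm//.
  rewrite (le_lt_trans _ lk)// ler_wpM2l ?(ltW l0)// ler_norml; lra.
by rewrite /= in_itv/= cr.
Qed.

(** On each closed piece the norm of [dg] attains a maximum; the sum over the pieces bounds them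
    all. *)
Lemma logder_bounded : exists K : R, forall t, t \in `]a, b[ -> t \notin s ->
  opnorm (logder t) <= K.
Proof.
have [abs _ C1] := gamma_C1.
have /choice[K KP] : forall i, exists K, (i < size s)%N -> forall r,
    nth b (a :: s) i < r -> r < nth b (a :: s) i.+1 -> opnorm (logder r) <= K.
  move=> i; have [is_|] := boolP (i < size s)%N; last by exists 0.
  have [dg [gdg dgc]] := C1 i is_.
  set c := nth b (a :: s) i in gdg dgc *; set d := nth b (a :: s) i.+1 in gdg dgc *.
  have ac : a <= c by apply: itv_partition_nth_ge abs; exact: ltnW.
  have db : d <= b by exact: itv_partition_nth_le abs.
  have [cd|dc] := ltP c d; last first.
    by exists 0 => _ r cr rd; have := lt_trans cr rd; rewrite ltNge dc.
  have dgnc : {within `[c, d], continuous (fun r => opnorm (dg r))}.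
    apply/subspace_continuousP => t tcd.
    move/subspace_continuousP : dgc => /(_ t tcd) /cvg_opnorm dgt.
    apply/subr_cvg0/norm_cvg0P.
    apply: (@squeeze_cvgr _ _ _ _ (cst 0) (fun r => opnorm (dg r - dg t))) => //.
      near=> r; rewrite normr_ge0/=.
      suff h : `|opnorm (dg r) - opnorm (dg t)| <= opnorm (dg r - dg t) by exact: h.
      rewrite ler_norml.
      have := opnormD (dg r - dg t) (dg t); rewrite subrK => h1.
      have := opnormD (dg t - dg r) (dg r); rewrite subrK opnormB => h2.
      by apply/andP; split; lra.
    exact: cvg_cst.
  have [m mcd mP] := EVT_max (ltW cd) dgnc.
  exists (opnorm (dg m)) => _ r cr rd.
  have rcd : r \in `[c, d] by rewrite in_itv/= !ltW.
  have vr : velocity a b gamma r = dg r.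
    by apply: (velocity_eq ab ac db rcd _ _ (gdg r rcd)); left.
  rewrite /right_logder vr (le_trans (opnormM _ _))// (le_trans _ (mP r rcd))//.
  rewrite ler_piMr ?opnorm_ge0//; apply: (unitary_opnorm ip_norm).
  by apply: (unitary_inv ip_norm); apply: gamma_unitary; exact: sub_piece rcd.
exists (\sum_(i < size s) `|K i|) => t tab ts.
have [tab' toff] := off_partition_interior tab ts.
have [i [is_ cd _ [ct td] _]] := partition_piece abs ab tab' toff.
have {}ct : nth b (a :: s) i < t.
  by case: ct => // -[ta _]; move: tab; rewrite ta in_itv/= ltxx.
have {}td : t < nth b (a :: s) i.+1.
  by case: td => // -[ta _]; move: tab; rewrite ta in_itv/= ltxx andbF.
rewrite (le_trans (KP i is_ t ct td))// (le_trans (ler_norm _))//.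
by rewrite (bigD1 (Ordinal is_))//= lerDl sumr_ge0.
Unshelve. all: by end_near. Qed.

End Curve.

(** * Multiplication by a phase *)

Section Rotation.
Variables (R : realType) (H : completeNormedModType R[i]).
Variable ip : {dot H for @conjC R[i]}.
Hypothesis ip_norm : forall x, ip x x = `|x| ^+ 2.
Implicit Types (x y : H) (B : bop H) (t : R).
Local Notation "r *' x" := ((r%:C%C : R[i]) *: x) (at level 40).
Local Notation J x := (('i%C : R[i]) *: x).
Local Notation rp := (rip ip).

(* e^{-it} x *)
Definition rot t x : H := cos t *' x - sin t *' J x.

Lemma rnormJ x : rnorm (J x) = rnorm x.
Proof. by rewrite rnormZc normc_def/= expr0n/= add0r expr1n sqrtr1 mul1r. Qed.

Lemma rotE t x : rot t x = expi (- t) *: x.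
Proof. by rewrite [RHS]cplxZ /= cosN sinN rmorphN scaleNr. Qed.

Lemma rot0 x : rot 0 x = x.
Proof. by rewrite rotE /expi oppr0 cos0 sin0 scale1r. Qed.

Lemma rotD t u x : rot (t + u) x = rot t (rot u x).
Proof.
rewrite !rotE scalerA; congr (_ *: _).
rewrite /expi opprD cosD sinD.
by apply/eqP; rewrite eq_complex /=; apply/andP; split; apply/eqP; ring.
Qed.

Lemma rotNK t x : rot t (rot (- t) x) = x.
Proof. by rewrite -rotD subrr rot0. Qed.

Lemma rotKN t x : rot (- t) (rot t x) = x.
Proof. by rewrite -rotD addNr rot0. Qed.

Lemma rot_rip t x y : rp (rot t x) y = cos t * rp x y + sin t * rp x (J y).
Proof. by rewrite /rot ripBl !ripE ripJC; ring. Qed.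

Lemma rip_rot t x y : rp x (rot t y) = cos t * rp x y - sin t * rp x (J y).
Proof. by rewrite /rot ripBr !ripE. Qed.

Lemma rot_J t x : rot t (J x) = J (rot t x).
Proof. by rewrite !rotE !scalerA mulrC. Qed.

Lemma rot_isometry t x y : rp (rot t x) (rot t y) = rp x y.
Proof.
rewrite rot_rip -rot_J !rip_rot JJ ripNr.
transitivity ((cos t ^+ 2 + sin t ^+ 2) * rp x y); first by ring.
by rewrite cos2Dsin2 mul1r.
Qed.

Lemma bop_rot B t x : B (rot t x) = rot t (B x).
Proof. by rewrite /rot bopB !bopZ. Qed.

Lemma rotB t x y : rot t (x - y) = rot t x - rot t y.
Proof. by rewrite !rotE scalerBr. Qed.

Lemma rotZ t (k : R[i]) x : rot t (k *: x) = k *: rot t x.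
Proof. by rewrite !rotE !scalerA mulrC. Qed.

Lemma rot_rnorm t x : rnorm (rot t x) = rnorm x.
Proof.
apply/eqP; rewrite -(eqrXn2 (n := 2)) ?rnorm_ge0//.
by rewrite -!(ripxx ip_norm) rot_isometry.
Qed.

End Rotation.

(** * The angle along an orbit, and the case of equality *)

Section CurveAngle.
Variables (R : realType) (H : completeNormedModType R[i]).
Variable ip : {dot H for @conjC R[i]}.
Hypothesis ip_norm : forall x, ip x x = `|x| ^+ 2.
Hypothesis H_nonzero : exists x : H, x != 0.
Local Notation "r *' x" := ((r%:C%C : R[i]) *: x) (at level 40).
Local Notation J x := (('i%C : R[i]) *: x).
Local Notation rp := (rip ip).

Variables (a b : R) (s : seq R) (gamma : R -> bop H).
Hypotheses (ab : a < b)
  (gamma_unitary : forall t, t \in `[a, b] -> unitary ip (gamma t))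
  (gamma_C1 : piecewise_C1 a b s gamma)
  (gamma_a : gamma a = 1).

Local Notation logder := (right_logder a b gamma).
Implicit Types (t : R) (x y : H).

Lemma rot_gamma_derive (F : R -> R) f t x y : t \in `]a, b[ -> t \notin s ->
  is_derive t 1 F f ->
  is_derive t 1 (fun r => rp (rot (F r) (gamma r x)) y)
    (rp (rot (F t) (logder t (gamma t x) - f *' J (gamma t x))) y).
Proof.
move=> tab ts dF.
have d1 := gamma_is_derive ip_norm ab gamma_unitary gamma_C1 x y tab ts.
have d2 := gamma_is_derive ip_norm ab gamma_unitary gamma_C1 x (J y) tab ts.
have dc : is_derive t 1 (fun r => cos (F r)) (- sin (F t) * f).
  by apply: is_derive1_comp.
have ds : is_derive t 1 (fun r => sin (F r)) (cos (F t) * f).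
  by apply: is_derive1_comp.
have D := is_deriveD (is_deriveM dc d1) (is_deriveM ds d2).
under [X in is_derive _ _ X]eq_fun do rewrite rot_rip.
apply: (is_derive_eq D); rewrite rotB rotZ rot_J ripBl ripZl ripJC !rot_rip JJ ripNr /GRing.scale/=.
ring.
Qed.

Lemma rot_gamma_continuous (F : R -> R) x y : {within `[a, b], continuous F} ->
  {within `[a, b], continuous (fun r => rp (rot (F r) (gamma r x)) y)}.
Proof.
move=> Fc.
have c1 : {within `[a, b], continuous (fun r => rp (gamma r x) y)}.
  exact: (gamma_continuous_rip ip_norm gamma_C1).
have c2 : {within `[a, b], continuous (fun r => rp (gamma r x) (J y))}.
  exact: (gamma_continuous_rip ip_norm gamma_C1).
have -> : (fun r => rp (rot (F r) (gamma r x)) y) =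
    (fun r => cos (F r) * rp (gamma r x) y + sin (F r) * rp (gamma r x) (J y)).
  by apply/funext => r; rewrite rot_rip.
apply: within_continuousD; apply: within_continuousM => //.
  by apply: within_continuous_comp Fc _; exact: continuous_cos.
by apply: within_continuous_comp Fc _; exact: continuous_sin.
Qed.


Let fpE t := phi_plus (logder t).
Let fmE t := phi_minus (logder t).
Let Fp := primitive fpE a.
Let Fm := primitive fmE a.

Let mid_off t : t \in `]a, b[ -> t \notin s -> off_partition a b s t.
Proof. exact: off_partition_interior. Qed.

Let skewX t : off_partition a b s t -> skew ip (logder t).
Proof. exact: logder_skew. Qed.

Let near_good t : t \in `]a, b[ -> t \notin s ->
  \forall r \near t, off_partition a b s r.
Proof.
move=> tab ts; have openD : open (`]a, b[ `\` [set` s]).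
  exact: open_itv_off_finite.
have : nbhs t (`]a, b[ `\` [set` s]).
  by apply: open_nbhs_nbhs; split => //; split => //; exact/negP.
by apply: filterS => r [/= rab /negP rs]; exact: mid_off.
Qed.

Let phi_continuous (phi : bop H -> R) :
  (forall A B, skew ip A -> skew ip B -> `|phi A - phi B| <= opnorm (A - B)) ->
  forall t, t \in `]a, b[ -> t \notin s -> {for t, continuous (phi \o logder)}.
Proof.
move=> phiL t tab ts; apply/subr_cvg0/norm_cvg0P.
apply: (@squeeze_cvgr _ _ _ _ (cst 0) (fun r => opnorm (logder r - logder t))).
- near=> r; rewrite normr_ge0/=; apply: phiL; apply: skewX.
    by near: r; exact: near_good.
  exact: mid_off.
- exact: cvg_cst.
- exact: (logder_continuous ip_norm ab gamma_unitary gamma_C1).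
Unshelve. all: by end_near. Qed.

Let phi_bounded (phi : bop H -> R) :
  (forall A, skew ip A -> `|phi A| <= opnorm A) ->
  exists K : R, forall t, t \in `]a, b[ -> t \notin s -> `|(phi \o logder) t| <= K.
Proof.
move=> phiB; have [K KP] := logder_bounded ip_norm ab gamma_unitary gamma_C1.
exists K => t tab ts; apply: le_trans (KP t tab ts).
by apply: phiB; apply: skewX; exact: mid_off.
Qed.

Let fpc := phi_continuous (phi_plus_lipschitz ip_norm H_nonzero).
Let fmc := phi_continuous (phi_minus_lipschitz ip_norm H_nonzero).
Let fpb := phi_bounded (phi_plus_bound ip_norm H_nonzero).
Let fmb := phi_bounded (phi_minus_bound ip_norm H_nonzero).

Let Fpc : {within `[a, b], continuous Fp}.
Proof. exact: (primitive_continuous ab fpc fpb). Qed.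
Let Fmc : {within `[a, b], continuous Fm}.
Proof. exact: (primitive_continuous ab fmc fmb). Qed.
Let Fpd t : t \in `]a, b[ -> t \notin s -> is_derive t 1 Fp (fpE t).
Proof. by move=> tab ts; have := primitive_is_derive fpc fpb tab ts. Qed.
Let Fmd t : t \in `]a, b[ -> t \notin s -> is_derive t 1 Fm (fmE t).
Proof. by move=> tab ts; have := primitive_is_derive fmc fmb tab ts. Qed.

(** [C] and [W] are the midpoint and half-length of the interval from [Fm] to [Fp], so [Fp = C + W],
    [Fm = C - W], and [W b] is the angle rho. *)
Let C t := 2^-1 * Fp t + 2^-1 * Fm t.
Let W t := 2^-1 * Fp t - 2^-1 * Fm t.
Let cE t := 2^-1 * fpE t + 2^-1 * fmE t.
Let wE t := 2^-1 * fpE t - 2^-1 * fmE t.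

Let Cc : {within `[a, b], continuous C}.
Proof.
by apply: within_continuousD; apply: within_continuousZ.
Qed.
Let Wc : {within `[a, b], continuous W}.
Proof.
by apply: within_continuousB; apply: within_continuousZ.
Qed.
Let Cd t : t \in `]a, b[ -> t \notin s -> is_derive t 1 C (cE t).
Proof.
by move=> tab ts; exact: is_deriveD (is_deriveZ 2^-1 (Fpd tab ts)) (is_deriveZ 2^-1 (Fmd tab ts)).
Qed.
Let Wd t : t \in `]a, b[ -> t \notin s -> is_derive t 1 W (wE t).
Proof.
by move=> tab ts; exact: is_deriveB (is_deriveZ 2^-1 (Fpd tab ts)) (is_deriveZ 2^-1 (Fmd tab ts)).
Qed.

Let zeta t x := rot (C t) (gamma t x).

(** Stated between arbitrary times because the case of equality uses it on both sides of an
    intermediate time. *)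
Lemma curve_angle t1 t2 x : a <= t1 -> t1 <= t2 -> t2 <= b -> rnorm x = 1 ->
  W t2 - W t1 <= pi -> cos (W t2 - W t1) <= rp (zeta t2 x) (zeta t1 x).
Proof.
move=> at1 t12 t2b x1 Wpi.
have gx r : r \in `[a, b] -> rnorm (gamma r x) = 1.
  by move=> rab; rewrite (unitary_rnorm ip_norm)//; exact: gamma_unitary.
have sub r : r \in `]t1, t2[ -> r \in `]a, b[.
  by rewrite !in_itv/= => /andP[? ?]; rewrite (le_lt_trans at1)// (lt_le_trans _ t2b).
have t1ab : t1 \in `[a, b] by rewrite in_itv/= at1 (le_trans t12).
set y := zeta t1 x.
have y1 : rnorm y = 1 by rewrite /y /zeta (rot_rnorm ip_norm) gx.
apply: (@angle_bound _ (fun r => rp (zeta r x) y) W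
  (fun r => rp (rot (C r) (logder r (gamma r x) - cE r *' J (gamma r x))) y) wE s t1 t2 t12).
- apply: (subitv_continuous at1 t2b); exact: rot_gamma_continuous.
- exact: (subitv_continuous at1 t2b).
- by move=> t /sub tab ts; apply: rot_gamma_derive => //; exact: Cd.
- by move=> t /sub tab ts; exact: Wd.
- move=> t /sub tab ts; have := phi_minus_le_plus ip_norm H_nonzero (skewX (mid_off tab ts)).
  by rewrite /wE /fpE /fmE; lra.
- move=> t /sub tab ts; have tab' := subset_itv_oo_cc tab.
  have sX := skewX (mid_off tab ts).
  set u := gamma t x; set v := logder t u - cE t *' J u.
  have vn : rnorm v <= wE t * rnorm u.
    by apply: (skew_centered_norm ip_norm H_nonzero) => //; rewrite /cE /wE /fpE /fmE; lra.
  set h := rp (zeta t x) y.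
  have zz : rp (zeta t x) (zeta t x) = 1.
    by rewrite (rot_isometry ip) (ripxx ip_norm) gx// expr1n.
  (* The velocity is orthogonal to [zeta t x], so only the component of [y] orthogonal to [zeta t x]
     counts. Its length is [sqrt (1 - h^2)], which is why the differential inequality of
     [angle_bound] holds. *)
  have -> : rp (rot (C t) v) y = rp (rot (C t) v) (y - h *' zeta t x).
    rewrite [RHS]ripBr ripZr (rot_isometry ip) -/u.
    have -> : rp v u = 0 by rewrite /v ripBl ripZl ripJxx sX mulr0 subr0.
    by rewrite mulr0 subr0.
  have -> : Num.sqrt (1 - h ^+ 2) = rnorm (y - h *' zeta t x).
    rewrite -[RHS]ger0_norm ?rnorm_ge0// -sqrtr_sqr -(ripxx ip_norm); congr Num.sqrt.
    rewrite ripBB ripZr ripZl ripZr zz (ripC ip y) -/h (ripxx ip_norm y) y1 expr1n; ring.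
  rewrite mulNr lerNl -ripNl (le_trans (rip_le ip_norm _ _))// rnormN.
  rewrite ler_wpM2r ?rnorm_ge0// (rot_rnorm ip_norm).
  by move: vn; rewrite gx// mulr1.
- move=> t tt; have tab : t \in `[a, b].
    by move: tt; rewrite !in_itv/= => /andP[? ?]; rewrite (le_trans at1)// (le_trans _ t2b).
  by rewrite (le_trans (cauchy_schwarz ip_norm _ _))// y1 mulr1 (rot_rnorm ip_norm) gx.
- by rewrite (rot_isometry ip) (ripxx ip_norm) gx// expr1n.
- exact: Wpi.
Qed.

Let Fpa : Fp a = 0. Proof. exact: primitive_left. Qed.
Let Fma : Fm a = 0. Proof. exact: primitive_left. Qed.
Let Ca : C a = 0. Proof. by rewrite /C Fpa Fma mulr0 addr0. Qed.
Let Wa : W a = 0. Proof. by rewrite /W Fpa Fma mulr0 subr0. Qed.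

Let zeta_a x : zeta a x = x.
Proof. by rewrite /zeta Ca rot0 gamma_a. Qed.

Let aI : a \in `[a, b]. Proof. by rewrite in_itv/= lexx ltW. Qed.
Let bI : b \in `[a, b]. Proof. by rewrite in_itv/= lexx ltW. Qed.

Let W_mono t1 t2 : a <= t1 -> t1 <= t2 -> t2 <= b -> W t1 <= W t2.
Proof.
move=> at1 t12 t2b.
have sub r : r \in `]t1, t2[ -> r \in `]a, b[.
  by rewrite !in_itv/= => /andP[? ?]; rewrite (le_lt_trans at1)// (lt_le_trans _ t2b).
have Wc' := subitv_continuous at1 t2b Wc.
have Wd' t : t \in `]t1, t2[ -> t \notin s -> is_derive t 1 W (wE t).
  by move=> /sub; exact: Wd.
apply: (nondecreasing_off_finite t12 Wc' Wd') => t /sub tab ts.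
have := phi_minus_le_plus ip_norm H_nonzero (skewX (mid_off tab ts)).
by rewrite /wE /fpE /fmE; lra.
Qed.

Lemma gamma_arc x : W b <= pi ->
  cos (W b) * rp x x <= rp (rot (C b) (gamma b x)) x.
Proof.
move=> Wpi; have [->|x0] := eqVneq x 0; first by rewrite !rip0r mulr0.
have xp : 0 < rnorm x by rewrite lt0r rnorm_eq0 x0 rnorm_ge0.
pose y := (rnorm x)^-1 *' x.
have y1 : rnorm y = 1 by rewrite /y rnormZ gtr0_norm ?invr_gt0// mulVf// gt_eqF.
have := @curve_angle a b y (lexx _) (ltW ab) (lexx _) y1.
rewrite Wa subr0 zeta_a => /(_ Wpi).
have -> : rp (zeta b y) y =
    (rnorm x)^-1 * ((rnorm x)^-1 * rp (rot (C b) (gamma b x)) x).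
  by rewrite /zeta /y (bopZ (gamma b)) rotZ ripZl ripZr.
rewrite -(ler_pM2l (exprn_gt0 2 xp)) => h.
rewrite (ripxx ip_norm) mulrC (le_trans h)// le_eqVlt; apply/orP; left; apply/eqP.
by field; rewrite gt_eqF.
Qed.

(* Equality in the spherical triangle inequality: [zeta_t x] lies on the great
   circle through [x] and [zeta_b x] because [e^{iw}] is a combination of [1] and
   [e^{i rho}] with coefficients [sin (rho - w) / sin rho] and [sin w / sin rho]. *)
Let geodesic (o : R) x : o ^+ 2 = 1 -> W b < pi -> rnorm x = 1 ->
  zeta b x = rot (- (o * W b)) x ->
  forall t, t \in `[a, b] -> zeta t x = rot (- (o * W t)) x.
Proof.
move=> o1 Wpi x1 zb t tab; have := tab; rewrite in_itv/= => /andP[at_ tb].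
have W0 : 0 <= W t by rewrite -Wa; exact: W_mono.
have Wt : W t <= W b by exact: W_mono.
have h1 := @curve_angle a t x (lexx _) at_ tb x1.
have h2 := @curve_angle t b x at_ tb (lexx _) x1.
move: h1; rewrite Wa subr0 zeta_a => /(_ (le_trans Wt (ltW Wpi))).
have /h2 : W b - W t <= pi by lra.
rewrite zb ripC rip_rot.
set p := rp (zeta t x) x; set q := rp (zeta t x) (J x) => {h2} h2 h1.
have cosoW r : cos (- (o * r)) = cos r.
  have : (o == 1) || (o == -1) by rewrite -sqrf_eq1 o1.
  by case/orP => /eqP ->; rewrite ?mul1r ?mulN1r ?opprK ?cosN.
have sinoW r : sin (- (o * r)) = - (o * sin r).
  have : (o == 1) || (o == -1) by rewrite -sqrf_eq1 o1.
  by case/orP => /eqP ->; rewrite ?mul1r ?mulN1r ?opprK ?sinN.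
rewrite cosoW sinoW in h2.
apply/eqP; rewrite -subr_eq0 -(ripxx_eq0 ip_norm) eq_le (ripxx_ge0 ip_norm) andbT.
rewrite ripBB (rot_isometry ip _ x) rip_rot.
rewrite cosoW sinoW -/p -/q.
have -> : rp (zeta t x) (zeta t x) = 1.
  rewrite (rot_isometry ip) (ripxx ip_norm) (unitary_rnorm ip_norm) ?x1 ?expr1n//.
  exact: gamma_unitary.
rewrite (ripxx ip_norm) x1 expr1n.
suff : 1 <= cos (W t) * p + o * sin (W t) * q by lra.
(* The division by [sin (W b)] fails only here, and then [W t = 0] too. *)
have [Wb0|Wb0] := eqVneq (W b) 0.
  have Wt0 : W t = 0 by apply/eqP; rewrite eq_le W0 -Wb0 Wt.
  by move: h1; rewrite Wt0 cos0 sin0 mulr0 mul0r addr0 mul1r.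
have Wbp : 0 < W b by rewrite lt0r Wb0 (le_trans W0).
have sb : 0 < sin (W b) by apply: sin_gt0_pi; rewrite Wbp.
have st : 0 <= sin (W t) by apply: sin_ge0_pi; rewrite W0 (le_trans Wt)// ltW.
have sbt : 0 <= sin (W b - W t).
  by apply: sin_ge0_pi; rewrite subr_ge0 Wt/=; lra.
rewrite -(ler_pM2l sb) mulr1.
have k1 : sin (W b - W t) * cos (W t) <= sin (W b - W t) * p by rewrite ler_wpM2l.
have k2 : sin (W t) * cos (W b - W t) <= sin (W t) * (cos (W b) * p - - (o * sin (W b)) * q).
  by rewrite ler_wpM2l.
have e1 : sin (W b - W t) * cos (W t) + sin (W t) * cos (W b - W t) = sin (W b).
  by rewrite mulrC (mulrC (sin (W t))) mulrC -sinD subrK.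
have e2 : sin (W b) * (cos (W t) * p + o * sin (W t) * q) =
    sin (W b - W t) * p + sin (W t) * (cos (W b) * p - - (o * sin (W b)) * q).
  by rewrite (sinB (W b)); ring.
by rewrite e2 (le_trans _ (lerD k1 k2))// e1.
Qed.

(** The sign [o] is 1 for [Fp] and -1 for [Fm]. Restoring the phase [C] turns the great circle into
    [gamma t x = e^{i F t} x]. *)
Let geodesic_gamma (o : R) (F : R -> R) x : o ^+ 2 = 1 -> W b < pi ->
  (forall t, F t = C t + o * W t) ->
  gamma b x = rot (- F b) x -> forall t, t \in `[a, b] -> gamma t x = rot (- F t) x.
Proof.
move=> o1 Wpi FE gb t tab; have [->|x0] := eqVneq x 0.
  by rewrite bop0 rotE scaler0.
have xp : 0 < rnorm x by rewrite lt0r rnorm_eq0 x0 rnorm_ge0.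
pose y := (rnorm x)^-1 *' x.
have y1 : rnorm y = 1 by rewrite /y rnormZ gtr0_norm ?invr_gt0// mulVf// gt_eqF.
have zE r : rot (C r) (rot (- F r) y) = rot (- (o * W r)) y.
  by rewrite -rotD FE; congr rot; lra.
have zb : zeta b y = rot (- (o * W b)) y.
  by rewrite -zE /zeta /y bopZ gb rotZ.
have := geodesic o1 Wpi y1 zb tab.
rewrite -zE /zeta => /(congr1 (rot (- C t))); rewrite !rotKN /y bopZ rotZ.
by apply: scalerI; rewrite -(rmorph0 (real_complex R)) (inj_eq (@complexI R)) invr_eq0 gt_eqF.
Qed.

(** [e^{-i F} gamma x] is the constant [x], so its derivative vanishes. *)
Let logder_eigen (F : R -> R) x :
  (forall t, t \in `[a, b] -> gamma t x = rot (- F t) x) ->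
  forall t f, t \in `]a, b[ -> t \notin s -> is_derive t 1 F f ->
  logder t x = f *' J x.
Proof.
move=> gF t f tab ts dF; have tab' := subset_itv_oo_cc tab.
have h y : rp (rot (F t) (logder t (gamma t x) - f *' J (gamma t x))) y = 0.
  have d := rot_gamma_derive x y tab ts dF.
  rewrite -(@derive_val _ _ _ _ _ _ _ d).
  rewrite (@near_eq_derive _ _ _ _ (cst (rp x y))) ?derive_cst//; last first.
  near=> r; have rab : r \in `]a, b[ by near: r; exact: near_in_itvoo.
  by rewrite gF ?rotNK//; exact: subset_itv_oo_cc.
have : rot (F t) (logder t (gamma t x) - f *' J (gamma t x)) = 0.
  by apply: (rip_eq ip_norm) => y; rewrite h rip0l.
rewrite gF// bop_rot -rot_J -rotZ -rotB rotNK => /eqP.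
by rewrite subr_eq0 => /eqP.
Unshelve. all: by end_near. Qed.

Let eigen_closed (phi : bop H -> R) x :
  (forall A B, skew ip A -> skew ip B -> `|phi A - phi B| <= opnorm (A - B)) ->
  (forall t, t \in `]a, b[ -> t \notin s -> logder t x = phi (logder t) *' J x) ->
  forall t, off_partition a b s t -> logder t x = phi (logder t) *' J x.
Proof.
move=> phiL eig t toff; apply/eqP; rewrite -subr_eq0 -rnorm_eq0 eq_le rnorm_ge0 andbT.
apply/ler_addgt0Pr => e e0; rewrite add0r.
(* Two errors of size at most [d * rnorm x] are added; the 1 avoids dividing by zero. *)
pose d := e / (2 * (rnorm x + 1)).
have x1 : 0 < rnorm x + 1 by rewrite ltr_wpDl// rnorm_ge0.
have d0 : 0 < d by rewrite divr_gt0// mulr_gt0.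
have [r [rab rs rt]] := logder_approx ip_norm ab gamma_unitary gamma_C1 toff d0.
have -> : logder t x - phi (logder t) *' J x =
    - ((logder r - logder t) x) + (phi (logder r) - phi (logder t)) *' J x.
  by rewrite bop_addE bop_oppE (eig r)//; apply: (rip_eq ip_norm) => z; rewrite !ripE; ring.
have phin := phiL _ _ (skewX (mid_off rab rs)) (skewX toff).
rewrite (le_trans (rnormD _ _))// rnormN rnormZ rnormJ.
have n1 : rnorm ((logder r - logder t) x) <= d * rnorm x.
  by rewrite (le_trans (rnorm_bop _ _))// ler_wpM2r ?rnorm_ge0// ltW.
have n2 : `|phi (logder r) - phi (logder t)| * rnorm x <= d * rnorm x.
  by rewrite ler_wpM2r ?rnorm_ge0// (le_trans phin)// ltW.
have : d * (2 * (rnorm x + 1)) = e by rewrite /d; field; rewrite gt_eqF.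
have := rnorm_ge0 x; move: n1 n2 d0; nra.
Qed.

(** [logder t] acts on [gamma t y], while the equation is known at [x]. Skewness moves the operator
    to [x], so [<e^{-i F} gamma y, x>] has constant real part for every [y]; unitarity of [gamma b]
    turns this into the eigenvector equation. *)
Let right_eigen_gamma (F f : R -> R) x : {within `[a, b], continuous F} -> F a = 0 ->
  (forall t, t \in `]a, b[ -> t \notin s -> is_derive t 1 F (f t)) ->
  (forall t, t \in `]a, b[ -> t \notin s -> logder t x = f t *' J x) ->
  gamma b x = rot (- F b) x.
Proof.
move=> Fc Fa dF eig.
have const y : rp (rot (F b) (gamma b y)) x = rp y x.
  have d0 t : t \in `]a, b[ -> t \notin s ->
      is_derive t 1 (fun r => rp (rot (F r) (gamma r y)) x) 0.
    move=> tab ts; have := rot_gamma_derive y x tab ts (dF t tab ts).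
    rewrite rotB rotZ rot_J -bop_rot ripBl ripZl ripJC (skewC _ _ (skewX (mid_off tab ts))).
    by rewrite eig// ripZr mulrN subrr.
  have c0 : {within `[a, b], continuous (fun r => rp (rot (F r) (gamma r y)) x)}.
    exact: rot_gamma_continuous.
  have := constant_off_finite (ltW ab) c0 d0.
  by rewrite Fa rot0 gamma_a => ->.
have ub := gamma_unitary bI.
apply: (rip_eq ip_norm) => z.
rewrite -(unitaryVK ip_norm z ub) (unitary_rip _ _ ub) ripC -const.
by rewrite -(rot_isometry ip (- F b)) rotKN ripC.
Qed.

(** Multiplied by [gamma t], the equation becomes [gamma' x = i f gamma x], so [e^{-i F} gamma x] is
    constant. *)
Let left_eigen_gamma (F f : R -> R) x : {within `[a, b], continuous F} -> F a = 0 ->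
  (forall t, t \in `]a, b[ -> t \notin s -> is_derive t 1 F (f t)) ->
  (forall t, t \in `]a, b[ -> t \notin s -> left_logder a b gamma t x = f t *' J x) ->
  gamma b x = rot (- F b) x.
Proof.
move=> Fc Fa dF eig.
have const y : rp (rot (F b) (gamma b x)) y = rp x y.
  have d0 t : t \in `]a, b[ -> t \notin s ->
      is_derive t 1 (fun r => rp (rot (F r) (gamma r x)) y) 0.
    move=> tab ts; have tab' := subset_itv_oo_cc tab.
    have := rot_gamma_derive x y tab ts (dF t tab ts).
    have -> : logder t (gamma t x) = f t *' J (gamma t x).
      rewrite (logder_gamma ip_norm gamma_unitary)// -[LHS](unitaryVK ip_norm _ (gamma_unitary tab')).
      by rewrite -[bop_inv _ _]/(left_logder a b gamma t x) eig// !bopZ.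
    by rewrite subrr rotE scaler0 rip0l.
  have c0 : {within `[a, b], continuous (fun r => rp (rot (F r) (gamma r x)) y)}.
    exact: rot_gamma_continuous.
  have := constant_off_finite (ltW ab) c0 d0.
  by rewrite Fa rot0 gamma_a => ->.
have : rot (F b) (gamma b x) = x by exact: (rip_eq ip_norm).
by move=> /(congr1 (rot (- F b))); rewrite rotKN.
Qed.


Let FpE t : Fp t = C t + 1 * W t. Proof. by rewrite /C /W; lra. Qed.
Let FmE t : Fm t = C t + -1 * W t. Proof. by rewrite /C /W; lra. Qed.

Let left_logderE t x : t \in `[a, b] ->
  left_logder a b gamma t x = bop_inv (gamma t) (logder t (gamma t x)).
Proof. by move=> tab; rewrite (logder_gamma ip_norm gamma_unitary). Qed.

Let left_rip t x y : t \in `[a, b] ->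
  rp (left_logder a b gamma t x) y = rp (logder t (gamma t x)) (gamma t y).
Proof.
by move=> tab; rewrite left_logderE// (unitary_adj ip_norm)//; exact: gamma_unitary.
Qed.

Let left_skew t : off_partition a b s t -> skew ip (left_logder a b gamma t).
Proof. by move=> toff x; rewrite left_rip ?skewX//; case: toff. Qed.

(** The two logarithmic derivatives are conjugate by the unitary [gamma t], so their numerical
    ranges agree. *)
Let left_phi_plus t : off_partition a b s t ->
  phi_plus (left_logder a b gamma t) = phi_plus (logder t).
Proof.
move=> toff; have tab : t \in `[a, b] by case: toff.
have ut := gamma_unitary tab; have sL := left_skew toff; have sX := skewX toff.
apply/eqP; rewrite eq_le; apply/andP; split.
  apply: (phi_plus_le ip_norm H_nonzero sL) => x.
  by rewrite left_rip// bopZ -(unitary_rip x x ut); exact: phi_plus_ub.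
apply: (phi_plus_le ip_norm H_nonzero sX) => x.
rewrite -(unitaryVK ip_norm x ut) -bopZ -left_rip// (unitary_rip _ _ ut).
exact: phi_plus_ub.
Qed.

Let left_phi_minus t : off_partition a b s t ->
  phi_minus (left_logder a b gamma t) = phi_minus (logder t).
Proof.
move=> toff; have tab : t \in `[a, b] by case: toff.
have ut := gamma_unitary tab; have sL := left_skew toff; have sX := skewX toff.
apply/eqP; rewrite eq_le; apply/andP; split.
  apply: (phi_minus_ge ip_norm H_nonzero sX) => x.
  rewrite -(unitaryVK ip_norm x ut) -bopZ -left_rip// (unitary_rip _ _ ut).
  exact: phi_minus_lb.
apply: (phi_minus_ge ip_norm H_nonzero sL) => x.
by rewrite left_rip// bopZ -(unitary_rip x x ut); exact: phi_minus_lb.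
Qed.

Let left_eigen (F : R -> R) x t (f : R) : t \in `[a, b] ->
  gamma t x = rot (- F t) x -> logder t x = f *' J x ->
  left_logder a b gamma t x = f *' J x.
Proof.
move=> tab gt Xx; have ut := gamma_unitary tab.
rewrite left_logderE// gt bop_rot Xx rotZ rot_J -gt !bopZ.
by rewrite (unitaryK ip_norm).
Qed.

Let eigE (f : R) x : (('i%C : R[i]) * f%:C%C) *: x = f *' J x.
Proof. by rewrite mulrC scalerA. Qed.

(** All three sets are compared with the condition [gamma b x = e^{i Fp b} x]. Going from it to the
    logarithmic derivatives is the great circle argument; the way back is an integration. *)
Lemma unitary_eig_plus_bigcap : Fp b < pi -> - pi < Fm b -> theta_plus (gamma b) = Fp b ->
  unitary_eig_plus (gamma b) =
    \bigcap_(t in off_partition a b s) skew_eig_plus (logder t) /\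
  \bigcap_(t in off_partition a b s) skew_eig_plus (logder t) =
    \bigcap_(t in off_partition a b s) skew_eig_plus (left_logder a b gamma t).
Proof.
move=> Fppi Fmpi theta.
have Wpi : W b < pi by rewrite /W; lra.
have u2r x : gamma b x = rot (- Fp b) x ->
    forall t, off_partition a b s t -> logder t x = fpE t *' J x.
  move=> gb; have g := geodesic_gamma (expr1n _ 2) Wpi FpE gb.
  apply: (eigen_closed (phi_plus_lipschitz ip_norm H_nonzero)) => t tab ts.
  exact: (logder_eigen g tab ts (Fpd tab ts)).
have u2l x : gamma b x = rot (- Fp b) x ->
    forall t, off_partition a b s t -> left_logder a b gamma t x = fpE t *' J x.
  move=> gb t toff; have tab : t \in `[a, b] by case: toff.
  have g := geodesic_gamma (expr1n _ 2) Wpi FpE gb.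
  exact: left_eigen (g t tab) (u2r x gb t toff).
have uE x : unitary_eig_plus (gamma b) x <-> gamma b x = rot (- Fp b) x.
  by rewrite /unitary_eig_plus /= theta rotE opprK.
have r2u x : (\bigcap_(t in off_partition a b s) skew_eig_plus (logder t)) x ->
    gamma b x = rot (- Fp b) x.
  move=> h; apply: (right_eigen_gamma Fpc Fpa Fpd) => t tab ts.
  by have := h t (mid_off tab ts); rewrite /skew_eig_plus /= eigE.
have l2u x : (\bigcap_(t in off_partition a b s) skew_eig_plus (left_logder a b gamma t)) x ->
    gamma b x = rot (- Fp b) x.
  move=> h; apply: (left_eigen_gamma Fpc Fpa Fpd) => t tab ts.
  have := h t (mid_off tab ts); rewrite /skew_eig_plus /= eigE.
  by rewrite left_phi_plus//; exact: mid_off.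
split; apply/seteqP; split => x.
- by move=> /uE gb t toff; rewrite /skew_eig_plus /= eigE; exact: u2r.
- by move=> /r2u /uE.
- move=> /r2u gb t toff; rewrite /skew_eig_plus /= eigE left_phi_plus//.
  exact: u2l.
- by move=> /l2u gb t toff; rewrite /skew_eig_plus /= eigE; exact: u2r.
Qed.

Lemma unitary_eig_minus_bigcap : Fp b < pi -> - pi < Fm b -> theta_minus (gamma b) = Fm b ->
  unitary_eig_minus (gamma b) =
    \bigcap_(t in off_partition a b s) skew_eig_minus (logder t) /\
  \bigcap_(t in off_partition a b s) skew_eig_minus (logder t) =
    \bigcap_(t in off_partition a b s) skew_eig_minus (left_logder a b gamma t).
Proof.
move=> Fppi Fmpi theta.
have Wpi : W b < pi by rewrite /W; lra.
have N1 : (-1) ^+ 2 = 1 :> R by rewrite sqrrN expr1n.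
have u2r x : gamma b x = rot (- Fm b) x ->
    forall t, off_partition a b s t -> logder t x = fmE t *' J x.
  move=> gb; have g := geodesic_gamma N1 Wpi FmE gb.
  apply: (eigen_closed (phi_minus_lipschitz ip_norm H_nonzero)) => t tab ts.
  exact: (logder_eigen g tab ts (Fmd tab ts)).
have u2l x : gamma b x = rot (- Fm b) x ->
    forall t, off_partition a b s t -> left_logder a b gamma t x = fmE t *' J x.
  move=> gb t toff; have tab : t \in `[a, b] by case: toff.
  have g := geodesic_gamma N1 Wpi FmE gb.
  exact: left_eigen (g t tab) (u2r x gb t toff).
have uE x : unitary_eig_minus (gamma b) x <-> gamma b x = rot (- Fm b) x.
  by rewrite /unitary_eig_minus /= theta rotE opprK.
have r2u x : (\bigcap_(t in off_partition a b s) skew_eig_minus (logder t)) x ->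
    gamma b x = rot (- Fm b) x.
  move=> h; apply: (right_eigen_gamma Fmc Fma Fmd) => t tab ts.
  by have := h t (mid_off tab ts); rewrite /skew_eig_minus /= eigE.
have l2u x : (\bigcap_(t in off_partition a b s) skew_eig_minus (left_logder a b gamma t)) x ->
    gamma b x = rot (- Fm b) x.
  move=> h; apply: (left_eigen_gamma Fmc Fma Fmd) => t tab ts.
  have := h t (mid_off tab ts); rewrite /skew_eig_minus /= eigE.
  by rewrite left_phi_minus//; exact: mid_off.
split; apply/seteqP; split => x.
- by move=> /uE gb t toff; rewrite /skew_eig_minus /= eigE; exact: u2r.
- by move=> /r2u /uE.
- move=> /r2u gb t toff; rewrite /skew_eig_minus /= eigE left_phi_minus//.
  exact: u2l.
- by move=> /l2u gb t toff; rewrite /skew_eig_minus /= eigE; exact: u2r.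
Qed.

Lemma primitive_minus_le_plus : Fm b <= Fp b.
Proof. by have := W_mono (lexx a) (ltW ab) (lexx b); rewrite Wa /W; lra. Qed.

End CurveAngle.

(** * Polynomials and Laurent polynomials in an operator *)

Section BopHorner.
Variables (R : realType) (H : completeNormedModType R[i]).
Implicit Types (f g u : bop H) (k : R[i]) (p q : {poly R[i]}).

Lemma bop_scalerAl k f g : k *: (f * g) = (k *: f) * g.
Proof. exact: bop_ext. Qed.

Lemma bop_scalerAr k f g : k *: (f * g) = f * (k *: g).
Proof. by apply: bop_ext => x; rewrite !bopE bopZ. Qed.

Lemma bop_horner_widen n p u : (size p <= n)%N ->
  bop_horner p u = \sum_(i < n) p`_i *: u ^+ i.
Proof.
move=> pn; rewrite /bop_horner (big_ord_widen n (fun i => p`_i *: u ^+ i) pn).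
rewrite big_mkcond; apply: eq_bigr => i _; case: ifPn => //.
by rewrite -leqNgt => /leq_sizeP/(_ _ (leqnn _)) ->; rewrite scale0r.
Qed.

Lemma bop_horner0 u : bop_horner 0 u = 0.
Proof. by rewrite /bop_horner size_poly0 big_ord0. Qed.

Lemma bop_hornerD p q u : bop_horner (p + q) u = bop_horner p u + bop_horner q u.
Proof.
have pq := size_polyD p q; set n := maxn _ _ in pq.
rewrite (bop_horner_widen _ pq) (@bop_horner_widen n p) ?leq_maxl//.
rewrite (@bop_horner_widen n q) ?leq_maxr// -big_split; apply: eq_bigr => i _.
by rewrite coefD scalerDl.
Qed.

Lemma bop_hornerZ k p u : bop_horner (k *: p) u = k *: bop_horner p u.
Proof.
rewrite (bop_horner_widen _ (size_scale_leq k p)) /bop_horner scaler_sumr.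
by apply: eq_bigr => i _; rewrite coefZ scalerA.
Qed.

Lemma bop_hornerC k u : bop_horner k%:P u = k *: (1 : bop H).
Proof.
by rewrite (bop_horner_widen _ (size_polyC_leq1 k)) big_ord1 coefC expr0.
Qed.

Lemma bop_hornerMX p u : bop_horner (p * 'X) u = bop_horner p u * u.
Proof.
have [->|p0] := eqVneq p 0; first by rewrite mul0r bop_horner0 mul0r.
rewrite /bop_horner size_mulX// big_ord_recl coefMX eqxx scale0r add0r mulr_suml.
by apply: eq_bigr => i _; rewrite coefMX /= exprSr bop_scalerAl.
Qed.

Lemma bop_hornerX u : bop_horner 'X u = u.
Proof. by rewrite -[X in bop_horner X _]mul1r bop_hornerMX bop_hornerC scale1r mul1r. Qed.

Lemma bop_hornerM p q u : bop_horner (p * q) u = bop_horner p u * bop_horner q u.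
Proof.
elim/poly_ind: q => [|q k ih]; first by rewrite mulr0 bop_horner0 mulr0.
rewrite mulrDr mulrA !bop_hornerD !bop_hornerMX ih mulrDr mulrA; congr (_ + _).
by rewrite mulrC mul_polyC bop_hornerZ bop_hornerC -bop_scalerAr mulr1.
Qed.

Lemma bop_horner_comm p u f : f * u = u * f -> f * bop_horner p u = bop_horner p u * f.
Proof.
move=> fu; elim/poly_ind: p => [|p k ih]; first by rewrite bop_horner0 mulr0 mul0r.
rewrite bop_hornerD bop_hornerMX bop_hornerC mulrDr mulrDl mulrA ih -!mulrA fu.
by rewrite -bop_scalerAr -bop_scalerAl mulr1 mul1r.
Qed.

Lemma bop_hornerXn n u : bop_horner 'X^n u = u ^+ n.
Proof.
elim: n => [|n ih]; first by rewrite expr0 -polyC1 bop_hornerC scale1r expr0.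
by rewrite exprSr bop_hornerMX ih exprSr.
Qed.

Lemma bop_inverseM f g : bop_inverse f !=set0 -> bop_inverse g !=set0 ->
  bop_inverse (f * g) !=set0.
Proof.
move=> [V [fV Vf]] [W [gW Wg]]; exists (W * V); split.
  by rewrite mulrA -(mulrA f) gW mulr1 fV.
by rewrite mulrA -(mulrA W) Vf mulr1 Wg.
Qed.

Lemma bop_inverse1 : bop_inverse (1 : bop H) !=set0.
Proof. by exists 1; rewrite /bop_inverse /= mulr1. Qed.

Lemma bop_inverseX f n : bop_inverse f !=set0 -> bop_inverse (f ^+ n) !=set0.
Proof.
move=> fV; elim: n => [|n ih]; first by rewrite expr0; exact: bop_inverse1.
by rewrite exprS; exact: bop_inverseM.
Qed.

Lemma bop_inverse_scale k f : k != 0 -> bop_inverse f !=set0 -> bop_inverse (k *: f) !=set0.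
Proof.
move=> k0 [V [fV Vf]]; exists (k^-1 *: V).
by split; rewrite -bop_scalerAl -bop_scalerAr scalerA ?mulfV ?mulVf// scale1r.
Qed.

Lemma bop_inverse_scaler k f : bop_inverse (k *: f) !=set0 -> bop_inverse f !=set0.
Proof.
move=> [V [fV Vf]]; exists (k *: V).
by split; [rewrite -bop_scalerAr bop_scalerAl|rewrite -bop_scalerAl bop_scalerAr].
Qed.

(** Over the algebraically closed field [R[i]] the polynomial splits, and each factor [u - z] is
    invertible. *)
Lemma horner_invertible p u : p != 0 -> (forall z, root p z -> ~ spec u z) ->
  bop_inverse (bop_horner p u) !=set0.
Proof.
move=> p0 pu; have [r pE] := closed_field_poly_normal p.
have : forall z, z \in r -> ~ spec u z.
  by move=> z zr; apply: pu; rewrite pE rootZ ?lead_coef_eq0// root_prod_XsubC.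
rewrite pE bop_hornerZ => ru; apply: bop_inverse_scale; first by rewrite lead_coef_eq0.
elim: r ru {pE} => [_|z r ih ru].
  by rewrite big_nil -polyC1 bop_hornerC scale1r; exact: bop_inverse1.
rewrite big_cons bop_hornerM; apply: bop_inverseM; last first.
  by apply: ih => w wr; apply: ru; rewrite inE wr orbT.
rewrite -polyCN bop_hornerD bop_hornerX bop_hornerC scaleNr.
by have /contrapT := ru z (mem_head _ _).
Qed.

Variable u : bop H.
Hypothesis u_unit : bop_inverse u (bop_inv u).

Local Notation v := (bop_inv u).

Lemma spec_neq0 z : spec u z -> z != 0.
Proof.
by move=> uz; apply/eqP => z0; apply: uz; rewrite z0 scale0r subr0; exists v.
Qed.

Lemma clear_denominators q : exists (k : nat) (G : {poly R[i]}),
  u ^+ k * bop_horner q v = bop_horner G u /\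
  forall z, z != 0 -> z ^+ k * q.[z^-1] = G.[z].
Proof.
have [uv vu] := u_unit.
elim/poly_ind: q => [|q c [k [G [GE Gz]]]].
  exists 0%N, 0; split; first by rewrite !bop_horner0 mulr0.
  by move=> z _; rewrite !horner0 mulr0.
have Gu : u * bop_horner G u = bop_horner G u * u.
  by rewrite -bop_hornerMX mulrC bop_hornerM bop_hornerX.
exists k.+1, (G + c *: 'X^(k.+1)); split.
  rewrite (bop_hornerD (q * 'X)) bop_hornerMX bop_hornerC mulrDr mulrA exprS -(mulrA u) GE.
  rewrite Gu -mulrA uv mulr1 bop_hornerD bop_hornerZ bop_hornerXn; congr (_ + _).
  by rewrite -bop_scalerAr mulr1 exprS.
move=> z z0; rewrite !hornerE ?hornerXn -Gz// exprS.
rewrite mulrDr [_.[_] / z]mulrC -mulrA (mulrCA (z ^+ k)) !mulrA mulfV// mul1r.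
by congr (_ + _); rewrite mulrC mulrA.
Qed.

(** Multiplication by a power of [u] reduces to a polynomial [P]. If [P = 0], the Laurent polynomial
    is the constant [l]; this is a separate alternative because the spectrum of [u] is not yet known
    to be nonempty, a fact deduced from this lemma for unitary operators. *)
Lemma laurent_spectral_mapping p q l : spec (bop_horner p u + bop_horner q v) l ->
  (exists2 z, spec u z & p.[z] + q.[z^-1] = l) \/
  (forall z, z != 0 -> p.[z] + q.[z^-1] = l).
Proof.
move=> Ll; have [k [G [GE Gz]]] := clear_denominators q.
pose P := 'X^k * (p - l%:P) + G.
have Pz z : z != 0 -> P.[z] = z ^+ k * (p.[z] + q.[z^-1] - l).
  by move=> z0; rewrite /P !hornerE ?hornerXn -Gz//; ring.
have PE : bop_horner P u = u ^+ k * (bop_horner p u + bop_horner q v - l *: (1 : bop H)).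
  rewrite /P bop_hornerD bop_hornerM bop_hornerXn -GE bop_hornerD -polyCN bop_hornerC.
  by rewrite -mulrDr addrAC scaleNr.
have [P0|P0] := eqVneq P 0.
  right => z z0; have := Pz z z0; rewrite P0 horner0 => /esym/eqP.
  by rewrite mulf_eq0 expf_eq0 (negbTE z0) andbF/= subr_eq0 => /eqP.
left; apply: contrapT => /forall2NP nz; apply: Ll.
have : bop_inverse (bop_horner P u) !=set0.
  apply: horner_invertible => // z rz uz; have z0 := spec_neq0 uz.
  case: (nz z) => //; apply; move: rz; rewrite rootE Pz//.
  by rewrite mulf_eq0 expf_eq0 (negbTE z0) andbF/= subr_eq0 => /eqP.
rewrite PE; apply: bop_inverse_cancel; apply: bop_inverseX.
by exists v.
Qed.

(** A relation, since [f] does not determine the pair [p], [q]: a constant term may sit in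
    either. *)
Definition laurent (f : R[i] -> R[i]) (F : bop H) := exists p q,
  (forall z, z != 0 -> f z = p.[z] + q.[z^-1]) /\
  F = bop_horner p u + bop_horner q v.

Lemma laurentD (f g : R[i] -> R[i]) (F G : bop H) : laurent f F -> laurent g G ->
  laurent (fun z => f z + g z) (F + G).
Proof.
move=> [p [q [fE ->]]] [p' [q' [gE ->]]]; exists (p + p'), (q + q'); split.
  by move=> z z0; rewrite fE// gE// !hornerD addrACA.
by rewrite !bop_hornerD addrACA.
Qed.

Lemma laurentZ k (f : R[i] -> R[i]) (F : bop H) : laurent f F -> laurent (fun z => k * f z) (k *: F).
Proof.
move=> [p [q [fE ->]]]; exists (k *: p), (k *: q); split.
  by move=> z z0; rewrite fE// !hornerZ mulrDr.
by rewrite !bop_hornerZ scalerDr.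
Qed.

Lemma poly_split q : exists (q1 : {poly R[i]}) c, q = q1 * 'X + c%:P.
Proof.
by elim/poly_ind: q => [|q c _]; [exists 0, 0; rewrite mul0r add0r|exists q, c].
Qed.

(** The constant coefficient of [q] is the one that changes sides: it becomes a linear term of the
    first polynomial. *)
Lemma laurent_mulz (f : R[i] -> R[i]) (F : bop H) :
  laurent f F -> laurent (fun z => z * f z) (u * F).
Proof.
have [uv vu] := u_unit.
move=> [p [q [fE ->]]]; have [q1 [c qE]] := poly_split q; subst q.
exists ('X * p + c *: 'X), q1; split.
  by move=> z z0; rewrite fE// !hornerE !mulrDr (mulrCA z) mulfV// mulr1; ring.
rewrite (bop_hornerD ('X * p)) bop_hornerM bop_hornerZ bop_hornerX (bop_hornerD (q1 * 'X)) bop_hornerMX.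
rewrite bop_hornerC !mulrDr -addrA; congr (_ + _); rewrite addrC -bop_scalerAr mulr1.
by congr (_ + _); rewrite mulrA (bop_horner_comm q1) ?uv// -mulrA uv mulr1.
Qed.

Lemma laurent_mulzV (f : R[i] -> R[i]) (F : bop H) :
  laurent f F -> laurent (fun z => z^-1 * f z) (v * F).
Proof.
have [uv vu] := u_unit.
move=> [p [q [fE ->]]]; have [p1 [c pE]] := poly_split p; subst p.
exists p1, ('X * q + c *: 'X); split.
  move=> z z0; rewrite fE// !hornerE !mulrDr (mulrCA z^-1) mulVf// mulr1.
  by rewrite addrAC (mulrC z^-1 c).
rewrite (bop_hornerD ('X * q)) bop_hornerM bop_hornerZ bop_hornerX bop_hornerD bop_hornerMX.
rewrite bop_hornerC !mulrDr addrAC -addrA; congr (_ + _); last first.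
  by rewrite -bop_scalerAr mulr1.
by rewrite mulrA (bop_horner_comm p1) ?vu// -mulrA vu mulr1.
Qed.

End BopHorner.

(** * Spectral inequality for Laurent polynomials in a unitary operator *)

Section SpectralInequality.
Variables (R : realType) (H : completeNormedModType R[i]).
Variable ip : {dot H for @conjC R[i]}.
Hypothesis ip_norm : forall x, ip x x = `|x| ^+ 2.
Hypothesis H_nonzero : exists x : H, x != 0.
Local Notation "r *' x" := ((r%:C%C : R[i]) *: x) (at level 40).
Local Notation J x := (('i%C : R[i]) *: x).
Local Notation rp := (rip ip).
Implicit Types (x y : H) (z w : R[i]).

Lemma ripZc z x y : rp (z *: x) y = complex.Re z * rp x y + complex.Im z * rp (J x) y.
Proof. by rewrite [in LHS]cplxZ ripDl !ripZl. Qed.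

Lemma ripZc_conj z x y : rp (z *: x) y = rp x (z^*%C *: y).
Proof.
rewrite ripZc [z^*%C *: y]cplxZ ripDr !ripZr ripJC.
by case: z => r i /=; ring.
Qed.

Lemma ripZxx z x : rp (z *: x) x = complex.Re z * rp x x.
Proof. by rewrite ripZc ripJxx mulr0 addr0. Qed.

Variable u : bop H.
Hypothesis uU : unitary ip u.
Local Notation v := (bop_inv u).

Let u_unit : bop_inverse u v. Proof. exact: (unitary_inverse ip_norm). Qed.
Let vU : unitary ip v. Proof. exact: (unitary_inv ip_norm). Qed.

Lemma rp_unitary_le z x : rp (z *: u x) x <= complex.Re `|z| * rp x x.
Proof.
rewrite (le_trans (rip_le ip_norm _ _))// rnormZc (unitary_rnorm ip_norm)//.
by rewrite (ripxx ip_norm) expr2 mulrA.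
Qed.

Lemma spec_unitary_coercive z w (d : R) : 0 < d ->
  (forall x, d * rp x x <= rp (w *: (u x - z *: x)) x) -> ~ spec u z.
Proof.
move=> d0 wu; apply; apply: (bop_inverse_scaler (k := w)).
by apply: (coercive_inverse ip_norm d0) => x; exact: wu.
Qed.

(** For [|z| > 1], multiplying [u - z] by minus the conjugate of [z] gives a coercive operator; for
    [|z| < 1], so does [u^-1 (u - z) = 1 - z u^-1]. *)
Lemma spec_unitary_norm z : spec u z -> complex.Re `|z| = 1.
Proof.
move=> uz; set m := complex.Re `|z|.
have m0 : 0 <= m by rewrite -ler0c RRe_real ?normr_real.
have mz : z^*%C * z = (m ^+ 2)%:C%C.
  by rewrite mulrC -sqr_normc rmorphXn/= RRe_real ?normr_real.
apply/eqP; rewrite eq_le; apply/andP; split; rewrite leNgt; apply/negP => m1.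
  apply: (@spec_unitary_coercive z (- z^*%C) (m * (m - 1))) uz.
    by rewrite mulr_gt0 ?subr_gt0// (lt_trans ltr01).
  move=> x; rewrite scalerBr scalerA mulNr mz ripBl ripZxx/= scaleNr ripNl.
  have := rp_unitary_le (z^*%C) x; rewrite normcJ -/m.
  by lra.
apply: uz; apply: (@bop_inverse_cancel _ _ v); first by exists u; split; [exact: u_unit.2|exact: u_unit.1].
apply: (@coercive_inverse _ _ ip ip_norm _ (1 - m)); first by rewrite subr_gt0.
move=> x; rewrite mulrBr -bop_scalerAr mulr1 u_unit.2 !bopE ripBl.
have : rp (z *: v x) x <= m * rp x x.
  rewrite (le_trans (rip_le ip_norm _ _))// rnormZc (unitary_rnorm ip_norm)//.
  by rewrite (ripxx ip_norm) expr2 mulrA.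
by lra.
Qed.

Lemma bop_horner_adj (p : {poly R[i]}) (f g : bop H) x y :
  (forall x y, rp (f x) y = rp x (g y)) ->
  rp (bop_horner p f x) y = rp x (bop_horner (map_poly conjc p) g y).
Proof.
move=> fg; elim/poly_ind: p x => [|p c ih] x.
  by rewrite rmorph0 !bop_horner0 /= rip0l rip0r.
rewrite rmorphD rmorphM/= map_polyX map_polyC/= !bop_hornerD !bop_hornerMX !bop_hornerC.
rewrite !bopE ripDl ripDr ripZc_conj; congr (_ + _).
rewrite ih fg; congr (rp x _).
have /(congr1 (fun h : bop H => h y)) := @bop_horner_comm _ _ (map_poly conjc p) g g erefl.
by [].
Qed.

Lemma unitary_conjC z : complex.Re `|z| = 1 -> z^*%C = z^-1.
Proof.
move=> z1; have zz : z * z^*%C = 1.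
  by rewrite -sqr_normc -[`|z|]RRe_real ?normr_real// z1 expr1n.
have z0 : z != 0 by apply/eqP => z0; move: zz; rewrite z0 mul0r => /eqP; rewrite eq_sym oner_eq0.
by apply: (mulfI z0); rewrite zz mulfV.
Qed.

Let half : R[i] := (2^-1)%:C%C.

(** The hermitian operator [(u + u^-1) / 2] has its numerical supremum in its spectrum, and
    [(z + z^-1) / 2] is not constant: it differs at 1 and -1. *)
Lemma spec_unitary_neq0 : exists z, spec u z.
Proof.
pose S := bop_horner (half *: 'X) u + bop_horner (half *: 'X) v.
have hS : hermitian ip S.
  move=> x y; rewrite /S !bop_hornerZ !bop_hornerX !bopE !ripDl !ripDr !ripZl !ripZr.
  rewrite (unitary_adj ip_norm x y uU) (ripC ip x (v y)) (unitary_adj ip_norm y x uU) (ripC ip y).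
  by rewrite addrC.
have := numeric_sup_spec ip_norm H_nonzero hS; rewrite /real_spec /=.
move=> /(laurent_spectral_mapping u_unit)[[z uz _]|h]; first by exists z.
have := h 1 (oner_neq0 _); have := h (-1); rewrite oppr_eq0 oner_neq0 => /(_ isT).
rewrite !hornerZ !hornerX invrN invr1 mulr1 mulrN1 => <- /eqP.
rewrite -subr_eq0 opprD !opprK -mulr2n -mulr2n -mulrnA mulrn_eq0/=.
by move=> /eqP/(@complexI R)/eqP; rewrite invr_eq0 pnatr_eq0.
Qed.

(* The hermitian part of [p(u) + q(u^-1)] is again a Laurent polynomial in [u], whose
   value at a point of the unit circle is the real part of [p(z) + q(z^-1)]. *)
Lemma laurent_numeric_le (f : R[i] -> R[i]) (F : bop H) (m : R) : laurent u f F ->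
  (forall z, spec u z -> complex.Re (f z) <= m) ->
  forall x, rp (F x) x <= m * rp x x.
Proof.
move=> [p [q [fE ->]]] fm.
pose P := half *: (p + map_poly conjc q); pose Q := half *: (q + map_poly conjc p).
pose S := bop_horner P u + bop_horner Q v.
have uv x y : rp (u x) y = rp x (v y) by rewrite ripC -(unitary_adj ip_norm) 1?ripC.
have vu x y : rp (v x) y = rp x (u y) by rewrite (unitary_adj ip_norm).
have SE x y : rp (S x) y = 2^-1 * rp ((bop_horner p u + bop_horner q v) x) y
     + 2^-1 * rp x ((bop_horner p u + bop_horner q v) y).
  rewrite /S /P /Q !bop_hornerZ !bop_hornerD !bopE !ripDl !ripZl !ripDl ripDr.
  have h1 := bop_horner_adj q y x vu; have h2 := bop_horner_adj p y x uv.
  rewrite (ripC ip x (bop_horner p u y)) (ripC ip x (bop_horner q v y)).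
  by rewrite h1 h2 !(ripC ip y); ring.
have hS : hermitian ip S by move=> x y; rewrite SE (ripC ip x (S y)) SE ripC (ripC ip x); ring.
have Sx x : rp (S x) x = rp ((bop_horner p u + bop_horner q v) x) x.
  by rewrite SE (ripC ip x); field.
move=> x; rewrite -Sx (le_trans (numeric_sup_ub ip_norm H_nonzero S x))//.
rewrite ler_wpM2r ?(ripxx_ge0 ip_norm)//.
have := numeric_sup_spec ip_norm H_nonzero hS; rewrite /real_spec /=.
move=> /(laurent_spectral_mapping u_unit).
have PQ z : spec u z -> P.[z] + Q.[z^-1] = (complex.Re (f z))%:C%C.
  move=> uz; have z1 := unitary_conjC (spec_unitary_norm uz).
  have z0 := spec_neq0 u_unit uz.
  have zV : (z^-1)^*%C = z by rewrite -z1 conjcK.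
  have mapJ (r : {poly R[i]}) (w : R[i]) : (map_poly conjc r).[w^*%C] = r.[w]^*%C.
    exact: horner_map.
  rewrite /P /Q !hornerZ !hornerD -{2}zV -{3}z1 !mapJ ReJ_add fE// rmorphD/=.
  by rewrite /half rmorphV ?unitfE ?pnatr_eq0//= rmorph_nat; field.
case=> [[z uz]|PQl].
  by rewrite PQ// => /(@complexI R) <-; exact: fm.
(* A constant Laurent polynomial also takes its value at some point of the spectrum. *)
have [z uz] := spec_unitary_neq0; have := PQ z uz.
by rewrite PQl ?(spec_neq0 u_unit uz)// => /(@complexI R) ->; exact: fm.
Qed.

End SpectralInequality.

(** * Uniform approximation of the argument on a proper arc *)

Section ArcSeries.
Variable R : realType.
Implicit Types (t q r : R) (n N : nat).

(* Taylor coefficients of [arcsin x / (x sqrt (1 - x^2))] in [x^2]; with [x = sin (t/2)]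
   this is [t / sin t], so that [arcsum N t] tends to [t] for [|t| < pi]. *)
Fixpoint acoef n : R :=
  if n is m.+1 then acoef m * ((2 * m + 2)%:R / (2 * m + 3)%:R) else 1.

(** The haversine [sin^2 (t / 2)], written so as to be a Laurent polynomial in [e^{it}]. *)
Definition hav t : R := (1 - cos t) / 2.

Definition arcterm n t : R := sin t * hav t ^+ n.

Definition arcsum N t : R := \sum_(n < N) acoef n * arcterm n t.

Lemma acoef_ge0 n : 0 <= acoef n.
Proof. by elim: n => //= n ih; rewrite mulr_ge0// divr_ge0. Qed.

Lemma acoef_le1 n : acoef n <= 1.
Proof.
elim: n => //= n ih; rewrite (le_trans _ ih)// ler_piMr ?acoef_ge0//.
by rewrite ler_pdivrMr ?ltr0n ?addn_gt0 ?orbT// mul1r ler_nat leq_add2l.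
Qed.

Lemma hav_ge0 t : 0 <= hav t.
Proof. by rewrite divr_ge0// subr_ge0 cos_le1. Qed.

Lemma sin2_hav t : sin t ^+ 2 = 4 * hav t * (1 - hav t).
Proof. by rewrite sin2cos2 /hav; field. Qed.

Lemma cos_hav t : cos t = 1 - 2 * hav t.
Proof. by rewrite /hav; field. Qed.

Lemma hav_derive t : is_derive t 1 hav (sin t / 2).
Proof.
have d : is_derive t 1 (fun t => 2^-1 * (1 - cos t)) (2^-1 * (0 - - sin t)).
  by apply: is_deriveZ; apply: is_deriveB.
have -> : hav = (fun t => 2^-1 * (1 - cos t)) by apply/funext => x; rewrite /hav mulrC.
by apply: (is_derive_eq d); rewrite sub0r opprK mulrC.
Qed.

Lemma arcterm_derive n t : is_derive t 1 (arcterm n)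
  ((2 * n + 1)%:R * hav t ^+ n - (2 * n + 2)%:R * hav t ^+ n.+1).
Proof.
elim: n => [|n ih].
  have -> : arcterm 0 = (@sin R) by apply/funext => x; rewrite /arcterm expr0 mulr1.
  by apply: (is_derive_eq (is_derive_sin t)); rewrite muln0 !add0n cos_hav expr0 expr1 mulr1.
have -> : arcterm n.+1 = (fun t => arcterm n t * hav t).
  by apply/funext => x; rewrite /arcterm exprSr mulrA.
have d := is_deriveM ih (hav_derive t); apply: (is_derive_eq d).
rewrite /GRing.scale /=.
have e : arcterm n t * (sin t / 2) = 2 * hav t ^+ n.+1 * (1 - hav t).
  transitivity (hav t ^+ n * (sin t ^+ 2) / 2); first by rewrite /arcterm; field.
  by rewrite sin2_hav exprS; field.
rewrite e !natrD !natrM !exprS -[n.+1%:R]natr1; ring.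
Qed.

(** [acoef n.+1 * (2 n + 3) = acoef n * (2 n + 2)], so the derivatives of the terms telescope and a
    single remainder is left. *)
Lemma arcsum_derive N t :
  is_derive t 1 (arcsum N) (1 - acoef N * (2 * N + 1)%:R * hav t ^+ N).
Proof.
elim: N => [|N ih].
  have -> : arcsum 0 = cst 0 by apply/funext => x; rewrite /arcsum big_ord0.
  by apply: (is_derive_eq (is_derive_cst _ _ _)); rewrite /= expr0 !mulr1 subrr.
have -> : arcsum N.+1 = (fun t => arcsum N t + acoef N * arcterm N t).
  by apply/funext => x; rewrite /arcsum big_ord_recr.
have d := is_deriveD ih (is_deriveZ (acoef N) (arcterm_derive N t)).
apply: (is_derive_eq d); rewrite /GRing.scale /=.
have k : (2 * N + 3)%:R != 0 :> R by rewrite pnatr_eq0 addn_eq0 andbF.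
have -> : (2 * N.+1 + 1 = 2 * N + 3)%N by lia.
rewrite -[acoef N * _ * (2 * N + 3)%:R]mulrA divfK//.
by ring.
Qed.

Lemma arcsumN N t : arcsum N (- t) = - arcsum N t.
Proof.
rewrite /arcsum -sumrN; apply: eq_bigr => n _.
by rewrite /arcterm /hav sinN cosN mulNr mulrN.
Qed.

Lemma hav_le (t0 t : R) : 0 <= t0 <= pi -> `|t| <= t0 -> hav t <= hav t0.
Proof.
move=> /andP[t00 t0pi] tt0; rewrite /hav ler_pM2r// lerB// -(cos_norm t).
rewrite leNgt ltr_cos ?in_itv/= ?normr_ge0 ?t00// -?leNgt//.
exact: le_trans tt0 t0pi.
Qed.

Lemma hav_lt1 t : 0 <= t < pi -> hav t < 1.
Proof.
move=> /andP[t0 tpi]; rewrite /hav ltr_pdivrMr// mul1r ltrBlDr -ltrBlDl.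
have : cos pi < cos t by rewrite ltr_cos// in_itv/= ?t0 ?(ltW tpi) ?lexx ?pi_ge0.
by rewrite cospi; lra.
Qed.

(** The error is odd and vanishes at 0; its derivative is the remainder of [arcsum_derive], and
    [hav] is largest at the ends of the arc. *)
Lemma arcsum_error (t0 t : R) N : 0 <= t0 <= pi -> `|t| <= t0 ->
  `|t - arcsum N t| <= pi * (2 * N + 1)%:R * hav t0 ^+ N.
Proof.
move=> t0pi; wlog t_ge0 : t / 0 <= t.
  move=> h tt0; have [|t_lt0] := leP 0 t; first by move/h; apply.
  have -> : t - arcsum N t = - (- t - arcsum N (- t)) by rewrite arcsumN; ring.
  rewrite normrN; apply: h; rewrite ?normrN//.
  by rewrite oppr_ge0 ltW.
rewrite ger0_norm// => tt0.
pose E x := x - arcsum N x.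
have Ed (x : R) : is_derive x 1 E (acoef N * (2 * N + 1)%:R * hav x ^+ N).
  have d := is_deriveB (is_derive_id x 1) (arcsum_derive N x).
  by apply: (is_derive_eq d); rewrite opprB addrC subrK.
have [|c ct Ec] := @MVT_segment _ E _ 0 t t_ge0 (fun x _ => Ed x).
  apply: continuous_subspaceT => x; exact: is_derive_continuous (Ed x).
have E0 : E 0 = 0.
  by rewrite /E -{2}oppr0 arcsumN opprK add0r; have := arcsumN N 0; rewrite oppr0; lra.
have := ct; rewrite in_itv/= => /andP[c0 ct'].
have hc : hav c <= hav t0 by apply: hav_le => //; rewrite ger0_norm// (le_trans ct').
rewrite -/(E t) -[E t]subr0 -E0 Ec subr0 ger0_norm; last first.
  by rewrite !mulr_ge0 ?acoef_ge0 ?exprn_ge0 ?hav_ge0.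
have tpi : t <= pi by rewrite (le_trans tt0)//; case/andP: t0pi.
have hN : hav c ^+ N <= hav t0 ^+ N by rewrite lerXn2r ?nnegrE ?hav_ge0.
rewrite mulrC -2!mulrA [acoef N * _]mulrC -!mulrA.
have a1 := acoef_le1 N; have a0 := acoef_ge0 N.
rewrite ler_pM// ?mulr_ge0 ?exprn_ge0 ?hav_ge0// ler_wpM2l//.
by rewrite -[leRHS]mulr1 ler_pM ?exprn_ge0 ?hav_ge0.
Qed.

(** [1 - r ^+ n] is [1 - r] times a sum of [n] powers of [r], each at least [r ^+ n]. *)
Lemma natr_geometric_bound r n : 0 < r < 1 -> n%:R * (1 - r) * r ^+ n <= 1.
Proof.
move=> /andP[r0 r1]; have rn1 k : r ^+ k <= 1 by rewrite exprn_ile1 ?ltW.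
suff : n%:R * (1 - r) * r ^+ n <= 1 - r ^+ n.
  by move/le_trans; apply; rewrite gerBl exprn_ge0// ltW.
elim: n => [|n ih]; first by rewrite !mul0r expr0 subrr.
rewrite exprS -natr1.
have h : 0 <= r ^+ n by rewrite exprn_ge0// ltW.
have := ler_wpM2l (ltW r0) ih.
have : 0 <= n%:R :> R by [].
have := rn1 n; set x := r ^+ n in h *; set m := n%:R.
move=> x1 m0 k; have : r * x * (1 - r) <= x * (1 - r).
  by rewrite ler_wpM2r ?ler_piMl ?subr_ge0// ltW.
have : r * x <= r by rewrite ler_piMr// ltW.
nra.
Qed.

Lemma arcsum_uniform (t0 e : R) : 0 <= t0 < pi -> 0 < e ->
  \forall N \near \oo, forall t, `|t| <= t0 -> `|t - arcsum N t| < e.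
Proof.
move=> /andP[t00 t0pi] e0.
have h0 := hav_ge0 t0.
have h1 : hav t0 < 1 by apply: hav_lt1; rewrite t00.
(* [q] lies in []0, 1[] and above [hav t0], even if [hav t0 = 0]. With [r = sqrt q], one power
   [r ^+ N] absorbs the factor [2 N + 1] and the other gives the decay. *)
pose q := (1 + hav t0) / 2.
have q0 : 0 < q by rewrite divr_gt0// ltr_pwDl.
have q1 : q < 1 by rewrite /q; lra.
have hq : hav t0 <= q by rewrite /q; lra.
pose r := Num.sqrt q.
have r0 : 0 < r by rewrite sqrtr_gt0.
have r1 : r < 1 by rewrite -[ltRHS]sqrtr1 ltr_sqrt.
have qE : q = r ^+ 2 by rewrite sqr_sqrtr ?ltW.
pose K := pi * (2 / (1 - r) + 1).
have lim : (fun N => K * r ^+ N) @ \oo --> (0 : R).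
  by rewrite -(mulr0 K); apply: cvgMr; apply: cvg_expr; rewrite gtr0_norm.
have /cvgrPdist_lt /(_ e e0) := lim.
apply: filterS => N; rewrite sub0r normrN => Ke t tt0.
apply: le_lt_trans (le_lt_trans (ler_norm _) Ke).
rewrite (le_trans (arcsum_error _ _ tt0)) ?t00 ?(ltW t0pi)//.
rewrite /K -2!mulrA ler_wpM2l ?pi_ge0//.
have hN : hav t0 ^+ N <= r ^+ N * r ^+ N.
  by rewrite -expr2 -exprM mulnC exprM -qE lerXn2r ?nnegrE// ltW.
have rN0 : 0 <= r ^+ N by rewrite exprn_ge0// ltW.
have := @natr_geometric_bound r N; rewrite r0 r1 => /(_ isT) b.
rewrite (@le_trans _ _ ((2 * N + 1)%:R * (r ^+ N * r ^+ N)))//.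
  by rewrite ler_wpM2l.
rewrite mulrA ler_wpM2r// natrD natrM mulrDl mul1r lerD//; last first.
  by rewrite exprn_ile1// ltW.
rewrite ler_pdivlMr ?subr_gt0//; move: b; lra.
Qed.

End ArcSeries.

(** * Norm limits of operators *)

Section Completeness.
Variables (R : realType) (H : completeNormedModType R[i]).

(** The pointwise limits keep the rate [e n * rnorm x], from which linearity, boundedness and
    convergence in norm all follow. *)
Lemma bop_geometric_cvg (q C : R) (F : nat -> bop H) : 0 <= q < 1 ->
  (forall n, opnorm (F n.+1 - F n) <= C * q ^+ n) -> exists A : bop H, F @ \oo --> A.
Proof.
move=> q01 FC; have [q0 q1] := andP q01.
pose e n := C / (1 - q) * q ^+ n.
have C0 : 0 <= C by have := FC 0%N; rewrite expr0 mulr1; apply: le_trans; exact: opnorm_ge0.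
have e0 n : 0 <= e n by rewrite mulr_ge0 ?exprn_ge0// divr_ge0// subr_ge0 ltW.
have elim : e @ \oo --> 0.
  rewrite -(mulr0 (C / (1 - q))); apply: cvgMr.
  by apply: cvg_expr; rewrite ger0_norm.
have /choice[g gF] : forall x, exists l, forall n, rnorm (l - F n x) <= e n * rnorm x.
  move=> x; have FCx n : rnorm (F n.+1 x - F n x) <= C * rnorm x * q ^+ n.
    rewrite -[_ - _]/((F n.+1 - F n) x) (le_trans (rnorm_bop _ _))// mulrAC.
    by rewrite ler_wpM2r ?rnorm_ge0.
  have [l ln] := geometric_cauchy q01 FCx; exists l => n; rewrite (le_trans (ln n))//.
  by rewrite /e le_eqVlt; apply/orP; left; apply/eqP; ring.
have glin : linear g.
  move=> k x y; apply/eqP; rewrite -subr_eq0 -rnorm_eq0 eq_le rnorm_ge0 andbT.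
  pose D := C / (1 - q) * (rnorm (k *: x + y) + complex.Re `|k| * rnorm x + rnorm y).
  apply: (@geometric_le0 _ q D) => // n.
  have -> : g (k *: x + y) - (k *: g x + g y) =
      (g (k *: x + y) - F n (k *: x + y)) - (k *: (g x - F n x) + (g y - F n y)).
    rewrite bopD bopZ scalerBr addrACA -!opprD opprB.
    by rewrite addrA subrK.
  rewrite (le_trans (rnormD _ _))// rnormN.
  rewrite (@le_trans _ _ (e n * rnorm (k *: x + y) + (complex.Re `|k| * (e n * rnorm x) + e n * rnorm y)))//.
    rewrite lerD// (le_trans (rnormD _ _))// lerD// rnormZc ler_wpM2l//.
    by rewrite -ler0c RRe_real ?normr_real.
  by rewrite /e /D le_eqVlt; apply/orP; left; apply/eqP; ring.
have gbnd : exists M : R, forall x, `|g x| <= M%:C%C * `|x|.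
  exists (e 0%N + opnorm (F 0%N)) => x; rewrite !normrE -rmorphM lecR mulrDl.
  rewrite -[g x](subrK (F 0%N x)) (le_trans (rnormD _ _))// lerD ?gF//.
  exact: rnorm_bop.
exists (Bop glin gbnd); apply/cvg_opnorm.
apply: (@squeeze_cvgr _ _ _ _ (cst 0) e) => //; last exact: cvg_cst.
apply: nearW => n; rewrite opnorm_ge0/= opnormB.
by apply: opnorm_le => // x; exact: gF.
Qed.

End Completeness.

(** * The principal argument on an arc *)

Section LogOnArc.
Variable R : realType.
Implicit Types (z : R[i]) (t : R).

Lemma expi_Arg z : complex.Re `|z| = 1 -> [/\ z = expi (Arg z), Log z = (0 +i* Arg z)%C,
  - pi <= Arg z & Arg z <= pi].
Proof.
move=> z1; rewrite /Log /Arg z1 ln1 divr1.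
have ri : complex.Re z ^+ 2 + complex.Im z ^+ 2 = 1.
  apply: (@complexI R); rewrite add_Re2_Im2 -[`|z|]RRe_real ?normr_real//.
  by rewrite z1 expr1n.
have rI : -1 <= complex.Re z <= 1.
  rewrite -ler_norml -(@expr_le1 _ 2) ?normr_ge0// real_normK ?num_real//.
  by have := sqr_ge0 (complex.Im z); lra.
have c := @acosK R (complex.Re z); rewrite in_itv/= rI in c.
have a0 := acos_ge0 rI; have api := acos_lepi rI.
have s : sin (acos (complex.Re z)) = `|complex.Im z|.
  rewrite sin_acos// -sqrtr_sqr; congr Num.sqrt; lra.
case: z z1 ri rI c a0 api s => x y /= z1 ri rI c a0 api s.
have pi0 := @pi_ge0 R.
case: ifPn => [y0|]; [rewrite ger0_norm// in s|rewrite -ltNge => y0; rewrite ltr0_norm// in s].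
  by split => //; [rewrite /expi c// s|lra].
by split => //; [rewrite /expi cosN sinN c// s opprK|lra|lra].
Qed.

(** The cosine inequality bounds the distance of [t] from the midpoint only modulo [2 pi]. As [m]
    and [M] lie inside []-pi, pi[], that distance is below [2 pi - (M - m) / 2], which excludes
    every other branch. *)
Lemma arc_bounds (m M t : R) : - pi < m -> m <= M -> M < pi -> - pi <= t -> t <= pi ->
  cos ((M - m) / 2) <= cos (t - (M + m) / 2) -> m <= t <= M.
Proof.
move=> pm mM Mpi pt tpi.
have key (r d : R) : 0 <= r -> r < pi -> 0 <= d -> d < 2 * pi - r -> cos r <= cos d -> d <= r.
  move=> r0 rpi d0 d2 crd; rewrite leNgt; apply/negP => rd.
  move: crd; rewrite leNgt => /negP; apply.
  have [dpi|pid] := leP d pi.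
    by rewrite ltr_cos// in_itv/= ?r0 ?d0 ?dpi ?(ltW rpi).
  have -> : cos d = cos (2 * pi - d).
    by rewrite -[RHS]cosN opprB mulrC mulr_natr -(cosD2pi (d - _)) subrK.
  by rewrite ltr_cos ?in_itv/= ?r0 ?(ltW rpi)//=; [lra|apply/andP; split; lra].
move=> ct; have [tc|tc] := leP 0 (t - (M + m) / 2).
  have : t - (M + m) / 2 <= (M - m) / 2 by apply: key => //; lra.
  by move=> h; apply/andP; split; lra.
have : - (t - (M + m) / 2) <= (M - m) / 2 by apply: key; rewrite ?cosN//; lra.
by move=> h; apply/andP; split; lra.
Qed.

Lemma normc_ge_Im z : `|complex.Im z|%:C%C <= `|z|.
Proof.
have := normc_ge_Re (z * 'i%C); rewrite ReiNIm normrN normrM.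
by rewrite [X in _ * X]normc_def/= expr0n/= add0r expr1n sqrtr1 mulr1.
Qed.

End LogOnArc.

Lemma le_mul_eps (R : realFieldType) (a k b : R) : 0 <= b ->
  (forall e, 0 < e -> a <= (k + e) * b) -> a <= k * b.
Proof.
rewrite le_eqVlt => /predU1P[<- h|b0 h]; first by rewrite mulr0; have := h 1 ltr01; rewrite mulr0.
apply/ler_addgt0Pr => e e0; have := h (e / b) (divr_gt0 e0 b0).
by rewrite mulrDl divfK ?gt_eqF.
Qed.

(** * The logarithm of a unitary operator with spectrum in a proper arc *)

Section UnitaryLog.
Variables (R : realType) (H : completeNormedModType R[i]).
Variable ip : {dot H for @conjC R[i]}.
Hypothesis ip_norm : forall x, ip x x = `|x| ^+ 2.
Hypothesis H_nonzero : exists x : H, x != 0.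
Local Notation "r *' x" := ((r%:C%C : R[i]) *: x) (at level 40).
Local Notation J x := (('i%C : R[i]) *: x).
Local Notation rp := (rip ip).
Implicit Types (x y : H) (z w : R[i]).

Variable u : bop H.
Hypothesis uU : unitary ip u.
Local Notation v := (bop_inv u).

Variables m M : R.
Hypotheses (pm : - pi < m) (mM : m <= M) (Mpi : M < pi)
  (arc : forall x, cos ((M - m) / 2) * rp x x <= rp (rot ((M + m) / 2) (u x)) x).

Let u_unit : bop_inverse u v. Proof. exact: (unitary_inverse ip_norm). Qed.

(** Were the argument of [z] outside [[m, M]], then [u - z] would become coercive after
    multiplication by the phase [e^{-i (M + m) / 2}]. *)
Lemma spec_arc z : spec u z -> [/\ z = expi (Arg z), Log z = (0 +i* Arg z)%C,
  m <= Arg z & Arg z <= M].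
Proof.
move=> uz; have [zE LE pA Api] := expi_Arg (spec_unitary_norm ip_norm uU uz).
suff /andP[mA AM] : m <= Arg z <= M by [].
apply: arc_bounds => //; rewrite leNgt; apply/negP => lt.
have d0 : 0 < cos ((M - m) / 2) - cos (Arg z - (M + m) / 2) by rewrite subr_gt0.
apply: (@spec_unitary_coercive _ _ ip ip_norm u z (expi (- ((M + m) / 2))) _ d0) uz => x.
rewrite scalerBr ripBl -rotE.
have -> : rp (expi (- ((M + m) / 2)) *: (z *: x)) x = cos (Arg z - (M + m) / 2) * rp x x.
  rewrite scalerA ripZxx; congr (_ * _).
  by rewrite {1}zE /expi /= cosB cosN sinN; ring.
by rewrite mulrBl lerB.
Qed.

Lemma form_limit (L : nat -> bop H) (A : bop H) x y (c : R) : L @ \oo --> A ->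
  (\forall n \near \oo, rp (L n x) y <= c) -> rp (A x) y <= c.
Proof.
move=> LA Lc; have lim : (fun n => rp (L n x) y) @ \oo --> rp (A x) y.
  exact: (cvg_rip_bop ip_norm).
by rewrite -(cvg_lim _ lim)//; apply: limr_le => //; exact: cvgP lim.
Qed.

Let form_le := laurent_numeric_le ip_norm H_nonzero uU.

(** On the spectrum the approximants have real part within [e] of 0 and imaginary part within [e] of
    [[m, M]]. The spectral inequality, applied to them times 1, -1, [-i] and [i], survives both
    limits. *)
Lemma log_numeric A : functional_calculus u (@Log R) A ->
  [/\ skew ip A, forall x, rp (A x) (J x) <= M * rp x x &
      forall x, m * rp x x <= rp (A x) (J x)].
Proof.
move=> [p [q [pq LA]]].
set L := (fun n => bop_horner (p n) u + bop_horner (q n) v) in LA.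
pose l n z : R[i] := (p n).[z] + (q n).[z^-1].
have lL n : laurent u (l n) (L n) by exists (p n), (q n).
have near_log e : 0 < e -> \forall n \near \oo, forall z, spec u z ->
    [/\ complex.Re (l n z) <= e, - e <= complex.Re (l n z),
        complex.Im (l n z) <= M + e & m - e <= complex.Im (l n z)].
  move=> e0; apply: filterS (pq e e0) => n ln z uz.
  have [_ LE mA AM] := spec_arc uz; have := ln z uz; rewrite LE -/(l n z) => lt.
  have := le_lt_trans (normc_ge_Re _) lt; have := le_lt_trans (normc_ge_Im _) lt.
  rewrite !ltcR; case: (l n z) => r i /=; rewrite !ltr_norml.
  by move=> /andP[? ?] /andP[? ?]; split; lra.
have xx x := ripxx_ge0 ip_norm x.
have Ap x : rp (A x) x <= 0 * rp x x.
  apply: le_mul_eps => // e e0; apply: (form_limit LA).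
  apply: filterS (near_log e e0) => n ln; apply: (form_le (lL n)) => z uz.
  by have [] := ln z uz; lra.
have An x : - rp (A x) x <= 0 * rp x x.
  apply: le_mul_eps => // e e0; rewrite -ripNr; apply: (form_limit LA).
  apply: filterS (near_log e e0) => n ln.
  have := form_le (m := 0 + e) (laurentZ (-1) (lL n)).
  have -> : rp (L n x) (- x) = rp ((-1 *: L n) x) x by rewrite bopE scaleN1r ripNr ripNl.
  apply => z uz.
  by have [] := ln z uz; case: (l n z) => r i /=; lra.
split.
- by move=> x; apply/eqP; rewrite eq_le; have := Ap x; have := An x; rewrite mul0r; lra.
- move=> x; apply: le_mul_eps => // e e0; apply: (form_limit LA).
  apply: filterS (near_log e e0) => n ln.
  rewrite -mul_Ni_form; apply: (form_le (laurentZ (- 'i%C) (lL n))) => z uz.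
  by have [] := ln z uz; case: (l n z) => r i /=; lra.
- move=> x; rewrite -lerN2 -mulNr; apply: le_mul_eps => // e e0.
  rewrite -ripNr; apply: (form_limit LA).
  apply: filterS (near_log e e0) => n ln.
  rewrite ripNr -ripJC; apply: (form_le (laurentZ 'i%C (lL n))) => z uz.
  by have [] := ln z uz; case: (l n z) => r i /=; lra.
Qed.

(** At [z = e^{it}] the first factors give [i sin t] and the base of the power is [hav t], so this
    is [i * arcterm n t] as a Laurent polynomial. *)
Let g n z : R[i] := (2^-1)%:C%C * (z - z^-1) * ((2^-1)%:C%C - (4^-1)%:C%C * (z + z^-1)) ^+ n.

Let g_expi n t : g n (expi t) = (0 +i* arcterm n t)%C.
Proof.
have VE : (expi t)^-1 = expi (- t) :> R[i].
  have e : expi t * expi (- t) = 1 :> R[i].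
    have := cos2Dsin2 t; rewrite !expr2 => cs.
    by apply/eqP; rewrite eq_complex /= cosN sinN; apply/andP; split; apply/eqP; [lra|ring].
  have z0 : expi t != 0 :> R[i].
    by apply/eqP => z0; move: e; rewrite z0 mul0r => /eqP; rewrite eq_sym oner_eq0.
  by apply: (mulfI z0); rewrite mulfV// e.
rewrite /g VE.
have -> : (2^-1)%:C%C * (expi t - expi (- t)) = (0 +i* sin t)%C :> R[i].
  by apply/eqP; rewrite eq_complex /= cosN sinN; apply/andP; split; apply/eqP; field.
have -> : (2^-1)%:C%C - (4^-1)%:C%C * (expi t + expi (- t)) = (hav t)%:C%C :> R[i].
  by apply/eqP; rewrite eq_complex /= cosN sinN /hav; apply/andP; split; apply/eqP; field.
rewrite -rmorphXn; apply/eqP; rewrite eq_complex /= /arcterm.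
by apply/andP; split; apply/eqP; ring.
Qed.

Let laurent_g n : exists G, laurent u (g n) G.
Proof.
elim: n => [|n [G lG]].
  have l1 : laurent u (fun=> 1) 1.
    exists 1, 0; split; first by move=> z _; rewrite hornerC horner0 addr0.
    by rewrite -polyC1 bop_hornerC scale1r bop_horner0 addr0.
  have := laurentZ (2^-1)%:C%C
    (laurentD (laurent_mulz u_unit l1) (laurentZ (-1) (laurent_mulzV u_unit l1))).
  set G := (X in laurent _ _ X) => lG; exists G.
  have -> // : g 0 = (fun z => (2^-1)%:C%C * (z * 1 + -1 * (z^-1 * 1))).
  by apply/funext => z; rewrite /g expr0; move: z^-1 => w; ring.
have := laurentD (laurentZ (2^-1)%:C%C lG) (laurentZ (- (4^-1)%:C%C)
    (laurentD (laurent_mulz u_unit lG) (laurent_mulzV u_unit lG))).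
set G' := (X in laurent _ _ X) => lG'; exists G'.
have -> // : g n.+1 = (fun z => (2^-1)%:C%C * g n z +
    - (4^-1)%:C%C * (z * g n z + z^-1 * g n z)).
by apply/funext => z; rewrite /g exprS; move: z^-1 => w; ring.
Qed.

(** Half-length of a symmetric arc containing [[m, M]], as [arcsum_uniform] requires. *)
Let t0 := Num.max `|m| `|M|.

Let t0pi : 0 <= t0 < pi.
Proof.
by rewrite le_max normr_ge0/= gt_max !ltr_norml pm Mpi (lt_le_trans pm mM) (le_lt_trans mM Mpi).
Qed.

Let spec_le_t0 z : spec u z -> `|Arg z| <= t0.
Proof.
move=> /spec_arc[_ _ mA AM]; rewrite /t0 le_max !ler_norml.
by have [m0|m0] := leP 0 (Arg z);
  [apply/orP; right; rewrite ger0_norm//|apply/orP; left; rewrite ltr0_norm]; lra.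
Qed.

(** On the spectrum [g n] is imaginary and at most [hav t0 ^+ n] in modulus. Hence [G] is skew, and
    the form bound of the hermitian [-i G] is a norm bound. *)
Let laurent_g_opnorm n G : laurent u (g n) G -> opnorm G <= hav t0 ^+ n.
Proof.
move=> lG; have h0 : 0 <= hav t0 ^+ n by rewrite exprn_ge0// hav_ge0.
have gE z : spec u z -> g n z = (0 +i* arcterm n (Arg z))%C.
  by move=> uz; have [zE _ _ _] := spec_arc uz; rewrite {1}zE g_expi.
have tb z : spec u z -> `|arcterm n (Arg z)| <= hav t0 ^+ n.
  move=> uz; rewrite /arcterm normrM (ger0_norm (exprn_ge0 _ (hav_ge0 _))).
  rewrite -[leRHS]mul1r ler_pM ?exprn_ge0 ?hav_ge0 ?sin_max//.
  rewrite lerXn2r ?nnegrE ?hav_ge0//; apply: hav_le; last exact: spec_le_t0.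
  by case/andP: t0pi => -> /ltW ->.
have sG : skew ip G.
  move=> x; apply/eqP; rewrite eq_le; apply/andP; split.
    by rewrite -(mul0r (rp x x)); apply: (form_le lG) => z uz; rewrite gE.
  rewrite -oppr_le0 -ripNl -scaleN1r -(mul0r (rp x x)).
  by apply: (form_le (laurentZ (-1) lG)) => z uz; rewrite gE//=; lra.
have hB := skew_hermitian sG.
apply: opnorm_le => // x.
have -> : rnorm (G x) = rnorm ((- 'i%C *: G) x).
  by rewrite bopE scaleNr rnormN rnormJ.
apply: (hermitian_norm ip_norm hB) => // y; rewrite ler_norml; apply/andP; split.
  rewrite lerNl -ripNl -scaleN1r.
  apply: (form_le (laurentZ (-1) (laurentZ (- 'i%C) lG))) => z uz.
  by rewrite gE//=; have := tb z uz; rewrite ler_norml; lra.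
apply: (form_le (laurentZ (- 'i%C) lG)) => z uz.
by rewrite gE//=; have := tb z uz; rewrite ler_norml; lra.
Qed.

(** The witness is the sum of the series [i * arcsum] evaluated at [u]; it converges in norm because
    its coefficients are at most 1 and its terms are dominated by a geometric series. *)
Lemma log_exists : exists A, functional_calculus u (@Log R) A.
Proof.
have /choice[G lG] := laurent_g.
pose F N := \sum_(n < N) (acoef R n)%:C%C *: G n.
have lF N : laurent u (fun z => \sum_(n < N) (acoef R n)%:C%C * g n z) (F N).
  elim: N => [|N ih].
    exists 0, 0; split; first by move=> z _; rewrite big_ord0 !horner0 addr0.
    by rewrite /F big_ord0 !bop_horner0 addr0.
  have -> : F N.+1 = F N + (acoef R N)%:C%C *: G N by rewrite /F big_ord_recr.
  have -> : (fun z => \sum_(n < N.+1) (acoef R n)%:C%C * g n z) =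
      (fun z => \sum_(n < N) (acoef R n)%:C%C * g n z + (acoef R N)%:C%C * g N z).
    by apply/funext => z; rewrite big_ord_recr.
  exact: laurentD ih (laurentZ _ (lG N)).
have FC N : opnorm (F N.+1 - F N) <= 1 * hav t0 ^+ N.
  rewrite /F big_ord_recr/= addrAC subrr add0r mul1r.
  apply: opnorm_le => [|x]; first by rewrite exprn_ge0// hav_ge0.
  rewrite bopE rnormZ (ger0_norm (acoef_ge0 _ _)).
  rewrite (@le_trans _ _ (rnorm (G N x)))// ?ler_piMl ?rnorm_ge0 ?acoef_le1//.
  by rewrite (le_trans (rnorm_bop _ _))// ler_wpM2r ?rnorm_ge0// laurent_g_opnorm.
have q01 : 0 <= hav t0 < 1 by rewrite hav_ge0 hav_lt1.
have [A FA] := bop_geometric_cvg q01 FC.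
have /choice[p /choice[q pq]] := lF.
exists A, p, q; split; last first.
  have -> // : (fun n => bop_horner (p n) u + bop_horner (q n) v) = F.
  by apply/funext => N; have [_ ->] := pq N.
move=> e e0; apply: filterS (arcsum_uniform t0pi e0) => N Ne z uz.
have [zE LE _ _] := spec_arc uz; have [fE _] := pq N.
rewrite -fE ?(spec_neq0 u_unit)// LE.
have -> : \sum_(n < N) (acoef R n)%:C%C * g n z = (0 +i* arcsum N (Arg z))%C.
  elim: N {Ne fE} => [|N ih]; first by rewrite big_ord0 /arcsum big_ord0.
  have gz : g N z = (0 +i* arcterm N (Arg z))%C by rewrite {1}zE g_expi.
  rewrite big_ord_recr/= ih gz /arcsum big_ord_recr/=.
  by apply/eqP; rewrite eq_complex /=; apply/andP; split; apply/eqP; ring.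
have -> : (0 +i* Arg z)%C - (0 +i* arcsum N (Arg z))%C = (0 +i* (Arg z - arcsum N (Arg z)))%C.
  by apply/eqP; rewrite eq_complex /= subrr !eqxx.
rewrite normc_def/= expr0n/= add0r sqrtr_sqr ltcR.
exact: Ne (spec_le_t0 uz).
Qed.

Lemma unitary_log_bounds : [/\ ~ spec u (-1), theta_plus u <= M & m <= theta_minus u].
Proof.
(* Existence rules out the default value 0 of [xget]. *)
have fcA : functional_calculus u (@Log R) (bop_log u).
  have [A hA] := log_exists; rewrite /bop_log.
  by case: xgetP => [B _ //|/(_ A)].
have [sA AM mA] := log_numeric fcA.
(* By definition [theta_plus u] is [phi_plus (bop_log u)], and likewise for [theta_minus]. *)
split; [|exact: (phi_plus_le ip_norm H_nonzero)|exact: (phi_minus_ge ip_norm H_nonzero)].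
(* In the spectrum, -1 would have an argument in [[m, M]], where the cosine exceeds -1. *)
move=> /spec_arc[/(congr1 (@complex.Re R))/= c1 _ mArg ArgM].
have : cos pi < cos (Arg (-1 : R[i])).
  rewrite -(cos_norm (Arg _)) ltr_cos ?in_itv/= ?normr_ge0 ?pi_ge0 ?lexx//=.
    by rewrite ltr_norml (lt_le_trans pm)// (le_lt_trans ArgM).
  by rewrite ler_norml (le_trans (ltW pm))// (le_trans ArgM)// ltW.
by rewrite -c1 cospi ltxx.
Qed.

End UnitaryLog.

Theorem theorem4p4 (R : realType) (H : completeNormedModType R[i])
    (ip : {dot H for @conjC R[i]})
    (ip_norm : forall xi : H, ip xi xi = `|xi| ^+ 2)
    (H_separable : exists D : set H, countable D /\ dense D)
    (H_nonzero : exists xi : H, xi != 0)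
    (a b : R) (ab : a < b) (s : seq R) (gamma : R -> bop H)
    (gamma_unitary : forall t, t \in `[a, b] -> unitary ip (gamma t))
    (gamma_C1 : piecewise_C1 a b s gamma)
    (gamma_a : gamma a = 1)
    (int_plus : \int[lebesgue_measure]_(t in `[a, b])
                  phi_plus (right_logder a b gamma t) < pi)
    (int_minus : - pi < \int[lebesgue_measure]_(t in `[a, b])
                          phi_minus (right_logder a b gamma t)) :
  [/\ ~ spec (gamma b) (- 1),
      theta_plus (gamma b) <= \int[lebesgue_measure]_(t in `[a, b])
                                phi_plus (right_logder a b gamma t),
      \int[lebesgue_measure]_(t in `[a, b])
        phi_minus (right_logder a b gamma t) <= theta_minus (gamma b),
      theta_plus (gamma b) = \int[lebesgue_measure]_(t in `[a, b])
                               phi_plus (right_logder a b gamma t) ->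
        unitary_eig_plus (gamma b) =
          \bigcap_(t in off_partition a b s)
            skew_eig_plus (right_logder a b gamma t) /\
        \bigcap_(t in off_partition a b s)
            skew_eig_plus (right_logder a b gamma t) =
          \bigcap_(t in off_partition a b s)
            skew_eig_plus (left_logder a b gamma t) &
      theta_minus (gamma b) = \int[lebesgue_measure]_(t in `[a, b])
                                phi_minus (right_logder a b gamma t) ->
        unitary_eig_minus (gamma b) =
          \bigcap_(t in off_partition a b s)
            skew_eig_minus (right_logder a b gamma t) /\
        \bigcap_(t in off_partition a b s)
            skew_eig_minus (right_logder a b gamma t) =
          \bigcap_(t in off_partition a b s)
            skew_eig_minus (left_logder a b gamma t)].
Proof.
pose fp := fun t => phi_plus (right_logder a b gamma t).
pose fm := fun t => phi_minus (right_logder a b gamma t).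
have bI : b \in `[a, b] by rewrite in_itv/= lexx ltW.
have mM := primitive_minus_le_plus ip_norm H_nonzero ab gamma_unitary gamma_C1.
have arc x := gamma_arc ip_norm H_nonzero ab gamma_unitary gamma_C1 gamma_a x.
set M := \int[lebesgue_measure]_(t in `[a, b]) phi_plus _ in int_plus *.
set m := \int[lebesgue_measure]_(t in `[a, b]) phi_minus _ in int_minus *.
have {}mM : m <= M := mM.
have arc' x : cos ((M - m) / 2) * rip ip x x <= rip ip (rot ((M + m) / 2) (gamma b x)) x.
  have := arc x; rewrite -/(primitive fp a b) -/(primitive fm a b).
  have -> : primitive fp a b = M by [].
  have -> : primitive fm a b = m by [].
  have -> : 2^-1 * M - 2^-1 * m = (M - m) / 2 by ring.
  have -> : 2^-1 * M + 2^-1 * m = (M + m) / 2 by ring.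
  by apply; move: int_plus int_minus; lra.
have [sp tp tm] := unitary_log_bounds ip_norm H_nonzero (gamma_unitary b bI) int_minus mM int_plus arc'.
split => //.
- exact: (unitary_eig_plus_bigcap ip_norm H_nonzero ab gamma_unitary gamma_C1 gamma_a).
- exact: (unitary_eig_minus_bigcap ip_norm H_nonzero ab gamma_unitary gamma_C1 gamma_a).
Qed.
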